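(* Let $r\ge 2$ be an integer and let $\gamma=(\gamma_1,\dots,\gamma_{r-1})\in\mathbb{R}^{r-1}$ satisfy $\gamma_k\ge -1+\frac{k}{r}$ for all $k\in\{1,\dots,r-1\}$. Then the generalized Fourier transform $\mathcal{F}_\gamma$ is a topological isomorphism from $\mathcal{H}'_r(\mathbb{C})$ onto $\mathrm{Exp}_r(\mathbb{C})$.
   Context: A function $u:\mathbb{C}\to\mathbb{C}$ is $r$-even if $u(\omega^k z)=u(z)$ for all $z\in\mathbb{C}$ and $k\in\{1,\dots,r-1\}$, where $\omega=e^{2i\pi/r}$. $\mathcal{H}_r(\mathbb{C})$ is the Fréchet space of all $r$-even entire functions on $\mathbb{C}$ with the topology of uniform convergence on compact sets, given by the semi-norms $\|u\|_R=\sup_{|z|\le R}|u(z)|$, $R>0$. $\mathcal{H}'_r(\mathbb{C})$ is its strong dual. For $a>0$, $\mathrm{Exp}_{r,a}(\mathbb{C})$ is the Banach space of all $u\in\mathcal{H}_r(\mathbb{C})$ with $P_a(u)=\sup_{z\in\mathbb{C}}|u(z)|e^{-a|z|}<\infty$, with norm $P_a$. $\mathrm{Exp}_r(\mathbb{C})=\bigcup_{a>0}\mathrm{Exp}_{r,a}(\mathbb{C})$ (the $r$-even entire functions of exponential type), with the locally convex inductive limit topology. With $\mathbb{N}=\{0,1,2,\dots\}$, put $\alpha_{rn}(\gamma)=r^{rn}\,n!\prod_{i=1}^{r-1}\frac{\Gamma(\gamma_i+n+1)}{\Gamma(\gamma_i+1)}$ for $n\in\mathbb{N}$, and $j_\gamma(z)=\sum_{n=0}^{\infty}\frac{(-1)^n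 z^{rn}}{\alpha_{rn}(\gamma)}$, $z\in\mathbb{C}$ (an $r$-even entire function). For $T\in\mathcal{H}'_r(\mathbb{C})$ the generalized Fourier transform of $T$ is the function $\mathcal{F}_\gamma(T):\mathbb{C}\to\mathbb{C}$, $\mathcal{F}_\gamma(T)(z)=\langle T(w),j_\gamma(wz)\rangle$, i.e. $T$ applied to the function $w\mapsto j_\gamma(wz)$. *)

(* Defs.v *)
From HB Require Import structures.
From mathcomp Require Import all_boot all_order all_algebra.
From mathcomp Require Import all_classical all_reals all_analysis.
From mathcomp Require Import complex.

Set Implicit Arguments.
Unset Strict Implicit.
Unset Printing Implicit Defensive.

Import Order.TTheory GRing.Theory Num.Theory.
Import numFieldNormedType.Exports.

Local Open Scope classical_set_scope.
Local Open Scope ring_scope.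
Local Open Scope complex_scope.
Local Open Scope convex_scope.

Notation normc := ComplexField.Normc.normc.

(* C is written R[i]^o throughout, because MathComp-Analysis puts the norm
   topology on the regular module of a numFieldType. The real-valued modulus is
   normc (the library's `|z| is an element of R[i]). *)

Section HSpace.
Variables (R : realType) (r : nat).
Local Notation C := (R[i]^o).

Definition omega : C := cos (2 * pi / r%:R) +i* sin (2 * pi / r%:R).

Definition r_even (u : C -> C) : Prop :=
  forall (z : C) (k : nat), (1 <= k <= r.-1)%N -> u (omega ^+ k * z) = u z.

(* derivable is taken over the field R[i]: the limit of
   h^-1 (u (z + h) - u z) along complex h exists. *)
Definition entire (u : C -> C) : Prop := forall z : C, derivable u z 1.

Definition Hset : set (C -> C) := [set u | entire u /\ r_even u].

Definition Hpred : {pred (C -> C)} := mem Hset.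

Lemma Hpred_submod_closed : submod_closed Hpred.
Proof.
split.
  rewrite inE; split=> [z|//]; exact: derivable_cst.
move=> a u v; rewrite !inE => -[eu ru] [ev rv]; split.
  by move=> z; apply: derivableD => //; apply: derivableZ.
by move=> z k kr; rewrite !fctE ru ?rv.
Qed.

HB.instance Definition _ :=
  GRing.isSubmodClosed.Build R[i] (C -> C) Hpred Hpred_submod_closed.

Record Hspace := HSpace { Hfun :> C -> C ; _ : Hfun \in Hpred }.

HB.instance Definition _ := [isSub for Hfun].
HB.instance Definition _ := [Choice of Hspace by <:].
HB.instance Definition _ := [SubChoice_isSubLmodule of Hspace by <:].

(* Uniform convergence on compact sets. *)
HB.instance Definition _ := Topological.copy Hspace
  (initial_topology (Hfun : Hspace -> {family compact, C -> C})).

End HSpace.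

Section Dual.
Variables (K : numFieldType) (E : preTopologicalLmodType K).

Definition dual_pred : {pred (E -> K^o)} :=
  mem [set T : E -> K^o | linear T /\ continuous T].

Lemma dual_submod_closed : submod_closed dual_pred.
Proof.
split.
  rewrite inE; split=> [a u v|x]; last exact: cst_continuous.
  by rewrite /= /GRing.zero /= ?fctE scaler0 addr0.
move=> a S T; rewrite !inE => -[lS cS] [lT cT]; split.
  by move=> b u v; rewrite !fctE lS lT !scalerDr !scalerA [a * b]mulrC addrACA.
by move=> x; apply: cvgD; [apply: cvgZr; exact: cS|exact: cT].
Qed.

HB.instance Definition _ :=
  GRing.isSubmodClosed.Build K (E -> K^o) dual_pred dual_submod_closed.

Record dual := Dual { dual_fun :> E -> K^o ; _ : dual_fun \in dual_pred }.

HB.instance Definition _ := [isSub for dual_fun].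
HB.instance Definition _ := [Choice of dual by <:].
HB.instance Definition _ := [SubChoice_isSubLmodule of dual by <:].

(* B is bounded iff it is absorbed by every neighbourhood of 0. *)
Definition vN_bounded (B : set E) : Prop :=
  forall V : set E, nbhs 0 V -> exists2 s : K, 0 < s &
    forall t : K, s <= `|t| -> B `<=` [set t *: v | v in V].

(* Strong topology: uniform convergence on the bounded subsets of E. *)
HB.instance Definition _ := Topological.copy dual
  (initial_topology (dual_fun : dual -> {family vN_bounded, E -> K^o})).

End Dual.

Lemma convex_setE (K : numDomainType) (M : lmodType K) (A : set M) :
  convex_set (A : set (convex_lmodType M)) <->
  forall (x y : M) (l : {i01 K}), A x -> A y ->
    A (l%:num *: x + (1 - l%:num) *: y).
Proof.
split=> h x y l; last by rewrite !inE; exact: h.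
by move=> Ax Ay; apply/set_mem; apply: (h x y l); rewrite inE.
Qed.

Section ExpSpace.
Variables (R : realType) (r : nat).
Local Notation C := (R[i]^o).
Local Notation H := (Hspace R r).

(* expnorm a u is P_a(u), with value +oo when u is not in Exp_(r,a), so that
   Exp_(r,a) is the set of u in Hspace R r with (expnorm a u < +oo)%E. *)
Definition expnorm (a : R) (u : C -> C) : \bar R :=
  ereal_sup [set (normc (u z) * expR (- (a * normc z)))%:E | z in [set: C]].

Arguments expnorm (a u)%_R.

Definition exp_type (u : C -> C) : Prop :=
  exists2 a : R, 0 < a & (expnorm a u < +oo)%E.

Definition exp_pred : {pred H} := mem [set u : H | exp_type u].

Lemma normc_ge0 (z : R[i]) : 0 <= normc z.
Proof. by case: z => x y; rewrite sqrtr_ge0. Qed.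

Lemma expnorm_leP (a M : R) (u : C -> C) :
  (expnorm a u <= M%:E)%E <->
  forall z, normc (u z) * expR (- (a * normc z)) <= M.
Proof.
split=> [h z|h].
  by rewrite -lee_fin; apply: le_trans h; apply: ereal_sup_ubound; exists z.
by apply: ge_ereal_sup => _ [z _ <-]; rewrite lee_fin.
Qed.

Lemma expnorm_ltyP (a : R) (u : C -> C) :
  (expnorm a u < +oo)%E ->
  exists2 M : R, 0 < M & (expnorm a u <= M%:E)%E.
Proof.
move=> h; exists (Num.max 1 (fine (expnorm a u))); first by rewrite lt_max ltr01.
case E: (expnorm a u) h => [x| |] // _; last by rewrite leNye.
by rewrite lee_fin le_max lexx orbT.
Qed.

Lemma expnorm_le0 (a : R) : (expnorm a (0 : H) <= 0%:E)%E.
Proof.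
apply/expnorm_leP => z.
by rewrite [normc _]ComplexField.Normc.normc0 mul0r.
Qed.

Lemma expnormZ_le (a M : R) (t : C) (u : H) :
  (expnorm a u <= M%:E)%E -> (expnorm a (t *: u) <= (normc t * M)%:E)%E.
Proof.
move=> /expnorm_leP h; apply/expnorm_leP => z.
rewrite [normc _]ComplexField.Normc.normcM -mulrA.
by rewrite ler_wpM2l ?normc_ge0 ?h.
Qed.

Lemma expnormD_le (a M N : R) (u v : H) :
  (expnorm a u <= M%:E)%E -> (expnorm a v <= N%:E)%E ->
  (expnorm a (u + v) <= (M + N)%:E)%E.
Proof.
move=> /expnorm_leP hu /expnorm_leP hv; apply/expnorm_leP => z.
apply: le_trans (lerD (hu z) (hv z)); rewrite -mulrDl.
apply: ler_wpM2r; first exact: expR_ge0.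
exact: (@le_normcD R (u z) (v z)).
Qed.

Lemma expnorm_le_mono (a b M : R) (u : C -> C) : a <= b ->
  (expnorm a u <= M%:E)%E -> (expnorm b u <= M%:E)%E.
Proof.
move=> ab /expnorm_leP h; apply/expnorm_leP => z; apply: le_trans (h z).
by rewrite ler_wpM2l ?normc_ge0// ler_expR lerN2 ler_wpM2r ?normc_ge0.
Qed.

Lemma exp_submod_closed : submod_closed exp_pred.
Proof.
split.
  rewrite inE; exists 1; first exact: ltr01.
  by apply: (le_lt_trans (expnorm_le0 _)); rewrite ltry.
move=> t u v; rewrite !inE => -[a a0 /expnorm_ltyP[M _ hM]].
move=> [b b0 /expnorm_ltyP[N _ hN]].
exists (Num.max a b); first by rewrite lt_max a0.
apply: (@le_lt_trans _ _ (normc t * M + N)%:E); last by rewrite ltry.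
apply: expnormD_le.
  by apply: expnormZ_le; apply: expnorm_le_mono hM; rewrite le_max lexx.
by apply: expnorm_le_mono hN; rewrite le_max lexx orbT.
Qed.

HB.instance Definition _ :=
  GRing.isSubmodClosed.Build R[i] H exp_pred exp_submod_closed.

Record Expspace := ExpSpace { Expfun :> H ; _ : Expfun \in exp_pred }.

HB.instance Definition _ := [isSub for Expfun].
HB.instance Definition _ := [Choice of Expspace by <:].
HB.instance Definition _ := [SubChoice_isSubLmodule of Expspace by <:].

(* Locally convex inductive limit topology: a convex set W is a basic
   neighbourhood of 0 iff, for every a > 0, its trace on Exp_(r,a) contains a
   ball around 0 for the norm P_a. Exp_final below shows that this is a locally
   convex topology with the universal property of the inductive limit. *)
Definition Exp_nbhs0 (W : set Expspace) : Prop :=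
  convex_set W /\
  forall a : R, 0 < a -> exists2 e : R, 0 < e &
    forall v : Expspace, (expnorm a v < e%:E)%E -> W v.

Definition Exp_open (U : set Expspace) : Prop :=
  forall u, U u -> exists2 W, Exp_nbhs0 W & forall w, W w -> U (u + w).

Lemma Exp_nbhs0T : Exp_nbhs0 setT.
Proof.
split; first by move=> x y l _ _; rewrite inE.
by move=> a _; exists 1.
Qed.

Lemma Exp_nbhs0I V W : Exp_nbhs0 V -> Exp_nbhs0 W -> Exp_nbhs0 (V `&` W).
Proof.
move=> [cV bV] [cW bW]; split.
  move=> x y l; rewrite !inE => -[Vx Wx] [Vy Wy].
  by split; apply/set_mem; [apply: cV|apply: cW]; rewrite inE.
move=> a a0; have [d d0 dV] := bV a a0; have [e e0 eW] := bW a a0.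
exists (Num.min d e); first by rewrite lt_min d0 e0.
move=> v hv; split; [apply: dV|apply: eW]; apply: lt_le_trans hv _;
  by rewrite lee_fin ge_min lexx ?orbT.
Qed.

Lemma Exp_nbhs0_0 W : Exp_nbhs0 W -> W 0.
Proof.
move=> [_ /(_ 1 ltr01)[e e0]]; apply.
by apply: (le_lt_trans (expnorm_le0 _)); rewrite lte_fin.
Qed.

Lemma Exp_nbhs0Z W (t : R) : 0 < t -> Exp_nbhs0 W ->
  Exp_nbhs0 [set v | forall s : C, normc s <= t -> W (s *: v)].
Proof.
move=> t0 [cW bW]; split.
  apply/convex_setE => x y l Wx Wy s st; rewrite scalerDr !scalerA.
  rewrite [s * _]mulrC [s * _]mulrC -!scalerA.
  by move/convex_setE: cW; apply; [exact: Wx|exact: Wy].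
move=> a a0; have [e e0 eW] := bW a a0.
exists (e / 2 / t); first by rewrite !divr_gt0.
move=> v hv s st; apply: eW.
apply: (@le_lt_trans _ _ (normc s * (e / 2 / t))%:E).
  by apply: expnormZ_le; apply: ltW.
rewrite lte_fin (@le_lt_trans _ _ (t * (e / 2 / t)))//.
  by rewrite ler_wpM2r// ltW// !divr_gt0.
by rewrite mulrC divfK ?gt_eqF// ltr_pdivrMr// ltr_pMr// ltr1n.
Qed.

Lemma Exp_nbhs0_abs W (u : Expspace) : Exp_nbhs0 W ->
  exists2 d : R, 0 < d & forall s : C, normc s <= d -> W (s *: u).
Proof.
move=> [_ bW].
have [a a0 /expnorm_ltyP[M M0 hM]] : exp_type u by have := valP u; rewrite inE.
have [e e0 eW] := bW a a0.
exists (e / 2 / M); first by rewrite !divr_gt0.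
move=> s hs; apply: eW; apply: (le_lt_trans (expnormZ_le s hM)).
rewrite lte_fin (@le_lt_trans _ _ ((e / 2 / M) * M))//.
  by rewrite ler_wpM2r// ltW.
by rewrite divfK ?gt_eqF// ltr_pdivrMr// ltr_pMr// ltr1n.
Qed.

Lemma Exp_openT : Exp_open setT.
Proof. by move=> u _; exists setT => //; exact: Exp_nbhs0T. Qed.

Lemma Exp_openI : setI_closed Exp_open.
Proof.
move=> U V oU oV u [/oU[A hA AU] /oV[B hB BV]].
exists (A `&` B); first exact: Exp_nbhs0I.
by move=> w [/AU ? /BV].
Qed.

Lemma Exp_open_bigU (I : Type) (f : I -> set Expspace) :
  (forall i, Exp_open (f i)) -> Exp_open (\bigcup_i f i).
Proof.
move=> of_ u [i _ /of_[W hW WU]].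
by exists W => // w /WU ?; exists i.
Qed.

HB.instance Definition _ :=
  isOpenTopological.Build Expspace Exp_openT Exp_openI Exp_open_bigU.

Lemma Exp_nbhs0_half W : Exp_nbhs0 W ->
  exists2 V, Exp_nbhs0 V & forall x y, V x -> V y -> W (x + y).
Proof.
move=> hW; exists [set v | forall s : C, normc s <= 2 -> W (s *: v)].
  exact: Exp_nbhs0Z.
move=> x y Vx Vy; have [/convex_setE cW _] := hW.
have n2 : normc (2 : C) <= 2.
  by rewrite (le_trans (@le_normcD R 1 1))// ComplexField.Normc.normc1.
have i0 : 0 <= (2^-1 : R[i]) by rewrite invr_ge0 ler0n.
have i1 : (2^-1 : R[i]) <= 1 by rewrite invf_le1 ?ler1n// ltr0n.
have := cW _ _ (Itv01 i0 i1) (Vx _ n2) (Vy _ n2).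
rewrite /= !scalerA mulVf ?pnatr_eq0// scale1r.
suff -> : (1 - 2^-1) * (2 : R[i]) = 1 by rewrite scale1r.
by rewrite mulrBl mul1r mulVf ?pnatr_eq0// -[2]/(1 + 1 : R[i]) addrK.
Qed.

Lemma Exp_nbhsP (u : Expspace) (U : set Expspace) :
  nbhs u U <-> exists2 W, Exp_nbhs0 W & forall w, W w -> U (u + w).
Proof.
split.
  rewrite nbhsE => -[A [oA Au] AU].
  by have [W hW WA] := oA u Au; exists W => // w /WA /AU.
move=> [W hW WU]; rewrite nbhsE.
exists [set v | exists2 W, Exp_nbhs0 W & forall w, W w -> U (v + w)].
  split; last by exists W.
  move=> v [V hV VU]; have [V' hV' VV] := Exp_nbhs0_half hV.
  exists V' => // x V'x; exists V' => // w V'w.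
  by rewrite -addrA; apply/VU/VV.
by move=> v [V hV VU]; have := VU 0 (Exp_nbhs0_0 hV); rewrite addr0.
Qed.

Lemma Exp_add_continuous :
  continuous (fun x : Expspace * Expspace => x.1 + x.2).
Proof.
move=> [u v] U /Exp_nbhsP[W hW WU]; have [V hV VV] := Exp_nbhs0_half hW.
exists ([set u + w | w in V], [set v + w | w in V]).
  by split; apply/Exp_nbhsP; exists V => // w Vw; exists w.
move=> [_ _] [/= [x Vx <-] [y Vy <-]].
by rewrite addrACA; apply/WU/VV.
Qed.

Lemma Exp_scale_continuous :
  continuous (fun z : R[i]^o * Expspace => z.1 *: z.2).
Proof.
move=> [t u] U /Exp_nbhsP[W hW WU]; have [V hV VV] := Exp_nbhs0_half hW.
have [d d0 dV] := Exp_nbhs0_abs u hV.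
have hV' := Exp_nbhs0Z (ltr_pwDl d0 (normc_ge0 t)) hV.
set V' := [set _ | _] in hV'.
exists ([set s : R[i]^o | normc (s - t) <= d], [set u + w | w in V']).
  split; last by apply/Exp_nbhsP; exists V' => // w V'w; exists w.
  rewrite -nbhs_ballE; exists (d%:C); first by rewrite /= ltcR.
  move=> s; rewrite -ball_normE /= => ts.
  by rewrite -lecR -[leLHS](@distrC _ R[i]^o); apply: ltW.
move=> [s _] [/= hs [w V'w <-]].
suff -> : s *: (u + w) = t *: u + ((s - t) *: u + s *: w).
  apply/WU/VV; first exact: dV.
  apply: V'w; rewrite -[s](subrK t).
  by rewrite (le_trans (le_normcD _ _))// lerD2r.
by rewrite scalerBl addrA [t *: u + _]addrC subrK scalerDr.
Qed.

Lemma Exp_locally_convex : exists2 B : set_system Expspace,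
  (forall b, b \in B -> convex_set b) & basis B.
Proof.
exists [set U | open U /\ convex_set U].
  by move=> b; rewrite inE => -[].
split; first by move=> b [].
move=> u U /Exp_nbhsP[W hW WU].
exists [set v | exists2 V, Exp_nbhs0 V & forall w, V w -> W (v - u + w)]; last first.
  move=> v [V hV VW]; rewrite -[v](addrNK u) addrC; apply: WU.
  by have := VW 0 (Exp_nbhs0_0 hV); rewrite addr0.
split; last by exists W => // w; rewrite subrr add0r.
split.
  move=> v [V hV VW]; have [V' hV' VV] := Exp_nbhs0_half hV.
  exists V' => // x V'x; exists V' => // w V'w.
  by have := VW _ (VV _ _ V'x V'w); rewrite addrA [v - u + x]addrAC.
apply/convex_setE => x y l [V hV VW] [V' hV' VW'].
exists (V `&` V'); first exact: Exp_nbhs0I.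
move=> w [Vw V'w]; have [/convex_setE cW _] := hW.
have := cW _ _ l (VW w Vw) (VW' w V'w); congr (W _).
rewrite !scalerDr addrACA -scalerDl [X in X + _]addrACA -scalerDl.
by rewrite [l%:num + _]addrC subrK !scale1r.
Qed.

HB.instance Definition _ := PreTopologicalLmod_isTvs.Build R[i] Expspace
  Exp_add_continuous Exp_scale_continuous Exp_locally_convex.

Lemma Exp_final (F : tvsType R[i]) (f : {linear Expspace -> F}) :
  continuous f <->
  forall a : R, 0 < a -> forall V : set F, nbhs 0 V -> exists2 e : R, 0 < e &
    forall v : Expspace, (expnorm a v < e%:E)%E -> V (f v).
Proof.
split=> [cf a a0 V V0|h u U].
  have /Exp_nbhsP[W [_ /(_ a a0)[e e0 eW]] WV] : nbhs (0 : Expspace) (f @^-1` V).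
    by apply: cf; rewrite linear0.
  by exists e => // v /eW /WV; rewrite /= add0r.
move=> Ufu; have := nbhsB (- f u) Ufu; rewrite addNr => U0.
have [B cB [oB bB]] := @locally_convex _ F.
have [b [Bb b0] bU] := bB 0 _ U0.
apply/Exp_nbhsP; exists (f @^-1` b).
  split.
    apply/convex_setE => x y l bx by_; rewrite /= linearD !linearZ.
    by have /convex_setE := cB b (mem_set Bb); apply.
  by move=> a a0; apply: h => //; apply: open_nbhs_nbhs; split=> //; exact: oB.
move=> w /= bw; have [x Ux] := bU _ bw; rewrite linearD => <-.
by rewrite addrA subrr add0r.
Qed.

End ExpSpace.

(* Euler's integral, which is the Gamma function on x > 0 only. *)
Definition Gamma (R : realType) (x : R) : R :=
  \int[lebesgue_measure]_(t in `]0, +oo[) (t `^ (x - 1) * expR (- t)).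

(* The index k : 'I_r.-1 starts at 0: gamma k is gamma_(k+1) in 1-based
   notation, and alpha n is alpha_(rn). *)
Section Fourier.
Variables (R : realType) (r : nat) (gamma : 'I_r.-1 -> R).
Local Notation C := (R[i]^o).
Local Notation H := (Hspace R r).

Definition alpha (n : nat) : R :=
  r%:R ^+ (r * n) * n`!%:R *
  \prod_(k < r.-1) (Gamma (gamma k + n%:R + 1) / Gamma (gamma k + 1)).

Definition jgamma (z : C) : C :=
  limn (series (fun n => (-1) ^+ n * z ^+ (r * n) / (alpha n)%:C) : C^nat).

(* insubd 0 f is f as an element of Hspace R r if f lies in it, and 0
   otherwise. *)
Definition fourier (T : dual H) (z : C) : C :=
  T (insubd 0 (fun w : C => jgamma (w * z))).

End Fourier.

Definition topological_isomorphism (K : numDomainType)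
    (E F : preTopologicalLmodType K) (f : E -> F) : Prop :=
  linear f /\ continuous f /\
  exists g : F -> E, [/\ cancel f g, cancel g f & continuous g].

(* Main.v *)
Require Import Defs.
From HB Require Import structures.
From mathcomp Require Import all_boot all_order all_algebra.
From mathcomp Require Import all_classical all_reals all_analysis.
From mathcomp Require Import measurable_realfun complex ring lra.
Import Order.TTheory GRing.Theory Num.Theory.
Import numFieldNormedType.Exports.
Set Implicit Arguments.
Unset Strict Implicit.
Unset Printing Implicit Defensive.
Local Open Scope classical_set_scope.
Local Open Scope ring_scope.
Local Open Scope complex_scope.

(* An r-even entire function is u(z) = sum_n u_n z^(rn), and the topology of
   H_r is given by the norms sum_n |u_n| rho^(rn). A continuous functional T is
   therefore determined by t_n = T(z^(rn)), which satisfies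
   |t_n| <= K rho^(rn), and F(T)(z) = sum_n (-1)^n t_n z^(rn) / alpha_n. Since
   Gamma(x + 1) = x Gamma(x), alpha_n equals (rn)! up to factors that are
   geometric in n, so that division by alpha_n turns this growth condition into
   exponential type. The inverse sends v = sum_n v_n z^(rn) to
   u |-> sum_n (-1)^n alpha_n v_n u_n, and it is continuous on each Exp_(r,a).
   F itself is continuous because, for every convex W absorbing balls of all the
   spaces Exp_(r,a), the set of the multiples of the z^(rn) that witness the
   failure of a suitable multiple of z^(rn) / alpha_n to lie in W is bounded.

   Complex differentiability is not assumed to be continuous, so Taylor
   expansions rest on Goursat's bisection argument. It is carried out on
   trapezoidal sums along polygons, for which affine functions have sum exactly 0
   around a closed polygon; no integral is needed. The outcome is Cauchy's
   estimate |f'(p)| <= 8 M / rho, and everything else follows from it. *)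

(** Dilations of z act as isomorphisms on H_r and on Exp_r, so a factor geometric in n only changes
    a radius or a type, and these are existentially quantified throughout. Hence crude constants
    suffice: (16 / rho)^n replaces the sharp rho^-n for Taylor coefficients, and A^n, B^n may be
    anything. Conversely, enlarging a radius buys a factor 2^-n or 4^-n; limits of series are
    therefore handled through a geometric bound on the distance to the N-th partial sum, from which
    uniqueness and linearity are elementary. The delicate point is the continuity of F. A
    neighbourhood of 0 in the inductive limit is only known to contain balls whose radius depends on
    a in an uncontrolled way, yet a single bounded subset of H_r has to handle all of them at once.
    The weights 2^-(n+1) of a convex combination reduce the question to one condition per monomial,
    and 4^-n in the tail estimates is what survives multiplication by the inverse weights. *)

Section ComplexModulus.
Variable R : realType.
Implicit Types x y z : R[i].

Lemma normc_eq0 z : (normc z == 0) = (z == 0).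
Proof.
apply/eqP/eqP => [/ComplexField.Normc.eq0_normc//|->].
exact: ComplexField.Normc.normc0.
Qed.

Lemma normc0 : normc (0 : R[i]) = 0.
Proof. exact: ComplexField.Normc.normc0. Qed.

Lemma normc1 : normc (1 : R[i]) = 1.
Proof. exact: ComplexField.Normc.normc1. Qed.

Lemma normcM x y : normc (x * y) = normc x * normc y.
Proof. exact: ComplexField.Normc.normcM. Qed.

Lemma normcV x : normc x^-1 = (normc x)^-1.
Proof. exact: ComplexField.Normc.normcV. Qed.

Lemma normc_gt0 z : (0 < normc z) = (z != 0).
Proof. by rewrite lt_def normc_ge0 andbT normc_eq0. Qed.

Lemma normcD x y : normc (x + y) <= normc x + normc y.
Proof. exact: le_normcD. Qed.

Lemma normcBC x y : normc (x - y) = normc (y - x).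
Proof. by rewrite -normcN opprB. Qed.

Lemma normcB x y : normc (x - y) <= normc x + normc y.
Proof. by rewrite -(normcN y) normcD. Qed.

Lemma normcX z n : normc (z ^+ n) = normc z ^+ n.
Proof. by elim: n => [|n IH]; rewrite ?expr0 ?normc1// !exprS normcM IH. Qed.

Lemma normcR (a : R) : normc a%:C = `|a|.
Proof. by rewrite /= expr0n addr0 sqrtr_sqr. Qed.

Lemma normc_nat n : normc (n%:R : R[i]) = n%:R.
Proof. by rewrite -(rmorph_nat (real_complex R)) normcR normr_nat. Qed.

Lemma normcE z : `|z| = (normc z)%:C.
Proof. by case: z. Qed.

Lemma normc_Re z : `|complex.Re z| <= normc z.
Proof. by have := normc_ge_Re z; rewrite normcE lecR. Qed.

Lemma normc_Im z : `|complex.Im z| <= normc z.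
Proof.
case: z => a b /=; rewrite -(sqrtr_sqr b) ler_wsqrtr//.
by rewrite lerDr sqr_ge0.
Qed.

Lemma normc_ReIm z : normc z <= `|complex.Re z| + `|complex.Im z|.
Proof.
case: z => a b /=; rewrite -[leRHS]ger0_norm ?addr_ge0// -sqrtr_sqr.
rewrite ler_wsqrtr// sqrrD !real_normK ?num_real// lerD2r lerDl.
by rewrite mulrn_wge0 ?mulr_ge0.
Qed.

Lemma normc_triangle x y z : normc (x - z) <= normc (x - y) + normc (y - z).
Proof. by rewrite -{1}(subrK y x) -addrA normcD. Qed.

(** Completeness in the form of nested intervals, with the supremum of the left ends as the point.
    It supplies the limits in [cauchy_limit] and [square_bisection]. *)
Lemma separating_point (a b : nat -> R) : (forall n m, a n <= b m) ->
  exists l, forall n, a n <= l <= b n.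
Proof.
move=> ab; exists (sup (range a)) => n.
have ub m : ubound (range a) (b m) by move=> _ [k _ <-].
have ne : range a !=set0 by exists (a 0%N), 0%N.
apply/andP; split; last exact: ge_sup.
by apply: ub_le_sup; [exists (b 0%N)|exists n].
Qed.

(** Keeps the rate of convergence; the factor 2 comes from treating real and imaginary parts
    separately. *)
Lemma cauchy_limit (u : nat -> R[i]) (e : nat -> R) :
  (forall n m, (n <= m)%N -> normc (u m - u n) <= e n) ->
  exists l, forall n, normc (l - u n) <= 2 * e n.
Proof.
move=> cu.
have lim (p : R[i] -> R) : (forall z, `|p z| <= normc z) ->
    (forall x y, p (x - y) = p x - p y) ->
    exists l, forall n, `|l - p (u n)| <= e n.
  move=> pn pB; have h n m : (n <= m)%N -> `|p (u m) - p (u n)| <= e n.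
    by move=> nm; rewrite -pB (le_trans (pn _))// cu.
  have [n m|l hl] := @separating_point (fun n => p (u n) - e n)
      (fun n => p (u n) + e n).
    rewrite lerBlDr -addrA -lerBlDl.
    have ge0 k : 0 <= e k by apply: le_trans (h k k (leqnn _)).
    case: (leqP n m) => [nm|/ltnW mn].
      have := h _ _ nm; rewrite distrC => /(le_trans (ler_norm _)) /le_trans.
      by apply; rewrite lerDr ge0.
    by have := h _ _ mn => /(le_trans (ler_norm _)) /le_trans; apply; rewrite lerDl ge0.
  exists l => n; rewrite ler_distl; have /andP[h1 h2] := hl n.
  by rewrite h1 h2.
have ReB (x y : R[i]) : complex.Re (x - y) = complex.Re x - complex.Re y.
  by case: x y => [? ?] [? ?].
have ImB (x y : R[i]) : complex.Im (x - y) = complex.Im x - complex.Im y.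
  by case: x y => [? ?] [? ?].
have [a ha] := lim _ normc_Re ReB; have [b hb] := lim _ normc_Im ImB.
exists (a +i* b) => n; rewrite (le_trans (normc_ReIm _))// mulr2n mulrDl mul1r.
by rewrite ReB ImB lerD.
Qed.

End ComplexModulus.

(** * Bisection of the unit square *)

Section Bisection.
Variable R : realType.

Lemma halfE (h : R) : h / 2 + h / 2 = h.
Proof. by rewrite -splitr. Qed.

Lemma exists_expr_lt (q d : R) : 0 <= q < 1 -> 0 < d -> exists n, q ^+ n < d.
Proof.
move=> /andP[q0 q1] d0; have := @cvg_expr R q.
rewrite ger0_norm// => /(_ q1) /cvgrPdist_lt /(_ _ d0) [N _ hN].
exists N; have := hN N (leqnn N).
by rewrite /= sub0r normrN ger0_norm ?exprn_ge0.
Qed.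

(** If [P] failed on the unit square, it would fail on a sequence of nested quarters shrinking to a
    point, against the local hypothesis there. This stands in for compactness in [goursat],
    [mean_value] and [holomorphic_bounded]. *)
Lemma square_bisection (P : R -> R -> R -> Prop) :
  (forall a b h : R, 0 < h -> P a b (h / 2) -> P (a + h / 2) b (h / 2) ->
    P a (b + h / 2) (h / 2) -> P (a + h / 2) (b + h / 2) (h / 2) -> P a b h) ->
  (forall x y : R, 0 <= x <= 1 -> 0 <= y <= 1 -> exists2 d : R, 0 < d &
    forall a b h : R, 0 < h -> h < d -> a <= x <= a + h -> b <= y <= b + h ->
      0 <= a -> a + h <= 1 -> 0 <= b -> b + h <= 1 -> P a b h) ->
  P 0 0 1.
Proof.
move=> step loc; apply: contrapT => nP.
pose bad (s : R * R * R) := 0 < s.2 /\ ~ P s.1.1 s.1.2 s.2.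
have next s : exists t, bad s -> [/\ bad t, t.2 = s.2 / 2,
    s.1.1 <= t.1.1 <= s.1.1 + s.2 / 2 & s.1.2 <= t.1.2 <= s.1.2 + s.2 / 2].
  have [[h0 nPs]|nb] := pselect (bad s); last by exists s.
  apply: contrapT => /forallNP none; apply: nPs.
  have h20 : 0 < s.2 / 2 by rewrite divr_gt0.
  have try a b : s.1.1 <= a <= s.1.1 + s.2 / 2 ->
      s.1.2 <= b <= s.1.2 + s.2 / 2 -> P a b (s.2 / 2).
    move=> ha hb; apply: contrapT => nPab; apply: (none (a, b, s.2 / 2)) => _.
    by split.
  by apply: step => //; apply: try; lra.
have [f fP] := choice next.
pose s n := iter n f (0, 0, 1).
have bs n : bad (s n).
  elim: n => [|n IH]; first by split => //=.
  by have [] := fP _ IH.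
have sS n : [/\ (s n.+1).2 = (s n).2 / 2,
    (s n).1.1 <= (s n.+1).1.1 <= (s n).1.1 + (s n).2 / 2 &
    (s n).1.2 <= (s n.+1).1.2 <= (s n).1.2 + (s n).2 / 2].
  by have [] := fP _ (bs n).
(* Serves both coordinates: left ends increase and right ends decrease, so each left end is below
   every right end. *)
have mono (c : nat -> R) :
    (forall n, c n <= c n.+1 <= c n + (s n).2 / 2) ->
    (forall n m, c n <= c m + (s m).2) /\ forall n, c 0%N <= c n /\
      c n + (s n).2 <= c 0%N + (s 0%N).2.
  move=> cS.
  have up n k : c n <= c (n + k)%N /\ c (n + k)%N + (s (n + k)%N).2 <= c n + (s n).2.
    elim: k => [|k [IH1 IH2]]; first by rewrite addn0.
    have := cS (n + k)%N; have [hs _ _] := sS (n + k)%N.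
    by have [h0 _] := bs (n + k)%N; rewrite addnS hs; lra.
  split=> [n m|n]; last by have := up 0%N n; rewrite add0n.
  case: (leqP n m) => [/subnKC|/ltnW/subnKC] <-.
    by have [h1 _] := up n (m - n)%N; have [h0 _] := bs (n + (m - n))%N; lra.
  have [_ h1] := up m (n - m)%N; have [h0 _] := bs (m + (n - m))%N; lra.
have [|xl xr] := mono (fun n => (s n).1.1); first by move=> n; have [] := sS n.
have [|yl yr] := mono (fun n => (s n).1.2); first by move=> n; have [] := sS n.
have [x hx] := separating_point xl; have [y hy] := separating_point yl.
have hs n : (s n).2 = 2^-1 ^+ n.
  by elim: n => [|n IH]//; have [-> _ _] := sS n; rewrite IH exprSr.
have [||d d0 dP] := loc x y.
- by have := hx 0%N; rewrite /= add0r.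
- by have := hy 0%N; rewrite /= add0r.
have [|n hn] := @exists_expr_lt 2^-1 d _ d0; first by rewrite invr_ge0 ler0n invf_lt1 ?ltr1n.
have [h0 nPn] := bs n; apply: nPn; have [x1 x2] := xr n; have [y1 y2] := yr n.
move: x1 x2 y1 y2; rewrite /= add0r => *.
by apply: dP; rewrite ?hs// -?hs.
Qed.

End Bisection.

(** * Goursat's lemma and Cauchy's estimate *)

Section Goursat.
Variable R : realType.
Local Notation C := R[i].
Implicit Types (f q : C -> C) (z w : C).

(** The difference quotient is cleared of its denominator, so that w = z is no exception and all
    epsilons are real. *)
Definition cdiff f z (d : C) := forall e : R, 0 < e -> exists2 D : R, 0 < D &
  forall w, normc (w - z) < D ->
    normc (f w - f z - d * (w - z)) <= e * normc (w - z).

(* Trapezoidal sum of [q dz] over [2 ^ n] steps along the arc [g] restricted to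
   [a, a + h]. *)
Fixpoint psum q (g : R -> C) n (a h : R) : C :=
  if n is n'.+1 then psum q g n' a (h / 2) + psum q g n' (a + h / 2) (h / 2)
  else (q (g a) + q (g (a + h))) / 2 * (g (a + h) - g a).

Lemma psumD q1 q2 g n a h :
  psum (fun z => q1 z + q2 z) g n a h = psum q1 g n a h + psum q2 g n a h.
Proof.
elim: n a h => [|n IH] a h /=; last by rewrite !IH addrACA.
by rewrite -mulrDl -mulrDl addrACA.
Qed.

(** The trapezoidal rule is exact on affine integrands: each step gives the increment of the
    primitive A z + B z^2 / 2. *)
Lemma psum_linear (A B : C) g n a h :
  psum (fun z => A + B * z) g n a h =
  (A * g (a + h) + B / 2 * g (a + h) ^+ 2) - (A * g a + B / 2 * g a ^+ 2).
Proof.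
elim: n a h => [|n IH] a h /=; last by rewrite !IH -(addrA a) halfE; ring.
by field.
Qed.

Lemma eq_psum q1 q2 (g1 g2 : R -> C) n a h : 0 <= h ->
  (forall x, a <= x <= a + h -> q1 (g1 x) = q2 (g2 x)) ->
  (forall x, a <= x <= a + h -> g1 x = g2 x) ->
  psum q1 g1 n a h = psum q2 g2 n a h.
Proof.
elim: n a h => [|n IH] a h /= h0 eq eg.
  by rewrite !eq ?eg// lexx lerDl h0.
have h20 : 0 <= h / 2 by rewrite divr_ge0.
by rewrite !IH // => x hx; (apply: eq || apply: eg); move: hx; lra.
Qed.

Lemma psum_le q (g : R -> C) n a h (M L : R) : 0 <= h -> 0 <= M ->
  (forall x, a <= x <= a + h -> normc (q (g x)) <= M) ->
  (forall x y, a <= x <= a + h -> a <= y <= a + h ->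
    normc (g x - g y) <= L * `|x - y|) ->
  normc (psum q g n a h) <= M * (L * h).
Proof.
move=> + M0; elim: n a h => [|n IH] a h /= h0 qM gL.
  rewrite normcM ler_pM ?normc_ge0//.
    rewrite normcM normcV normc_nat ler_pdivrMr// mulr_natr mulr2n.
    by rewrite (le_trans (normcD _ _))// lerD// qM// lexx lerDl h0.
  have := gL (a + h) a; rewrite addrAC subrr add0r ger0_norm//.
  by apply; rewrite lexx lerDl h0.
have h20 : 0 <= h / 2 by rewrite divr_ge0.
have -> : M * (L * h) = M * (L * (h / 2)) + M * (L * (h / 2)) by field.
rewrite (le_trans (normcD _ _))// lerD// IH//.
- by move=> x hx; apply: qM; move: hx; lra.
- by move=> x y hx hy; apply: gL; move: hx hy; lra.
- by move=> x hx; apply: qM; move: hx; lra.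
- by move=> x y hx hy; apply: gL; move: hx hy; lra.
Qed.

Definition bsum q (phi : R -> R -> C) n (a b h : R) : C :=
  psum q (phi ^~ b) n a h + psum q (phi (a + h)) n b h
  - psum q (phi ^~ (b + h)) n a h - psum q (phi a) n b h.

(** Halving a side consumes one refinement level of [psum], so the inner sides of the four quarters
    carry identical sums and cancel exactly. *)
Lemma bsum_split q phi n a b h :
  bsum q phi n.+1 a b h =
    bsum q phi n a b (h / 2) + bsum q phi n (a + h / 2) b (h / 2) +
    bsum q phi n a (b + h / 2) (h / 2) +
    bsum q phi n (a + h / 2) (b + h / 2) (h / 2).
Proof.
by rewrite /bsum /= -(addrA a) -(addrA b) !halfE; ring.
Qed.

Lemma bsumD q1 q2 phi n a b h :
  bsum (fun z => q1 z + q2 z) phi n a b h =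
  bsum q1 phi n a b h + bsum q2 phi n a b h.
Proof. by rewrite /bsum !psumD; ring. Qed.

Lemma bsum_linear (A B : C) phi n a b h :
  bsum (fun z => A + B * z) phi n a b h = 0.
Proof. by rewrite /bsum !psum_linear; ring. Qed.

Section Map.
Variables (phi : R -> R -> C) (L : R).
Hypothesis L0 : 0 < L.
Hypothesis phiL : forall a b a' b' : R,
  0 <= a <= 1 -> 0 <= b <= 1 -> 0 <= a' <= 1 -> 0 <= b' <= 1 ->
  normc (phi a b - phi a' b') <= L * (`|a - a'| + `|b - b'|).

Lemma phi_lipl (b a a' : R) : 0 <= b <= 1 -> 0 <= a <= 1 -> 0 <= a' <= 1 ->
  normc (phi a b - phi a' b) <= L * `|a - a'|.
Proof. by move=> hb ha ha'; have := phiL ha hb ha' hb; rewrite subrr normr0 addr0. Qed.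

Lemma phi_lipr (a b b' : R) : 0 <= a <= 1 -> 0 <= b <= 1 -> 0 <= b' <= 1 ->
  normc (phi a b - phi a b') <= L * `|b - b'|.
Proof. by move=> ha hb hb'; have := phiL ha hb ha hb'; rewrite subrr normr0 add0r. Qed.

Lemma bsum_le q n (a b h M : R) : 0 <= h -> 0 <= M ->
  0 <= a -> a + h <= 1 -> 0 <= b -> b + h <= 1 ->
  (forall x y, a <= x <= a + h -> b <= y <= b + h -> normc (q (phi x y)) <= M) ->
  normc (bsum q phi n a b h) <= 4 * (M * (L * h)).
Proof.
move=> h0 M0 a0 a1 b0 b1 qM.
have H1 y : b <= y <= b + h -> normc (psum q (phi ^~ y) n a h) <= M * (L * h).
  move=> hy; apply: psum_le => // [x hx|x x' hx hx']; first exact: qM.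
  by apply: phi_lipl; move: hx hx' hy; lra.
have H2 x : a <= x <= a + h -> normc (psum q (phi x) n b h) <= M * (L * h).
  move=> hx; apply: psum_le => // [y hy|y y' hy hy']; first exact: qM.
  by apply: phi_lipr; move: hx hy hy'; lra.
have e1 := H1 b; have e2 := H1 (b + h); have e3 := H2 a; have e4 := H2 (a + h).
rewrite /bsum; move: (psum _ _ _ _ _) (psum _ _ _ _ _) (psum _ _ _ _ _)
  (psum _ _ _ _ _) e1 e2 e3 e4 => v t w u e1 e2 e3 e4.
have := normcB (u + v - w) t; have := normcB (u + v) w; have := normcD u v.
have := e1; have := e2; have := e3; have := e4; rewrite !lexx !lerDl h0.
move=> /(_ isT) ? /(_ isT) ? /(_ isT) ? /(_ isT) ? * ; lra.
Qed.

(* On a small square around a point where [q] is differentiable only the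
   remainder of [q] contributes, because trapezoidal sums of affine functions
   telescope. *)
Lemma goursat q :
  (forall x y, 0 <= x <= 1 -> 0 <= y <= 1 -> exists d, cdiff q (phi x y) d) ->
  forall e : R, 0 < e ->
  exists n0, forall n, (n0 <= n)%N -> normc (bsum q phi n 0 0 1) <= e.
Proof.
move=> dq e e0.
(* The bound is proportional to the area, so the bounds of four quarters add up to that of the whole
   square. *)
pose P a b h := exists n0, forall n, (n0 <= n)%N ->
  normc (bsum q phi n a b h) <= e * h ^+ 2.
suff : P 0 0 1 by rewrite /P expr1n mulr1.
apply: square_bisection => [a b h h0 [n1 H1] [n2 H2] [n3 H3] [n4 H4]|x y hx hy].
  exists (maxn (maxn n1 n2) (maxn n3 n4)).+1 => -[//|n]; rewrite ltnS !geq_max.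
  move=> /andP[/andP[/H1 l1 /H2 l2] /andP[/H3 l3 /H4 l4]]; rewrite bsum_split.
  apply: le_trans (normcD _ _) _.
  have -> : e * h ^+ 2 = e * (h / 2) ^+ 2 + e * (h / 2) ^+ 2 +
     e * (h / 2) ^+ 2 + e * (h / 2) ^+ 2 by field.
  rewrite lerD// (le_trans (normcD _ _))// lerD// (le_trans (normcD _ _))//.
  exact: lerD.
have [d qd] := dq x y hx hy.
(* On a square of side h all points are within 2 L h of z, and each of the four sides contributes
   length L h; together 8 L^2 h^2. *)
have eL : 0 < e / (8 * L ^+ 2) by rewrite divr_gt0// mulr_gt0// exprn_gt0.
have [D D0 HD] := qd _ eL.
exists (D / (2 * L)); first by rewrite divr_gt0// mulr_gt0.
move=> a b h h0 hD hxa hyb a0 a1 b0 b1; exists 0%N => n _.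
set z := phi x y in qd HD.
have -> : bsum q phi n a b h =
    bsum (fun w => q w - q z - d * (w - z)) phi n a b h.
  rewrite -[RHS]add0r -(bsum_linear (q z - d * z) d phi n a b h) -bsumD.
  by congr (bsum _ _ _ _ _ _); apply/funext => w; ring.
have -> : e * h ^+ 2 = 4 * (e / (8 * L ^+ 2) * (L * (2 * h)) * (L * h)).
  by field; rewrite gt_eqF.
apply: bsum_le => //; first exact: ltW.
  by rewrite mulr_ge0 ?(ltW eL)// !mulr_ge0 ?ltW// mulr_gt0.
move=> x' y' hx' hy'.
have zh : normc (phi x' y' - z) <= L * (2 * h).
  apply: le_trans (phiL _ _ _ _) _ => //; first by move: hx'; lra.
    by move: hy'; lra.
  rewrite ler_wpM2l ?(ltW L0)// mulr_natl mulr2n.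
  by apply: lerD; rewrite ler_distl; move: hx hy hx' hy' hxa hyb; lra.
apply: le_trans (HD _ _) _.
  by apply: le_lt_trans zh _; move: hD; rewrite ltr_pdivlMr ?mulr_gt0//; lra.
by rewrite ler_wpM2l// ltW.
Qed.

End Map.

End Goursat.

(** * Complex differentiability in epsilon-delta form *)

Section Derivative.
Variable R : realType.
Local Notation C := R[i].
Local Notation Co := (R[i]^o).
Implicit Types (f g : C -> C) (z w d : C).

Lemma ltcR_norm (z : C) (e : R) : (`|z| < e%:C) = (normc z < e).
Proof. by rewrite normcE ltcR. Qed.

Lemma lecR_norm (z : C) (e : R) : (`|z| <= e%:C) = (normc z <= e).
Proof. by rewrite normcE lecR. Qed.

Lemma posc (e : C) : 0 < e -> exists2 r : R, 0 < r & e = r%:C.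
Proof.
case: e => a b; rewrite ltcE /= => /andP[/eqP -> a0]; by exists a.
Qed.

Lemma cdiffP f z d : cdiff f z d <-> is_derive (z : Co) 1 (f : Co -> Co) d.
Proof.
split=> [fd|[dfz dE] e e0].
  have cv : (h^-1 *: (((f : Co -> Co) \o shift (z : Co)) (h *: (1 : Co)) - f z)
      @[h --> (0 : Co)^'] --> (d : Co)).
    apply/cvgrPdist_le => e' /posc[e e0 ->].
    have [D D0 HD] := fd e e0.
    rewrite /at_right near_withinE; apply/nbhs_ballP.
    exists D%:C; first by rewrite /= ltcR.
    move=> h; rewrite -ball_normE /= sub0r normrN ltcR_norm => hD h0.
    rewrite [_%:A]mulr1.
    have := HD (h + z); rewrite addrK => /(_ hD) H.
    rewrite lecR_norm -[d](mulKf h0) -[_ *: _]/(h^-1 * (f (h + z) - f z)).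
    rewrite -mulrBr normcM normcV -ler_pdivlMl ?invr_gt0 ?normc_gt0// invrK.
    by rewrite normcBC [h * d]mulrC [_ * e]mulrC.
  have -> : d = 'D_1 (f : Co -> Co) (z : Co).
    by symmetry; apply: cvg_lim cv; exact: norm_hausdorff.
  by apply: derivableP; apply/cvg_ex; exists d.
move: dfz; rewrite /derivable -dE => /cvgrPdist_le /(_ e%:C).
rewrite /= ltcR => /(_ e0); rewrite near_withinE => /nbhs_ballP[D' /posc[D D0 ->]] HD.
exists D => // w wD; have [->|wz] := eqVneq w z.
  by rewrite !subrr mulr0 subr0 normc0 mulr0.
have wz0 : w - z != 0 by rewrite subr_eq0.
have := HD (w - z); rewrite -ball_normE /= sub0r normrN ltcR_norm.
move=> /(_ wD wz0); rewrite [_%:A]mulr1 subrK lecR_norm.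
rewrite -[X in normc (X - _) <= _]/('D_(1 : Co) (f : Co -> Co) (z : Co)).
set d' : C := 'D_(1 : Co) (f : Co -> Co) (z : Co).
have dE' : d' = (w - z)^-1 * ((w - z) * d') by rewrite mulKf.
rewrite {1}dE'.
rewrite [X in normc (_ - X) <= _ -> _](_ : _ = (w - z)^-1 * (f w - f z))//.
rewrite -mulrBr normcM normcV -ler_pdivlMl ?invr_gt0 ?normc_gt0// invrK.
by rewrite [(w - z) * d']mulrC [_ * e]mulrC (normcBC (d' * _)).
Qed.

Definition cdifferentiable f z := exists d, cdiff f z d.

Lemma cdifferentiableP f z :
  cdifferentiable f z <-> derivable (f : Co -> Co) (z : Co) 1.
Proof.
split=> [[d /cdiffP fd]|df]; first by case: fd.
by exists ('D_1 (f : Co -> Co) (z : Co)); apply/cdiffP/derivableP.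
Qed.

Lemma cdiff_cst (c z : C) : cdiff (fun=> c) z 0.
Proof. by apply/cdiffP; exact: is_derive_cst. Qed.

Lemma cdiff_id z : cdiff id z 1.
Proof. by apply/cdiffP; exact: is_derive_id. Qed.

Lemma cdiffD f g z d e : cdiff f z d -> cdiff g z e ->
  cdiff (fun w => f w + g w) z (d + e).
Proof. by move=> /cdiffP ? /cdiffP ?; apply/cdiffP; exact: is_deriveD. Qed.

Lemma cdiffM f g z d e : cdiff f z d -> cdiff g z e ->
  cdiff (fun w => f w * g w) z (f z * e + g z * d).
Proof.
by move=> /cdiffP ? /cdiffP ?; apply/cdiffP; exact: is_deriveM.
Qed.

Lemma cdiffZ (c : C) f z d : cdiff f z d -> cdiff (fun w => c * f w) z (c * d).
Proof.
by move=> fd; have := cdiffM (cdiff_cst c z) fd; rewrite mulr0 addr0.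
Qed.

Lemma cdiffB f g z d e : cdiff f z d -> cdiff g z e ->
  cdiff (fun w => f w - g w) z (d - e).
Proof. by move=> /cdiffP ? /cdiffP ?; apply/cdiffP; exact: is_deriveB. Qed.

Lemma cdiff_shift f z d h : cdiff f (z + h) d -> cdiff (fun w => f (w + h)) z d.
Proof.
move=> fd e /fd[D D0 HD]; exists D => // w wD.
by have := HD (w + h); rewrite opprD addrACA subrr addr0; exact.
Qed.

Lemma cdifferentiableV f z : f z != 0 ->
  cdifferentiable f z -> cdifferentiable (fun w => (f w)^-1) z.
Proof.
move=> fz0 /cdifferentiableP df; apply/cdifferentiableP.
exact: (@derivableV _ _ (f : Co -> Co)).
Qed.

Lemma cdifferentiableM f g z : cdifferentiable f z -> cdifferentiable g z ->
  cdifferentiable (fun w => f w * g w) z.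
Proof. by move=> [d fd] [e ge]; exists (f z * e + g z * d); exact: cdiffM. Qed.

Lemma cdifferentiableB f g z : cdifferentiable f z -> cdifferentiable g z ->
  cdifferentiable (fun w => f w - g w) z.
Proof. by move=> [d fd] [e ge]; exists (d - e); exact: cdiffB. Qed.

Lemma cdiff_near f g z d (D : R) : 0 < D ->
  (forall w, normc (w - z) < D -> f w = g w) -> cdiff f z d -> cdiff g z d.
Proof.
move=> D0 fg fd e /fd[D' D'0 H]; exists (Num.min D D').
  by rewrite lt_min D0.
move=> w; rewrite lt_min => /andP[w1 w2]; rewrite -!fg//.
  exact: H.
by rewrite subrr normc0.
Qed.

Lemma cdiff_unique f z d e : cdiff f z d -> cdiff f z e -> d = e.
Proof. by move=> /cdiffP[_ <-] /cdiffP[_ <-]. Qed.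

Definition holomorphic f := forall z, cdifferentiable f z.

End Derivative.

(** * Trapezoidal sums on circles and Cauchy's estimate *)

Section CauchyEstimate.
Variable R : realType.
Local Notation C := R[i].
Implicit Types (f g : C -> C) (p z w d : C).

Definition cis (t : R) : C := cos t +i* sin t.

Lemma cis0 : cis 0 = 1.
Proof. by rewrite /cis cos0 sin0. Qed.

Lemma cisD s t : cis (s + t) = cis s * cis t.
Proof.
by rewrite /cis cosD sinD; apply/eqP; rewrite eq_complex /= eqxx addrC eqxx.
Qed.

Lemma normc_cis t : normc (cis t) = 1.
Proof. by rewrite /= cos2Dsin2 sqrtr1. Qed.

Lemma cis_neq0 t : cis t != 0.
Proof. by rewrite -normc_gt0 normc_cis. Qed.

Lemma cis2pi : cis (2 * pi) = 1.
Proof. by rewrite /cis mulr_natl cos2pi sin2pi. Qed.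

Lemma cis_lipschitz s t : normc (cis s - cis t) <= 2 * `|s - t|.
Proof.
wlog st : s t / t <= s.
  move=> h; case: (leP t s) => [/h//|/ltW/h].
  by rewrite normcBC distrC.
have lip (f df : R -> R) : (forall x : R, is_derive x (1 : R) f (df x)) ->
    (forall x : R, `|df x| <= 1) -> `|f s - f t| <= `|s - t|.
  move=> fd df1; have cf : {within `[t, s], continuous f}.
    by apply: derivable_within_continuous => x _; have [] := fd x.
  have [c _ ->] := MVT_segment st (fun x _ => fd x) cf.
  by rewrite normrM ler_piMl.
apply: le_trans (normc_ReIm _) _; rewrite mulr2n mulrDl !mul1r lerD//.
  apply: (@lip _ (fun x => - sin x)) => x; rewrite normrN; exact: sin_max.
apply: (@lip _ cos) => x; exact: cos_max.
Qed.

(** These numbers replace 2 pi in the contour integral of dz / z. The value at n = 2 is 4, and they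
    increase because sin 2x = 2 sin x cos x <= 2 sin x. *)
Lemma pow_sin_ge4 n : (2 <= n)%N -> 4 <= 2 ^+ n * sin (2 * pi / 2 ^+ n) :> R.
Proof.
elim: n => [//|n IH]; rewrite leq_eqVlt => /predU1P[<-|/IH {}IH].
  rewrite (_ : 2 * pi / 2 ^+ 2 = pi / 2); last by field.
  by rewrite sin_pihalf expr2; lra.
have p2 : (2 : R) ^+ n != 0 by rewrite expf_neq0.
set x := 2 * pi / 2 ^+ n.+1.
have E : 2 * pi / 2 ^+ n = x *+ 2 :> R.
  by rewrite /x exprS -mulr_natl; field.
have sx : 0 <= sin x.
  apply: sin_ge0_pi; rewrite divr_ge0 ?mulr_ge0 ?pi_ge0 ?exprn_ge0//=.
  rewrite ler_pdivrMr ?exprn_gt0// [pi * _]mulrC ler_wpM2r ?pi_ge0//.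
  by rewrite exprS ler_peMr// exprn_ege1// ler1n.
move: IH; rewrite E sin_mulr2n exprS => /le_trans; apply.
have -> : 2 ^+ n * (cos x * sin x *+ 2) = 2 * 2 ^+ n * (cos x * sin x).
  by rewrite -mulr_natl; ring.
by rewrite ler_wpM2l ?mulr_ge0 ?exprn_ge0// ler_piMl ?cos_le1.
Qed.

Definition arc p (s b : R) : C := p + s%:C * cis (2 * pi * b).

Lemma pi_le4 : pi <= 4 :> R.
Proof. by have := @pihalf_lt2 R; rewrite ltr_pdivrMr//; lra. Qed.

Lemma arc_lipschitz p s b b' : 0 <= s ->
  normc (arc p s b - arc p s b') <= 16 * s * `|b - b'|.
Proof.
move=> s0; rewrite /arc opprD addrACA subrr add0r -mulrBr normcM normcR ger0_norm//.
rewrite [16 * s]mulrC -(mulrA s) ler_wpM2l// (le_trans (cis_lipschitz _ _))//.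
rewrite -mulrBr normrM ger0_norm ?mulr_ge0 ?pi_ge0// mulrA ler_wpM2r//.
by have := pi_le4; lra.
Qed.

Lemma normc_arcB p s b : 0 <= s -> normc (arc p s b - p) = s.
Proof.
move=> s0; rewrite /arc addrAC subrr add0r normcM normc_cis normcR mulr1.
by rewrite ger0_norm.
Qed.

(** Every step contributes the same amount: with E the rotation of one step, the trapezoid for 1 / z
    equals (E - E^-1) / 2, that is, i times the sine of the angle. *)
Lemma psum_inv p (c : C) s n a h : 0 < s ->
  psum (fun z => c / (z - p)) (arc p s) n a h =
  c * (0 +i* (2 ^+ n * sin (2 * pi * h / 2 ^+ n))).
Proof.
move=> s0; have sn0 : s%:C != 0 by rewrite -normc_gt0 normcR normr_gt0 gt_eqF.
elim: n a h => [|n IH] a h /=.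
  rewrite /arc [p + _ - p]addrAC subrr add0r [p + _ - p]addrAC subrr add0r.
  rewrite (mulrDr (2 * pi)) cisD; set E := cis (2 * pi * h); set A := cis (2 * pi * a).
  have E0 : E != 0 := cis_neq0 _; have A0 : A != 0 := cis_neq0 _.
  have -> : (c / (s%:C * A) + c / (s%:C * (A * E))) / 2 *
      (p + s%:C * (A * E) - (p + s%:C * A)) = c * ((E - E^-1) / 2).
    by field; rewrite E0 A0 sn0.
  congr (_ * _); have -> : E^-1 = cis (- (2 * pi * h)).
    by apply: (mulfI E0); rewrite mulfV// -cisD subrr cis0.
  apply: (@mulIf _ 2) => //; rewrite divfK// expr0 mul1r divr1.
  rewrite mulr_natr mulr2n /E /cis cosN sinN.
  by apply/eqP; rewrite eq_complex /= subrr addr0 opprK !eqxx.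
rewrite !IH -mulrDr; congr (_ * _); apply/eqP; rewrite eq_complex /= addr0 eqxx /=.
have -> : 2 * pi * (h / 2) / 2 ^+ n = 2 * pi * h / 2 ^+ n.+1 :> R.
  by rewrite exprS; field; rewrite expf_neq0.
by apply/eqP; rewrite exprS; ring.
Qed.

(* Goursat on the annulus between a small circle, where
   (f z - f p) / (z - p)^2 is close to d / (z - p), and the circle of radius
   rho. *)
Lemma cauchy_estimate f p d (rho M : R) : holomorphic f -> 0 < rho ->
  (forall z, normc (z - p) <= rho -> normc (f z) <= M) ->
  cdiff f p d -> normc d <= 8 * M / rho.
Proof.
move=> hf rho0 fM fd; apply/ler_addgt0Pr => e0 e00.
have M0 : 0 <= M.
  by apply: le_trans (normc_ge0 _) (fM p _); rewrite subrr normc0 ltW.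
(* The error is e from [goursat] and 16 e from the inner circle, divided by the 4 of
   [pow_sin_ge4]. *)
pose e := e0 * 4 / 17; have e_gt0 : 0 < e by rewrite divr_gt0 ?mulr_gt0.
have [D D0 HD] := fd e e_gt0.
pose s := Num.min (D / 2) (rho / 2).
have s0 : 0 < s by rewrite lt_min !divr_gt0.
have sD : s < D by rewrite gt_min ltr_pdivrMr// ltr_pMr ?ltr1n.
have srho : s < rho.
  by rewrite gt_min [X in _ || X]ltr_pdivrMr// ltr_pMr ?ltr1n// orbT.
pose q z := (f z - f p) / (z - p) ^+ 2.
pose phi a b := arc p (s + a * (rho - s)) b.
have phi_r a : 0 <= a <= 1 -> s <= s + a * (rho - s) <= rho.
  by move=> /andP[a0 a1]; nra.
have phiL a b a' b' : 0 <= a <= 1 -> 0 <= b <= 1 -> 0 <= a' <= 1 ->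
    0 <= b' <= 1 ->
    normc (phi a b - phi a' b') <= 16 * rho * (`|a - a'| + `|b - b'|).
  move=> ha hb ha' hb'; have := phi_r _ ha; have := phi_r _ ha' => /andP[r1 r2] _.
  apply: le_trans (normc_triangle _ (phi a' b) _) _; rewrite mulrDr lerD//.
    rewrite /phi /arc opprD addrACA subrr add0r -mulrBl -rmorphB.
    rewrite normcM normc_cis mulr1 normcR.
    have -> : s + a * (rho - s) - (s + a' * (rho - s)) = (a - a') * (rho - s) by ring.
    rewrite normrM mulrC ler_wpM2r// ger0_norm ?subr_ge0 ?(ltW srho)//.
    lra.
  apply: le_trans (arc_lipschitz _ _ _ _) _; first lra.
  by rewrite ler_wpM2r//; lra.
have phi_np a b : 0 <= a <= 1 -> phi a b - p != 0.
  move=> /phi_r/andP[h _]; have h0 := lt_le_trans s0 h.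
  by rewrite -normc_gt0 normc_arcB// ltW.
have qd a b : 0 <= a <= 1 -> 0 <= b <= 1 -> cdifferentiable q (phi a b).
  move=> ha _; apply: cdifferentiableM.
    by apply: cdifferentiableB => //; exists 0; exact: cdiff_cst.
  apply: cdifferentiableV; first by rewrite expf_neq0// phi_np.
  have idp : cdifferentiable (fun z => z - p) (phi a b).
    by exists (1 - 0); apply: cdiffB; [exact: cdiff_id|exact: cdiff_cst].
  exact: (cdifferentiableM idp idp).
have L0 : 0 < 16 * rho by rewrite mulr_gt0.
have [n0 Hn0] := goursat L0 phiL qd e_gt0.
pose n := maxn n0 2; have {Hn0} := Hn0 n (leq_maxl _ _).
(* The radial sides b = 0 and b = 1 coincide by periodicity of [cis], so they cancel and only the
   two circles remain. *)
rewrite /bsum !add0r (_ : psum q (phi ^~ 1) n 0 1 = psum q (phi ^~ 0) n 0 1); last first.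
  by apply: eq_psum => // x _; rewrite /phi /arc mulr0 mulr1 cis2pi cis0.
set X := psum q (phi ^~ 0) n 0 1.
set out := psum q (phi 1) n 0 1; set inn := psum q (phi 0) n 0 1.
have -> : X + out - X - inn = out - inn by ring.
move=> Hdiff.
have Hout : normc out <= 32 * M / rho.
  have -> : 32 * M / rho = (2 * M / rho ^+ 2) * (16 * rho * 1).
    by field; rewrite gt_eqF.
  apply: psum_le => //.
  - by rewrite divr_ge0 ?mulr_ge0 ?exprn_ge0// ltW.
  - move=> x _; rewrite /q normcM normcV normcX.
    have ex : normc (phi 1 x - p) = rho.
      by rewrite normc_arcB; lra.
    rewrite ex ler_wpM2r ?invr_ge0 ?exprn_ge0 ?(ltW rho0)//.
    rewrite (le_trans (normcB _ _))// mulr2n mulrDl mul1r lerD// fM//.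
      by rewrite ex.
    by rewrite subrr normc0 ltW.
  - move=> x y _ _; apply: le_trans (arc_lipschitz _ _ _ _) _; first lra.
    by rewrite ler_wpM2r//; lra.
pose q1 z := d / (z - p); pose q2 z := q z - q1 z.
have Einn : inn = psum q1 (phi 0) n 0 1 + psum q2 (phi 0) n 0 1.
  rewrite -psumD /inn; congr (psum _ _ _ _ _); apply/funext => z.
  by rewrite /q2 addrC subrK.
have Hq2 : normc (psum q2 (phi 0) n 0 1) <= 16 * e.
  have -> : 16 * e = e / s * (16 * s * 1) by field; rewrite gt_eqF.
  have ex x : normc (phi 0 x - p) = s.
    by rewrite /phi mul0r addr0 normc_arcB// ltW.
  apply: psum_le => //.
  - by rewrite divr_ge0// ltW.
  - move=> x _; set z := phi 0 x.
    have z0 : z - p != 0 by rewrite -normc_gt0 ex.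
    have -> : q2 z = (f z - f p - d * (z - p)) / (z - p) ^+ 2.
      by rewrite /q2 /q /q1; field.
    rewrite normcM normcV normcX ler_pdivrMr ?exprn_gt0 ?normc_gt0//.
    apply: le_trans (HD z _) _; first by rewrite ex.
    by rewrite ex; have -> : e / s * s ^+ 2 = e * s by field; rewrite gt_eqF.
  - move=> x y _ _; rewrite /phi mul0r addr0.
    by apply: arc_lipschitz; rewrite ltW.
have E1 : psum q1 (phi 0) n 0 1 =
    d * (0 +i* (2 ^+ n * sin (2 * pi / 2 ^+ n))).
  rewrite -[2 * pi]mulr1 -(@psum_inv p d s n 0)//.
  by apply: eq_psum => // x _; rewrite /phi mul0r addr0.
have H1 : 4 * normc d <= normc (psum q1 (phi 0) n 0 1).
  rewrite E1 normcM mulrC ler_wpM2l ?normc_ge0//.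
  rewrite /= expr0n add0r sqrtr_sqr.
  by apply: le_trans (ler_norm _); apply: pow_sin_ge4; rewrite leq_maxr.
have : normc (psum q1 (phi 0) n 0 1) <= 32 * M / rho + e + 16 * e.
  have -> : psum q1 (phi 0) n 0 1 = out - (out - inn) - psum q2 (phi 0) n 0 1.
    by rewrite Einn; ring.
  apply: le_trans (normcB _ _) (lerD _ Hq2).
  exact: le_trans (normcB _ _) (lerD Hout Hdiff).
move/(le_trans H1); rewrite -lter_pdivlMl// => /le_trans; apply.
by rewrite /e; set t := M / rho; rewrite -!(mulrA _ M) -/t; lra.
Qed.

End CauchyEstimate.

(** * Consequences of Cauchy's estimate: Taylor's formula of order one and Weierstrass's theorem *)

Section Holomorphic.
Variable R : realType.
Local Notation C := R[i].
Implicit Types (f g : C -> C) (p z w d : C) (M rho : R).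

(** With M + e in place of M, the inequality holds near each point by differentiability and is
    additive under halving of the segment. The second coordinate of [square_bisection] is idle. *)
Lemma mean_value f (a b : C) M :
  (forall t : R, 0 <= t <= 1 ->
    exists2 d, cdiff f (a + t%:C * (b - a)) d & normc d <= M) ->
  normc (f b - f a) <= M * normc (b - a).
Proof.
move=> fM; have M0 : 0 <= M.
  have [|d _] := fM 0; first by rewrite lexx ler01.
  by apply: le_trans; exact: normc_ge0.
have n0 := normc_ge0 (b - a).
suff H e : 0 < e -> normc (f b - f a) <= (M + e) * normc (b - a).
  apply/ler_addgt0Pr => e e0.
  have /H : 0 < e / (normc (b - a) + 1) by rewrite divr_gt0// ltr_wpDl.
  move=> /le_trans; apply; rewrite mulrDl lerD2l mulrAC ler_pdivrMr ?ltr_wpDl//.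
  by rewrite ler_wpM2l ?lerDl// ltW.
move=> e0; pose c (t : R) := a + t%:C * (b - a).
have cB s t : c s - c t = (s - t)%:C * (b - a) by rewrite /c rmorphB; ring.
have cN s t : normc (c s - c t) = `|s - t| * normc (b - a).
  by rewrite cB normcM normcR.
pose P t (_ : R) h := normc (f (c (t + h)) - f (c t)) <=
  (M + e) * (h * normc (b - a)).
suff : P 0 0 1 by rewrite /P /c add0r !mul1r mul0r addr0 subrKC.
apply: (@square_bisection _ P) => [t s h h0 H1 H2 _ _|x y hx _].
  rewrite /P; apply: le_trans (normc_triangle _ (f (c (t + h / 2))) _) _.
  have -> : (M + e) * (h * normc (b - a)) = (M + e) * (h / 2 * normc (b - a)) +
    (M + e) * (h / 2 * normc (b - a)) by field.
  by rewrite lerD//; move: H2; rewrite /P -addrA halfE.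
have [d cd dM] := fM x hx; have [D D0 HD] := cd e e0.
have n1 : 0 < normc (b - a) + 1 by rewrite ltr_wpDl.
exists (D / (normc (b - a) + 1)); first by rewrite divr_gt0.
move=> t s h h0 hD /andP[tx xt] _ _ _ _ _.
(* The point x lies between t and t + h; the increments on either side of it are bounded separately
   and their lengths add up to h. *)
have approx u (k : R) : `|u - x| = k -> k <= h ->
    normc (f (c u) - f (c x)) <= (M + e) * (k * normc (b - a)).
  move=> <- ux; have ucx : normc (c u - c x) < D.
    rewrite cN; move: hD; rewrite ltr_pdivlMr// => /(le_lt_trans _); apply.
    by rewrite ler_pM// lerDl.
  rewrite -cN mulrDl; have -> : f (c u) - f (c x) =
    d * (c u - c x) + (f (c u) - f (c x) - d * (c u - c x)) by ring.
  rewrite (le_trans (normcD _ _))// lerD//; last exact: HD.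
  by rewrite normcM ler_wpM2r ?normc_ge0.
have H1 : normc (f (c (t + h)) - f (c x)) <= (M + e) * ((t + h - x) * normc (b - a)).
  apply: approx; last lra.
  by rewrite ger0_norm; lra.
have H2 : normc (f (c x) - f (c t)) <= (M + e) * ((x - t) * normc (b - a)).
  rewrite normcBC; apply: approx; last lra.
  by rewrite ler0_norm ?opprB; lra.
rewrite /P (le_trans (normc_triangle _ (f (c x)) _))// (le_trans (lerD H1 H2))//.
by rewrite le_eqVlt; apply/orP; left; apply/eqP; ring.
Qed.

Definition cderiv f z := xget 0 [set d | cdiff f z d].

Lemma cderivP f z : holomorphic f -> cdiff f z (cderiv f z).
Proof. by move=> /(_ z)[d fd]; exact: (xgetPex 0 (ex_intro _ d fd)). Qed.

Lemma cderivE f z d : cdiff f z d -> cderiv f z = d.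
Proof.
move=> fd; apply: (cdiff_unique _ fd); exact: (xgetPex 0 (ex_intro _ d fd)).
Qed.

Lemma holomorphicD f g : holomorphic f -> holomorphic g ->
  holomorphic (fun z => f z + g z).
Proof.
move=> hf hg z; have [d ?] := hf z; have [e ?] := hg z.
by exists (d + e); apply: cdiffD.
Qed.

Lemma holomorphicB f g : holomorphic f -> holomorphic g ->
  holomorphic (fun z => f z - g z).
Proof.
move=> hf hg z; have [d ?] := hf z; have [e ?] := hg z.
by exists (d - e); apply: cdiffB.
Qed.

Lemma holomorphicM f g : holomorphic f -> holomorphic g ->
  holomorphic (fun z => f z * g z).
Proof. by move=> hf hg z; exact: cdifferentiableM. Qed.

Lemma holomorphic_cst (c : C) : holomorphic (fun=> c).
Proof. by move=> z; exists 0; exact: cdiff_cst. Qed.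

Lemma holomorphic_id : holomorphic (id : C -> C).
Proof. by move=> z; exists 1; exact: cdiff_id. Qed.

Lemma holomorphicX n : holomorphic (fun z : C => z ^+ n).
Proof.
elim: n => [|n IH]; first exact: holomorphic_cst.
suff -> : (fun z : C => z ^+ n.+1) = (fun z => z * z ^+ n).
  by apply: holomorphicM => //; exact: holomorphic_id.
by apply/funext => z; rewrite exprS.
Qed.

Lemma holomorphic_sum n (F : nat -> C -> C) : (forall k, holomorphic (F k)) ->
  holomorphic (fun z => \sum_(k < n) F k z).
Proof.
move=> hF; elim: n => [|n IH].
  suff -> : (fun z => \sum_(k < 0) F k z) = (fun=> 0) by exact: holomorphic_cst.
  by apply/funext => z; rewrite big_ord0.
suff -> : (fun z => \sum_(k < n.+1) F k z) = (fun z => \sum_(k < n) F k z + F n z).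
  exact: holomorphicD.
by apply/funext => z; rewrite big_ord_recr.
Qed.

Lemma holomorphic_shift f h : holomorphic f -> holomorphic (fun z => f (z + h)).
Proof. by move=> hf z; have [d fd] := hf (z + h); exists d; exact: cdiff_shift. Qed.

Definition disc_bound f p rho M := forall z, normc (z - p) <= rho -> normc (f z) <= M.

Lemma disc_boundS f p q rho sigma M : disc_bound f p rho M ->
  normc (q - p) + sigma <= rho -> disc_bound f q sigma M.
Proof.
move=> fM h z zq; apply: fM; apply: le_trans (normc_triangle _ q _) _.
by rewrite addrC (le_trans _ h)// lerD2l.
Qed.

Lemma disc_bound_ge0 f p rho M : 0 <= rho -> disc_bound f p rho M -> 0 <= M.
Proof.
by move=> r0 /(_ p); rewrite subrr normc0 => /(_ r0); apply: le_trans; exact: normc_ge0.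
Qed.

Lemma cderiv_bound f p rho sigma M : holomorphic f -> 0 < sigma ->
  disc_bound f p (rho + sigma) M -> disc_bound (cderiv f) p rho (8 * M / sigma).
Proof.
move=> hf s0 fM z zp; apply: (cauchy_estimate hf s0 _ (cderivP z hf)).
by apply: disc_boundS fM _; rewrite lerD2r.
Qed.

Lemma disc_segment p a b rho (t : R) : normc (a - p) <= rho -> normc (b - p) <= rho ->
  0 <= t <= 1 -> normc (a + t%:C * (b - a) - p) <= rho.
Proof.
move=> ha hb /andP[t0 t1].
have -> : a + t%:C * (b - a) - p = (1 - t)%:C * (a - p) + t%:C * (b - p).
  by rewrite rmorphB; ring.
rewrite (le_trans (normcD _ _))// !normcM !normcR !ger0_norm ?subr_ge0//.
by nra.
Qed.

Lemma disc_lipschitz f p rho M : holomorphic f ->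
  disc_bound (cderiv f) p rho M -> forall a b, normc (a - p) <= rho ->
  normc (b - p) <= rho -> normc (f b - f a) <= M * normc (b - a).
Proof.
move=> hf fM a b ha hb; apply: mean_value => t ht; exists (cderiv f (a + t%:C * (b - a))).
  exact: cderivP.
by apply: fM; exact: disc_segment.
Qed.

(** Cauchy's estimate applied to the difference f(w + h) - f(w), which is at most 8 M |h| on the
    unit disc, gives 8 * 8 M |h| without second derivatives. *)
Lemma cderiv_lipschitz f p M : holomorphic f -> disc_bound f p 3 M ->
  forall h, normc h <= 1 -> normc (cderiv f (p + h) - cderiv f p) <= 64 * M * normc h.
Proof.
move=> hf fM h h1.
have dM : disc_bound (cderiv f) p 2 (8 * M).
  have := @cderiv_bound f p 2 1 M hf ltr01; rewrite divr1; apply.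
  by apply: disc_boundS fM _; rewrite subrr normc0; lra.
pose g w := f (w + h) - f w.
have hg : holomorphic g by apply: holomorphicB => //; exact: holomorphic_shift.
have gM : disc_bound g p 1 (8 * M * normc h).
  move=> z zp; rewrite /g.
  have E : z + h - z = h by rewrite addrC addKr.
  rewrite -{2}E; apply: (disc_lipschitz hf dM); first lra.
  by rewrite addrAC (le_trans (normcD _ _))//; lra.
have := cauchy_estimate hg ltr01 gM (cdiffB (cdiff_shift (cderivP (p + h) hf)) (cderivP p hf)).
by rewrite divr1; move/le_trans; apply; rewrite !mulrA; lra.
Qed.

(** The constant depends on f only through its bound M, so the estimate is uniform along a bounded
    sequence; [weierstrass] relies on this. *)
Lemma taylor1 f p M : holomorphic f -> disc_bound f p 3 M ->
  forall z, normc (z - p) <= 1 ->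
  normc (f z - f p - cderiv f p * (z - p)) <= 64 * M * normc (z - p) ^+ 2.
Proof.
move=> hf fM z zp; pose g w := f w - cderiv f p * w.
have -> : f z - f p - cderiv f p * (z - p) = g z - g p by rewrite /g; ring.
rewrite expr2 mulrA; apply: mean_value => t /andP[t0 t1].
have M0 := disc_bound_ge0 (ler0n _ 3) fM.
set w := p + _; exists (cderiv f w - cderiv f p * 1).
  apply: cdiffB; [exact: cderivP|exact: cdiffZ (cdiff_id _)].
have nt : normc (t%:C * (z - p)) <= normc (z - p).
  by rewrite normcM normcR ger0_norm// ler_piMl ?normc_ge0.
rewrite mulr1 (le_trans (cderiv_lipschitz hf fM _))//; first exact: le_trans zp.
by rewrite ler_wpM2l// mulr_ge0.
Qed.

Lemma holomorphic_bounded f p rho : holomorphic f -> 0 < rho ->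
  exists M, disc_bound f p rho M.
Proof.
(* Maps the unit square onto the square of side 2 rho centred at p, which contains the disc. *)
move=> hf r0; pose c (x y : R) := p + ((2 * x - 1) * rho +i* ((2 * y - 1) * rho)).
pose P a b h := exists M, forall x y, a <= x <= a + h -> b <= y <= b + h ->
  normc (f (c x y)) <= M.
have [M HM] : P 0 0 1.
  apply: (@square_bisection _ P) => [a b h h0 [M1 H1] [M2 H2] [M3 H3] [M4 H4]|x y hx hy].
    exists (Num.max (Num.max M1 M2) (Num.max M3 M4)) => x y hx hy.
    rewrite !le_max; have [xa|xa] := leP x (a + h / 2);
      have [yb|yb] := leP y (b + h / 2).
    - by rewrite H1 //; lra.
    - by rewrite H3 ?orbT //; lra.
    - by rewrite H2 ?orbT //; lra.
    - by rewrite H4 ?orbT //; lra.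
  have [d fd] := hf (c x y); have [D D0 HD] := fd 1 ltr01.
  exists (D / (4 * rho)); first by rewrite divr_gt0// mulr_gt0.
  move=> a b h h0 hD hxa hyb _ _ _ _.
  exists (normc (f (c x y)) + (normc d + 1) * D) => x' y' hx' hy'.
  have cD : normc (c x' y' - c x y) < D.
    apply: le_lt_trans (normc_ReIm _) _.
    have -> : c x' y' - c x y = (2 * (x' - x) * rho) +i* (2 * (y' - y) * rho).
      rewrite /c opprD addrACA subrr add0r.
      by apply/eqP; rewrite eq_complex /=; apply/andP; split; apply/eqP; ring.
    rewrite [complex.Re _]/= [complex.Im _]/= !normrM normr_nat (gtr0_norm r0).
    have h1 : `|x' - x| <= h by rewrite ler_distl; lra.
    have h2 : `|y' - y| <= h by rewrite ler_distl; lra.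
    move: hD; rewrite ltr_pdivlMr ?mulr_gt0//; nra.
  have := HD _ cD; rewrite mul1r => H.
  have -> : f (c x' y') = f (c x y) + (d * (c x' y' - c x y) +
     (f (c x' y') - f (c x y) - d * (c x' y' - c x y))) by ring.
  rewrite (le_trans (normcD _ _))// lerD2l mulrDl mul1r (le_trans (normcD _ _))//.
  rewrite lerD//; last by rewrite (le_trans H)// ltW.
  by rewrite normcM ler_wpM2l ?normc_ge0// ltW.
exists M => z zp.
have zre := le_trans (normc_Re _) zp; have zim := le_trans (normc_Im _) zp.
have -> : z = c ((complex.Re (z - p) / rho + 1) / 2) ((complex.Im (z - p) / rho + 1) / 2).
  rewrite /c -[LHS](subrKC p); congr (_ + _); case: (z - p) => a b /=.
  by apply/eqP; rewrite eq_complex /=; apply/andP; split; apply/eqP; field; rewrite gt_eqF.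
have B (s : R) : `|s| <= rho -> 0 <= (s / rho + 1) / 2 <= 0 + 1.
  rewrite ler_norml => h; have : -1 <= s / rho <= 1.
    by rewrite ler_pdivlMr// ler_pdivrMr//; move: h; lra.
  by lra.
by apply: HM; exact: B.
Qed.

Lemma cdiff_quadratic f p d K : 0 <= K ->
  (forall z, normc (z - p) <= 1 ->
    normc (f z - f p - d * (z - p)) <= K * normc (z - p) ^+ 2) ->
  cdiff f p d.
Proof.
move=> K0 H e e0; have K1 : 0 < K + 1 by rewrite ltr_wpDl.
exists (Num.min 1 (e / (K + 1))); first by rewrite lt_min ltr01 divr_gt0.
move=> w; rewrite lt_min ltr_pdivlMr// => /andP[w1 we].
apply: le_trans (H w (ltW w1)) _; rewrite expr2 mulrA ler_wpM2r ?normc_ge0//.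
by have := normc_ge0 (w - p); move: we; lra.
Qed.

(** By Cauchy's estimate the derivatives at p of the approximants form a Cauchy sequence. The
    quadratic remainder bound of [taylor1], uniform in k, then passes to the limit and yields the
    derivative of f. *)
Lemma weierstrass f :
  (forall rho e : R, 0 < rho -> 0 < e -> exists2 g, holomorphic g &
    forall z, normc z <= rho -> normc (f z - g z) <= e) ->
  holomorphic f.
Proof.
move=> fg p; pose rho := normc p + 3.
have rho0 : 0 < rho by rewrite ltr_wpDl ?normc_ge0.
have h2 k : 0 < (2^-1 : R) ^+ k by rewrite exprn_gt0 ?invr_gt0.
have /choice[g gP] k : exists g, holomorphic g /\
    forall z, normc (z - p) <= 3 -> normc (f z - g z) <= 2^-1 ^+ k.
  have [g hg gf] := fg rho _ rho0 (h2 k); exists g; split => // z zp.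
  apply: gf; rewrite -(subrK p z) (le_trans (normcD _ _))// /rho; lra.
have g2 k : (2^-1 : R) ^+ k <= 1 by rewrite exprn_ile1 ?invr_ge0// invf_le1// ler1n.
have gB k l z : (k <= l)%N -> normc (z - p) <= 3 ->
    normc (g l z - g k z) <= 2 * 2^-1 ^+ k.
  move=> kl zp; apply: le_trans (normc_triangle _ (f z) _) _.
  rewrite mulr2n mulrDl mul1r lerD//; last by have [_ ->] := gP k.
  rewrite normcBC; have [_ h] := gP l; apply: le_trans (h z zp) _.
  by rewrite ler_wiXn2l ?invr_ge0// invf_le1// ler1n.
have [M0 gM0] := @holomorphic_bounded (g 0%N) p 3 (gP 0%N).1 (ltr0n _ 3).
have gM k : disc_bound (g k) p 3 (M0 + 2).
  move=> z zp; rewrite -(subrK (g 0%N z) (g k z)) addrC.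
  rewrite (le_trans (normcD _ _))// lerD//; first exact: gM0.
  by have := gB 0%N k z (leq0n _) zp; rewrite expr0 mulr1.
have M0' := disc_bound_ge0 (ler0n _ 3) (gM 0%N).
have dB k l : (k <= l)%N ->
    normc (cderiv (g l) p - cderiv (g k) p) <= 16 * 2^-1 ^+ k.
  move=> kl; have [hk _] := gP k; have [hl _] := gP l.
  have := cauchy_estimate (holomorphicB hl hk) (ltr0n _ 1) _
    (cdiffB (cderivP p hl) (cderivP p hk)).
  move=> /(_ (2 * 2^-1 ^+ k)); rewrite divr1 mulrA -natrM; apply=> z zp.
  by apply: gB => //; lra.
have [d dP] := cauchy_limit dB; exists d.
apply: (@cdiff_quadratic _ _ _ (64 * (M0 + 2))); first by rewrite mulr_ge0.
move=> z zp; apply/ler_addgt0Pr => e e0.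
(* 34 = 1 + 1 + 32: the errors of f at z and at p, and that of the derivative, namely 8 * 2 from
   Cauchy's estimate doubled by [cauchy_limit]. *)
have e34 : 0 < e / 34 by rewrite divr_gt0.
have [|k hk] := @exists_expr_lt R 2^-1 _ _ e34.
  by rewrite invr_ge0 ler0n invf_lt1 ?ltr1n.
have [hg fgk] := gP k.
have -> : f z - f p - d * (z - p) = (g k z - g k p - cderiv (g k) p * (z - p)) +
  ((f z - g k z) - (f p - g k p) - (d - cderiv (g k) p) * (z - p)) by ring.
rewrite (le_trans (normcD _ _))// lerD ?taylor1//.
have := normcB (f z - g k z) (f p - g k p).
have := normcB ((f z - g k z) - (f p - g k p)) ((d - cderiv (g k) p) * (z - p)).
have h3 := fgk z; have h4 := fgk p; rewrite subrr normc0 in h4.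
have {}h3 := h3 ltac:(lra); have {}h4 := h4 ltac:(lra).
have : normc ((d - cderiv (g k) p) * (z - p)) <= 32 * 2^-1 ^+ k.
  rewrite normcM; apply: le_trans (ler_pM _ _ (dP k) zp) _; rewrite ?normc_ge0//.
  by set q := _ ^+ k; lra.
move: hk; rewrite ltr_pdivlMr//; set q := _ ^+ k in h3 h4 *; lra.
Qed.

(** Difference quotients with a fixed step are holomorphic, and [taylor1] makes them converge
    uniformly on discs. *)
Lemma cderiv_holomorphic f : holomorphic f -> holomorphic (cderiv f).
Proof.
move=> hf; apply: weierstrass => rho e rho0 e0.
have [M fM] := @holomorphic_bounded f 0 (rho + 3) hf ltac:(lra).
have M0 : 0 <= M by apply: (disc_bound_ge0 _ fM); lra.
have M1 : 0 < 64 * M + 1 by rewrite ltr_wpDl ?mulr_ge0.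
pose h := Num.min 1 (e / (64 * M + 1)).
have h0 : 0 < h by rewrite lt_min ltr01 divr_gt0.
have hC : h%:C != 0 by rewrite -normc_gt0 normcR normr_gt0 gt_eqF.
have hn : normc h%:C = h by rewrite normcR gtr0_norm.
exists (fun z => h%:C^-1 * (f (z + h%:C) - f z)).
  apply: holomorphicM; first exact: holomorphic_cst.
  by apply: holomorphicB => //; exact: holomorphic_shift.
move=> z zr; rewrite normcBC.
have zM : disc_bound f z 3 M by apply: disc_boundS fM _; rewrite subr0 lerD2r.
have -> : h%:C^-1 * (f (z + h%:C) - f z) - cderiv f z =
  h%:C^-1 * (f (z + h%:C) - f z - cderiv f z * ((z + h%:C) - z)) by field.
have zh : z + h%:C - z = h%:C by ring.
rewrite normcM normcV hn ler_pdivrMl//.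
apply: le_trans (taylor1 hf zM _) _; rewrite zh hn.
  by rewrite ge_min lexx.
have : h <= e / (64 * M + 1) by rewrite ge_min lexx orbT.
by rewrite ler_pdivlMr// => H; rewrite expr2 mulrA mulrC ler_wpM2l ?(ltW h0)//; lra.
Qed.

End Holomorphic.

(** * Taylor expansions of r-even entire functions *)

Section TaylorCoefficients.
Variable R : realType.
Local Notation C := R[i].
Implicit Types (u v g : C -> C) (z w d : C) (M rho : R).

Lemma exists_half_lt (d : R) : 0 < d -> exists n, (2^-1 : R) ^+ n < d.
Proof. by apply: exists_expr_lt; rewrite invr_ge0 ler0n invf_lt1 ?ltr1n. Qed.

Lemma normc_half_eq0 z M : (forall n, normc z <= M * 2^-1 ^+ n) -> z = 0.
Proof.
move=> zM; apply/eqP; rewrite -normc_eq0 eq_le normc_ge0 andbT.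
apply/ler_addgt0Pr => e e0; rewrite add0r.
have M0 : 0 <= M by have := zM 0%N; rewrite expr0 mulr1; apply: le_trans; exact: normc_ge0.
have [|n hn] := @exists_half_lt (e / (M + 1)); first by rewrite divr_gt0// ltr_wpDl.
apply: le_trans (zM n) _; move: hn; rewrite ltr_pdivlMr ?ltr_wpDl// => hn.
have : 0 <= (2^-1 : R) ^+ n by rewrite exprn_ge0// invr_ge0.
by move: hn; set q := _ ^+ n; lra.
Qed.

(* Removing u 0 and dividing by z repeatedly yields the Taylor coefficients
   without higher derivatives; the remainder z^n (quot^n u)(z) is controlled by
   quot_bound alone. *)
Definition quot u z := if z == 0 then cderiv u 0 else (u z - u 0) / z.

Lemma quotE u z : u z = u 0 + z * quot u z.
Proof.
rewrite /quot; have [->|z0] := eqVneq z 0; first by rewrite mul0r addr0.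
by rewrite mulrC divfK// subrKC.
Qed.

Lemma quot_holomorphic u : holomorphic u -> holomorphic (quot u).
Proof.
move=> hu z; have [->|z0] := eqVneq z 0; last first.
  have [d qd] : cdifferentiable (fun w => (u w - u 0) / w) z.
    apply: cdifferentiableM.
      by apply: cdifferentiableB => //; exists 0; exact: cdiff_cst.
    by apply: cdifferentiableV => //; exists 1; exact: cdiff_id.
  exists d; apply: (@cdiff_near _ _ _ _ _ (normc z) _ _ qd); rewrite ?normc_gt0//.
  move=> w wz; rewrite /quot; have [w0|//] := eqVneq w 0.
  by move: wz; rewrite w0 sub0r normcN ltxx.
have hu' := cderiv_holomorphic hu.
(* The derivative of the quotient at 0 is u''(0) / 2. Subtracting the Taylor polynomial of degree
   two from u leaves a derivative o(|w|), hence an increment o(|z|^2), and the division by z is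
   affordable. *)
set c := cderiv (cderiv u) 0; exists (c / 2) => e e0.
have [D D0 HD] := cderivP 0 hu' e0; exists D => // {}z; rewrite subr0 => zD.
have [->|z0] := eqVneq z 0; first by rewrite subrr mulr0 subr0 normc0 mulr0.
pose k w := u w - (cderiv u 0 * w + c / 2 * (w * w)).
have kz : normc (k z - k 0) <= e * normc z * normc (z - 0).
  apply: mean_value => t /andP[t0 t1]; rewrite add0r subr0.
  set w := t%:C * z; have nw : normc w <= normc z.
    by rewrite normcM normcR ger0_norm// ler_piMl ?normc_ge0.
  exists (cderiv u w - (cderiv u 0 * 1 + c / 2 * (w * 1 + w * 1))).
    apply: cdiffB; first exact: cderivP.
    apply: cdiffD; first exact: (cdiffZ _ (cdiff_id _)).
    by apply: cdiffZ; apply: cdiffM; exact: cdiff_id.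
  have -> : cderiv u w - (cderiv u 0 * 1 + c / 2 * (w * 1 + w * 1)) =
    cderiv u w - cderiv u 0 - c * (w - 0) by field.
  apply: le_trans (HD w _) _; rewrite subr0; first exact: le_lt_trans zD.
  by rewrite ler_wpM2l// ltW.
have -> : quot u z - quot u 0 - c / 2 * z = (k z - k 0) / z.
  by rewrite /quot eqxx (negbTE z0) /k; field.
by rewrite normcM normcV ler_pdivrMr ?normc_gt0//; move: kz; rewrite subr0.
Qed.

(** Near 0 the quotient is bounded by the derivative, far from 0 by direct division. The maximum
    principle would give 2 instead of 16. *)
Lemma quot_bound u rho M : holomorphic u -> 0 < rho ->
  disc_bound u 0 rho M -> disc_bound (quot u) 0 rho (16 / rho * M).
Proof.
move=> hu r0 uM z; rewrite subr0 => zr.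
have M0 := disc_bound_ge0 (ltW r0) uM.
have dM : disc_bound (cderiv u) 0 (rho / 2) (16 / rho * M).
  have -> : 16 / rho * M = 8 * M / (rho / 2) by field; rewrite gt_eqF.
  apply: cderiv_bound; rewrite ?divr_gt0//.
  by apply: disc_boundS uM _; rewrite subrr normc0; lra.
have [zr2|zr2] := leP (normc z) (rho / 2).
  rewrite /quot; have [z0|z0] := eqVneq z 0.
    by apply: dM; rewrite subrr normc0 divr_ge0// ltW.
  rewrite normcM normcV ler_pdivrMr ?normc_gt0// -{2}[z]subr0.
  by apply: (disc_lipschitz hu dM); rewrite ?subr0// normc0 divr_ge0// ltW.
have z0 : z != 0 by rewrite -normc_gt0 (lt_trans _ zr2)// divr_gt0.
rewrite /quot (negbTE z0) normcM normcV ler_pdivrMr ?normc_gt0//.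
apply: le_trans (normcB _ _) _.
have h1 : normc (u z) <= M by apply: uM; rewrite subr0.
have h2 : normc (u 0) <= M by apply: uM; rewrite subrr normc0 ltW.
have : 16 / rho * M * (rho / 2) <= 16 / rho * M * normc z.
  by rewrite ler_wpM2l ?(ltW zr2)// !mulr_ge0 ?invr_ge0// ltW.
have -> : 16 / rho * M * (rho / 2) = 8 * M by field; rewrite gt_eqF.
by lra.
Qed.

(** Characterises [quot]: it is computed for linear combinations, dilations and powers by exhibiting
    the function as c + z g(z) with g holomorphic. *)
Lemma quot_mulX (c : C) g : holomorphic g -> quot (fun z => c + z * g z) = g.
Proof.
move=> hg; apply/funext => z; rewrite /quot; have [->|z0] := eqVneq z 0.
  apply: cderivE; have [d gd] := hg 0.
  have := cdiffD (cdiff_cst c 0) (cdiffM (cdiff_id 0) gd).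
  by rewrite /= mul0r mulr1 !add0r.
by rewrite mul0r addr0 addrAC subrr add0r mulrC mulKf.
Qed.

Lemma quot_linear (a : C) u v : holomorphic u -> holomorphic v ->
  quot (fun z => a * u z + v z) = fun z => a * quot u z + quot v z.
Proof.
move=> hu hv; rewrite -[RHS](@quot_mulX (a * u 0 + v 0)); last first.
  apply: holomorphicD (quot_holomorphic hv).
  by apply: holomorphicM (quot_holomorphic hu); exact: holomorphic_cst.
by congr quot; apply/funext => z; rewrite (quotE u) (quotE v); ring.
Qed.

Lemma holomorphic_scale (c : C) u : holomorphic u -> holomorphic (fun z => u (c * z)).
Proof.
move=> hu z; have [d ud] := hu (c * z); exists (d * c) => e e0.
have c1 : 0 < normc c + 1 by rewrite ltr_wpDl ?normc_ge0.
have [D D0 HD] := ud (e / (normc c + 1)) (divr_gt0 e0 c1).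
exists (D / (normc c + 1)) => [|w]; first exact: divr_gt0.
rewrite ltr_pdivlMr// => wD.
have E : normc (c * w - c * z) <= (normc c + 1) * normc (w - z).
  by rewrite -mulrBr normcM ler_wpM2r ?normc_ge0// lerDl.
have -> : d * c * (w - z) = d * (c * w - c * z) by ring.
apply: le_trans (HD _ _) _; first by rewrite (le_lt_trans E)// mulrC.
have ec := divr_ge0 (ltW e0) (ltW c1).
by rewrite (le_trans (ler_wpM2l ec E))// mulrA divfK ?gt_eqF.
Qed.

Lemma quot_scale (c : C) u : holomorphic u ->
  quot (fun z => u (c * z)) = fun z => c * quot u (c * z).
Proof.
move=> hu; rewrite -[RHS](@quot_mulX (u 0)); last first.
  apply: holomorphicM; first exact: holomorphic_cst.
  by apply: (holomorphic_scale c); exact: quot_holomorphic.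
by congr quot; apply/funext => z; rewrite {1}(quotE u); ring.
Qed.

Definition coef n u : C := iter n quot u 0.

Lemma coefS n u : coef n.+1 u = coef n (quot u).
Proof. by rewrite /coef iterSr. Qed.

Lemma iter_quot_holomorphic n u : holomorphic u -> holomorphic (iter n quot u).
Proof. by move=> hu; elim: n => //= n; exact: quot_holomorphic. Qed.

Lemma iter_quot_bound n u rho M : holomorphic u -> 0 < rho ->
  disc_bound u 0 rho M -> disc_bound (iter n quot u) 0 rho ((16 / rho) ^+ n * M).
Proof.
move=> hu r0 uM; elim: n => [|n IH] /=; first by rewrite mul1r.
by rewrite exprS -mulrA; apply: quot_bound => //; exact: iter_quot_holomorphic.
Qed.

Lemma coef_bound n u rho M : holomorphic u -> 0 < rho ->
  disc_bound u 0 rho M -> normc (coef n u) <= (16 / rho) ^+ n * M.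
Proof.
by move=> hu r0 uM; apply: (iter_quot_bound n hu r0 uM); rewrite subrr normc0 ltW.
Qed.

Lemma coef_expansion n u z :
  u z = \sum_(k < n) coef k u * z ^+ k + z ^+ n * iter n quot u z.
Proof.
elim: n => [|n IH]; first by rewrite big_ord0 add0r mul1r.
rewrite IH big_ord_recr /= -addrA; congr (_ + _).
by rewrite (quotE (iter n quot u)) exprSr -/(coef n u); ring.
Qed.

Lemma coef_linear n (a : C) u v : holomorphic u -> holomorphic v ->
  coef n (fun z => a * u z + v z) = a * coef n u + coef n v.
Proof.
elim: n u v => [//|n IH] u v hu hv; rewrite !coefS quot_linear//.
by apply: IH; exact: quot_holomorphic.
Qed.

Lemma coef0 n : coef n (fun=> 0) = 0.
Proof.
elim: n => [//|n IH]; rewrite coefS -[RHS]IH; congr coef.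
rewrite -[RHS](@quot_mulX 0); last exact: holomorphic_cst.
by congr quot; apply/funext => z; rewrite mulr0 addr0.
Qed.

Lemma coefX n m : coef n (fun z => z ^+ m) = (n == m)%:R.
Proof.
elim: m n => [|m IH] [|n].
- by rewrite /coef /= expr0.
- rewrite coefS (_ : quot _ = fun=> 0) ?coef0//.
  rewrite -[RHS](@quot_mulX 1); last exact: holomorphic_cst.
  by congr quot; apply/funext => z; rewrite expr0 mulr0 addr0.
- by rewrite /coef /= expr0n.
rewrite coefS eqSS -IH (_ : quot _ = fun z => z ^+ m)//.
rewrite -[RHS](@quot_mulX 0); last exact: holomorphicX.
by congr quot; apply/funext => z; rewrite add0r exprS.
Qed.

Lemma coef_scale n (c : C) u : holomorphic u ->
  coef n (fun z => u (c * z)) = c ^+ n * coef n u.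
Proof.
elim: n u => [|n IH] u hu; first by rewrite mul1r /coef /= mulr0.
have hq := quot_holomorphic hu.
rewrite !coefS quot_scale//.
have -> : (fun z => c * quot u (c * z)) = (fun z => c * quot u (c * z) + 0).
  by apply/funext => z; rewrite addr0.
rewrite coef_linear; [|exact: holomorphic_scale|exact: holomorphic_cst].
by rewrite IH// coef0 addr0 exprS mulrA.
Qed.

Lemma coef_sum n N (F : nat -> C -> C) (a : nat -> C) :
  (forall k, holomorphic (F k)) ->
  coef n (fun z => \sum_(k < N) a k * F k z) = \sum_(k < N) a k * coef n (F k).
Proof.
move=> hF; elim: N => [|N IH].
  rewrite big_ord0 (_ : (fun z => _) = fun=> 0) ?coef0//.
  by apply/funext => z; rewrite big_ord0.
rewrite big_ord_recr /= addrC -IH -coef_linear//; last first.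
  apply: (@holomorphic_sum _ N (fun k z => a k * F k z)) => k.
  by apply: holomorphicM => //; exact: holomorphic_cst.
by congr (coef n _); apply/funext => z; rewrite big_ord_recr addrC.
Qed.

End TaylorCoefficients.

(** * Power series in z^r and r-even entire functions *)

Section LacunarySeries.
Variables (R : realType) (r : nat).
Hypothesis r_gt0 : (0 < r)%N.
Local Notation C := R[i].
Local Notation Co := (R[i]^o).
Implicit Types (u v : C -> C) (z w : C) (a x : nat -> C) (M rho : R).

(** The single place where a [limn] is shown to be an actual limit. As q <= 1/2, the tail is at most
    twice its first bound; [cauchy_limit] doubles it again. *)
Lemma geometric_series x q M : 0 <= q <= 2^-1 ->
  (forall n, normc (x n) <= M * q ^+ n) ->
  forall N, normc (limn (series (x : Co^nat)) - \sum_(n < N) x n) <=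
    4 * M * q ^+ N.
Proof.
move=> /andP[q0 q2] xM; pose S N := \sum_(n < N) x n.
have M0 : 0 <= M by have := xM 0%N; rewrite expr0 mulr1; apply: le_trans; exact: normc_ge0.
have SB n m : (n <= m)%N -> normc (S m - S n) <= 2 * M * q ^+ n.
  move=> /subnKC <-; move: (m - n)%N => k.
  (* The subtracted term makes the induction close: it absorbs the next summand because q <= 1/2. *)
  suff : normc (S (n + k)%N - S n) <= 2 * M * q ^+ n - 2 * M * q ^+ (n + k).
    by move/le_trans; apply; rewrite lerBlDr lerDl mulr_ge0 ?mulr_ge0 ?exprn_ge0.
  elim: k => [|k IH]; first by rewrite addn0 !subrr normc0.
  rewrite addnS /S big_ord_recr /= addrAC (le_trans (normcD _ _))//.
  have := xM (n + k)%N; have : q * q ^+ (n + k) <= 2^-1 * q ^+ (n + k).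
    by rewrite ler_wpM2r// exprn_ge0.
  rewrite exprS; move: IH; rewrite /S.
  by set q1 := q ^+ n; set q3 := q ^+ (n + k); nra.
have [l lP] := cauchy_limit SB.
suff -> : limn (series (x : Co^nat)) = l.
  by move=> N; have := lP N; rewrite !mulrA -natrM.
apply: cvg_lim; first exact: norm_hausdorff.
apply/cvgrPdist_lt => e' /posc[e e0 ->].
have M1 : 0 < 4 * M + 1 by rewrite ltr_wpDl// mulr_ge0.
have [N hN] := exists_half_lt (divr_gt0 e0 M1).
exists N => // n /= Nn; rewrite ltcR_norm /series /= big_mkord.
apply: le_lt_trans (lP n) _.
have : q ^+ n <= 2^-1 ^+ n by rewrite lerXn2r// nnegrE invr_ge0.
have : (2^-1 : R) ^+ n <= 2^-1 ^+ N by rewrite ler_wiXn2l ?invr_ge0// invf_le1// ler1n.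
have : 0 <= q ^+ n by rewrite exprn_ge0.
move: hN; rewrite ltr_pdivlMr//; set p := q ^+ n; set p1 := _ ^+ n; set p2 := _ ^+ N; nra.
Qed.

(** Equivalent to an infinite radius of convergence of the series with terms a_n z^(rn). *)
Definition rapid a := forall rho : R, 0 < rho ->
  exists M, forall n, normc (a n) * rho ^+ (r * n) <= M.

Definition lacunary a z : C := limn (series ((fun n => a n * z ^+ (r * n)) : Co^nat)).

Lemma expr_half_le n : (2^-1 : R) ^+ (r * n) <= 2^-1 ^+ n.
Proof. by rewrite ler_wiXn2l ?invr_ge0 ?leq_pmull// invf_le1// ler1n. Qed.

Lemma term_bound a rho M : 0 < rho ->
  (forall n, normc (a n) * (2 * rho) ^+ (r * n) <= M) ->
  forall n z, normc z <= rho -> normc (a n * z ^+ (r * n)) <= M * 2^-1 ^+ n.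
Proof.
move=> r0 aM n z zr; have M0 : 0 <= M.
  by apply: le_trans (aM 0%N); rewrite mulr_ge0 ?normc_ge0 ?exprn_ge0 ?mulr_ge0 ?ltW.
rewrite normcM normcX.
apply: (@le_trans _ _ (normc (a n) * (2 * rho) ^+ (r * n) * 2^-1 ^+ (r * n))).
  rewrite -mulrA -exprMn mulrAC divff// mul1r ler_wpM2l ?normc_ge0//.
  by rewrite lerXn2r ?nnegrE ?normc_ge0// ltW.
have rr : 0 <= 2 * rho by rewrite mulr_ge0// ltW.
by apply: ler_pM; rewrite ?expr_half_le// ?exprn_ge0 ?invr_ge0// mulr_ge0 ?normc_ge0// exprn_ge0.
Qed.

Lemma lacunary_approx a rho M : 0 < rho ->
  (forall n, normc (a n) * (2 * rho) ^+ (r * n) <= M) ->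
  forall N z, normc z <= rho ->
    normc (lacunary a z - \sum_(n < N) a n * z ^+ (r * n)) <= 4 * M * 2^-1 ^+ N.
Proof.
move=> r0 aM N z zr.
apply: (@geometric_series (fun n => a n * z ^+ (r * n))) => [|n].
  by rewrite invr_ge0 ler0n lexx.
exact: (term_bound r0 aM).
Qed.

Lemma rapid_approx a rho : rapid a -> 0 < rho -> exists2 M, 0 <= M &
  forall N z, normc z <= rho ->
    normc (lacunary a z - \sum_(n < N) a n * z ^+ (r * n)) <= M * 2^-1 ^+ N.
Proof.
move=> ra r0; have [M aM] := ra _ (mulr_gt0 (ltr0Sn R 1) r0).
exists (4 * M); last by move=> N z zr; exact: lacunary_approx zr.
have := lacunary_approx r0 aM 0%N (z := 0); rewrite normc0 expr0 mulr1.
by move=> /(_ (ltW r0)); apply: le_trans; exact: normc_ge0.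
Qed.

Lemma holomorphic_psum a N : holomorphic (fun z : C => \sum_(n < N) a n * z ^+ (r * n)).
Proof.
apply: (@holomorphic_sum _ N (fun n z => a n * z ^+ (r * n))) => n.
by apply: holomorphicM; [exact: holomorphic_cst|exact: holomorphicX].
Qed.

Lemma lacunary_holomorphic a : rapid a -> holomorphic (lacunary a).
Proof.
move=> ra; apply: weierstrass => rho e r0 e0.
have [M M0 aM] := rapid_approx ra r0.
have [|N hN] := @exists_half_lt R (e / (M + 1)); first by rewrite divr_gt0// ltr_wpDl.
exists (fun z => \sum_(n < N) a n * z ^+ (r * n)); first exact: holomorphic_psum.
move=> z zr; apply: le_trans (aM N z zr) _.
have : 0 <= (2^-1 : R) ^+ N by rewrite exprn_ge0// invr_ge0.
by move: hN; rewrite ltr_pdivlMr ?ltr_wpDl//; set q := _ ^+ N; lra.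
Qed.

(** Coefficients of the partial sums are read off from [coefX], and [coef_bound] on the unit disc
    lets them pass to the uniform limit. *)
Lemma lacunary_coef a n : rapid a -> coef (r * n) (lacunary a) = a n.
Proof.
move=> ra; have [M M0 aM] := rapid_approx ra (ltr01 : 0 < 1 :> R).
apply/eqP; rewrite -subr_eq0; apply/eqP.
apply: (@normc_half_eq0 _ _ (16 ^+ (r * n) * M)) => N.
pose K := (n.+1 + N)%N.
pose p z := \sum_(k < K) a k * z ^+ (r * k).
have hp : holomorphic p := @holomorphic_psum a K.
have hl := lacunary_holomorphic ra.
have -> : a n = coef (r * n) p.
  rewrite /p (@coef_sum _ (r * n) K (fun k z => z ^+ (r * k)) a); last first.
    by move=> k; exact: holomorphicX.
  have nK : (n < K)%N by rewrite /K addSn ltnS leq_addr.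
  rewrite (bigD1 (Ordinal nK)) //= coefX eqxx mulr1 big1 ?addr0// => k kn.
  rewrite coefX eqn_pmul2l// (_ : (n == k) = false) ?mulr0//.
  by apply/negbTE; move: kn; rewrite eq_sym -val_eqE.
have -> : coef (r * n) (lacunary a) - coef (r * n) p =
    coef (r * n) (fun z => -1 * p z + lacunary a z).
  by rewrite coef_linear// mulN1r addrC.
have := @coef_bound _ (r * n) (fun z => -1 * p z + lacunary a z) 1 (M * 2^-1 ^+ N).
rewrite divr1 mulrA; apply=> //.
  apply: holomorphicD => //; apply: holomorphicM => //; exact: holomorphic_cst.
move=> z; rewrite subr0 => z1; rewrite mulN1r addrC.
apply: le_trans (aM K z z1) _; rewrite ler_wpM2l//.
by rewrite ler_wiXn2l ?invr_ge0 ?leq_addl// invf_le1// ler1n.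
Qed.

Lemma coef_rapid u : holomorphic u -> rapid (fun n => coef (r * n) u).
Proof.
(* The radius 16 rho cancels the 16 in [coef_bound]. *)
move=> hu rho r0; have r16 : 0 < 16 * rho by rewrite mulr_gt0.
have [M uM] := holomorphic_bounded 0 hu r16; exists M => n.
have := coef_bound (r * n) hu r16 uM.
rewrite invfM mulrA divff// mul1r exprVn => h.
by rewrite mulrC -ler_pdivlMl ?exprn_gt0.
Qed.

Lemma even_psum u N z : (forall k, ~~ (r %| k)%N -> coef k u = 0) ->
  \sum_(k < r * N) coef k u * z ^+ k = \sum_(n < N) coef (r * n) u * z ^+ (r * n).
Proof.
move=> u0; elim: N => [|N IH]; first by rewrite muln0 !big_ord0.
rewrite -(big_mkord predT (fun k => coef k u * z ^+ k)) mulnS addnC.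
rewrite (@big_cat_nat _ _ _ (r * N)) ?leq_addr//= big_mkord IH big_ord_recr /=.
have rN : (r * N < r * N + r)%N by rewrite -{1}[(r * N)%N]addn0 ltn_add2l.
congr (_ + _); rewrite (big_ltn rN) -[RHS]addr0; congr (_ + _).
rewrite big_nat_cond big1//.
move=> k /andP[/andP[k1 k2] _]; rewrite u0 ?mul0r//.
apply/negP => /dvdnP[j kj]; move: k1 k2; rewrite kj [(j * r)%N]mulnC addnC -mulnS.
by rewrite !ltn_pmul2l// ltnS ltnNge => /negP.
Qed.

(** With radius 32 rho the remainder of [coef_expansion] carries the factor rho * 16 / (32 rho) =
    1/2 to the power rN. *)
Lemma even_approx u rho M : holomorphic u ->
  (forall k, ~~ (r %| k)%N -> coef k u = 0) -> 0 < rho ->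
  disc_bound u 0 (32 * rho) M -> forall N z, normc z <= rho ->
  normc (u z - \sum_(n < N) coef (r * n) u * z ^+ (r * n)) <= M * 2^-1 ^+ N.
Proof.
move=> hu u0 r0 uM N z zr; have r32 : 0 < 32 * rho by rewrite mulr_gt0.
have M0 := disc_bound_ge0 (ltW r32) uM.
rewrite (coef_expansion (r * N) u z) even_psum// addrAC subrr add0r.
rewrite normcM normcX.
have := iter_quot_bound (r * N) hu r32 uM (z := z).
rewrite subr0 => /(_ _) h.
apply: (@le_trans _ _ (rho ^+ (r * N) * ((16 / (32 * rho)) ^+ (r * N) * M))).
  rewrite ler_pM ?exprn_ge0 ?normc_ge0//; last by apply: h; lra.
  by rewrite lerXn2r ?nnegrE ?normc_ge0// ltW.
rewrite mulrA -exprMn (_ : rho * _ = 2^-1); last by field; rewrite gt_eqF.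
by rewrite mulrC ler_wpM2l// expr_half_le.
Qed.

Lemma even_lacunary u : holomorphic u ->
  (forall k, ~~ (r %| k)%N -> coef k u = 0) ->
  forall z, u z = lacunary (fun n => coef (r * n) u) z.
Proof.
move=> hu u0 z; pose rho := normc z + 1.
have r0 : 0 < rho by rewrite ltr_wpDl ?normc_ge0.
have zr : normc z <= rho by rewrite lerDl.
have [M uM] := @holomorphic_bounded _ u 0 (32 * rho) hu (mulr_gt0 (ltr0Sn _ _) r0).
have [M' _ aM] := rapid_approx (coef_rapid hu) r0.
apply/eqP; rewrite -subr_eq0; apply/eqP.
apply: (@normc_half_eq0 _ _ (M + M')) => N.
have := even_approx hu u0 r0 uM N zr; have := aM N z zr; rewrite mulrDl => h1 h2.
apply: le_trans (normc_triangle _ (\sum_(n < N) coef (r * n) u * z ^+ (r * n)) _) _.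
by rewrite lerD// normcBC.
Qed.

Lemma omegaX k : omega R r ^+ k = cis (2 * pi / r%:R * k%:R).
Proof.
elim: k => [|k IH]; first by rewrite mulr0 cis0.
by rewrite exprS IH -[omega R r]/(cis (2 * pi / r%:R)) -cisD -natr1; congr cis; ring.
Qed.

Lemma omegaXr : omega R r ^+ r = 1.
Proof. by rewrite omegaX divfK ?cis2pi// pnatr_eq0 -lt0n. Qed.

(** Reduce k to its remainder m modulo r. If m > 0, then x = pi m / r lies strictly between 0 and
    pi, so sin x > 0 and cos 2x = 1 - 2 sin^2 x < 1. *)
Lemma omegaX_eq1 k : omega R r ^+ k = 1 -> (r %| k)%N.
Proof.
rewrite {1}(divn_eq k r) exprD mulnC exprM omegaXr expr1n mul1r omegaX.
rewrite /dvdn; set m := (k %% r)%N => /eqP; have mr : (m < r)%N by rewrite ltn_mod.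
rewrite eq_complex => /andP[/eqP + _]; have [//|m0] := posnP m.
pose x : R := pi * (m%:R / r%:R).
have -> : 2 * pi / r%:R * m%:R = x *+ 2 :> R.
  by rewrite /x -mulr_natl; field; rewrite pnatr_eq0 -lt0n.
rewrite [complex.Re _]/= cos_mulr2n cos2sin2.
have : 0 < sin x.
  apply: sin_gt0_pi; rewrite /x mulr_gt0 ?pi_gt0 ?divr_gt0 ?ltr0n//=.
  by rewrite gtr_pMr ?pi_gt0// ltr_pdivrMr ?ltr0n// mul1r ltr_nat.
set s := sin x => s0 /=; rewrite -mulr_natl => E.
suff : 0 < s ^+ 2 by lra.
by rewrite exprn_gt0.
Qed.

(** Comparing coefficients of u(omega z) = u(z) gives (omega^k - 1) c_k = 0. *)
Lemma even_coef0 u : holomorphic u -> r_even r u ->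
  forall k, ~~ (r %| k)%N -> coef k u = 0.
Proof.
move=> hu eu k rk.
have r1 : (1 < r)%N by case: r rk r_gt0 => [|[|]] //; rewrite dvd1n.
have : coef k (fun z => u (omega R r * z)) = coef k u.
  congr coef; apply/funext => z.
  by have := eu z 1%N; rewrite expr1; apply; rewrite /= -ltnS prednK.
rewrite coef_scale// => /eqP; rewrite -subr_eq0 -[X in _ - X]mul1r -mulrBl.
rewrite mulf_eq0 subr_eq0 => /orP[/eqP/omegaX_eq1|/eqP//].
by rewrite (negbTE rk).
Qed.

Lemma lacunary_even a : r_even r (lacunary a).
Proof.
move=> z k _; rewrite /lacunary.
suff E : (fun n => a n * (omega R r ^+ k * z) ^+ (r * n)) = (fun n => a n * z ^+ (r * n)).
  by rewrite -[in RHS]E.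
apply/funext => n; congr (_ * _).
by rewrite exprMn -exprM mulnCA exprM omegaXr expr1n mul1r.
Qed.

End LacunarySeries.

(** * The Gamma function *)

Section GammaFunction.
Variable R : realType.
Local Notation mu := (@lebesgue_measure R).
Implicit Types x t : R.

Definition gamma_integrand x t : R := t `^ (x - 1) * expR (- t).

(** Kept in the extended reals: the functional equation is proved before finiteness, which is then
    deduced from it. *)
Definition gamma_integral x : \bar R :=
  (\int[mu]_(t in `]0%R, +oo[) (gamma_integrand x t)%:E)%E.

Lemma gamma_integrand_ge0 x t : 0 <= gamma_integrand x t.
Proof. by rewrite mulr_ge0 ?powR_ge0 ?expR_ge0. Qed.

Lemma measurable_gamma_integrand x : measurable_fun [set: R] (gamma_integrand x).
Proof.
apply: measurable_funM; first exact: measurable_powR.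
by apply: measurableT_comp; [exact: measurable_expR|exact: oppr_measurable].
Qed.

(** The offset 2 makes the interval nondegenerate already for n = 0, as integration by parts
    requires. *)
Definition gamma_itv n : set R := `[n.+2%:R^-1, n.+2%:R].

Lemma gamma_integral_cvg x :
  (\int[mu]_(t in gamma_itv n) (gamma_integrand x t)%:E)%E @[n --> \oo]
  --> gamma_integral x.
Proof.
have -> : gamma_integral x =
    (\int[mu]_(t in \bigcup_n gamma_itv n) (gamma_integrand x t)%:E)%E.
  congr integral; apply/seteqP; split=> t /=.
    rewrite in_itv/= andbT => t0.
    have tn0 : 0 <= Num.max t t^-1 by rewrite le_max ltW.
    exists (Num.truncn (Num.max t t^-1)) => //=.
    have := truncnS_gt (Num.max t t^-1); rewrite gt_max => /andP[h1 h2].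
    rewrite /gamma_itv /= in_itv/=; apply/andP; split.
      rewrite -[leRHS]invrK lef_pV2 ?posrE ?invr_gt0// ltW// (lt_le_trans h2)//.
      by rewrite ler_nat.
    by rewrite ltW// (lt_le_trans h1)// ler_nat.
  move=> [n _]; rewrite /gamma_itv /= !in_itv/= andbT => /andP[+ _].
  by apply: lt_le_trans; rewrite invr_gt0.
apply: ge0_nondecreasing_set_cvg_integral => //.
- apply/nondecreasing_seqP => n; rewrite subsetEset => t.
  rewrite /gamma_itv /= !in_itv/= => /andP[h1 h2]; apply/andP; split.
    by apply: le_trans h1; rewrite lef_pV2 ?posrE// ler_nat.
  by apply: le_trans h2 _; rewrite ler_nat.
- by move=> n; exact: measurable_itv.
- by move=> n; apply/measurable_EFinP; apply: measurable_funTS; exact: measurable_gamma_integrand.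
- by move=> n t _; rewrite lee_fin gamma_integrand_ge0.
Qed.

Definition gamma_boundary x n : R :=
  n.+2%:R^-1 `^ x * expR (- n.+2%:R^-1) - n.+2%:R `^ x * expR (- n.+2%:R).

Lemma is_derive_expRN t : is_derive t (1 : R) (fun t : R => - expR (- t)) (expR (- t)).
Proof.
have h : is_derive t (1 : R) (fun t => expR (- t)) (expR (- t) * - 1).
  exact: (@is_derive1_comp _ (@expR R) (-%R)).
have := is_deriveN h; rewrite mulrN1 opprK; exact.
Qed.

Lemma gamma_by_parts x n : 0 < x ->
  (\int[mu]_(t in gamma_itv n) (gamma_integrand (x + 1) t)%:E =
   (gamma_boundary x n)%:E +
   x%:E * \int[mu]_(t in gamma_itv n) (gamma_integrand x t)%:E)%E.
Proof.
move=> x0; set a : R := n.+2%:R^-1; set b : R := n.+2%:R.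
have a0 : 0 < a by rewrite invr_gt0.
have ab : a < b.
  apply: (@lt_trans _ _ 1); first by rewrite invf_lt1// ltr1n.
  by rewrite ltr1n.
have pos t : t \in `[a, b] -> 0 < t.
  by rewrite in_itv/= => /andP[+ _]; exact: lt_le_trans.
have pos' t : t \in `]a, b[ -> 0 < t.
  by rewrite in_itv/= => /andP[+ _]; exact: lt_trans.
have cont (f df : R -> R) : (forall t : R, 0 < t -> is_derive t (1 : R) f (df t)) ->
    forall t, 0 < t -> {for t, continuous f}.
  move=> fd t t0; apply/differentiable_continuous/derivable1_diffP.
  by have [] := fd t t0.
have LR (f df : R -> R) : (forall t : R, 0 < t -> is_derive t (1 : R) f (df t)) ->
    derivable_oo_LRcontinuous f a b.
  move=> fd; split.
  - by move=> t /pos' t0; have [] := fd t t0.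
  - by apply/cvg_at_right_filter; exact: (cont _ _ fd _ a0).
  - by apply/cvg_at_left_filter; apply: (cont _ _ fd); exact: lt_trans ab.
have within (f : R -> R) : (forall t, 0 < t -> {for t, continuous f}) ->
    {within `[a, b], continuous f}.
  move=> cf; apply: continuous_in_subspaceT => t; rewrite inE => /pos.
  exact: cf.
have dpow t : 0 < t -> is_derive t (1 : R) (fun t : R => t `^ x) (x * t `^ (x - 1)).
  exact: is_derive1_powR.
have dexp t : 0 < t -> is_derive t (1 : R) (fun t : R => - expR (- t)) (expR (- t)).
  by move=> _; exact: is_derive_expRN.
have := @integration_by_parts R (fun t : R => t `^ x) (fun t => - expR (- t))
  (fun t => x * t `^ (x - 1)) (fun t => expR (- t)) a b ab.
move=> /(_ _ (LR _ _ dpow) _ _ (LR _ _ dexp) _) IBP.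
transitivity (\int[mu]_(t in `[a, b]) (t `^ x * expR (- t))%:E)%E.
  by apply: eq_integral => t _; rewrite /gamma_integrand addrK.
rewrite IBP; last 4 first.
- apply: within => t t0; apply: cvgM; first exact: cvg_cst.
  have [y y1] : exists y, y = x - 1 by exists (x - 1).
  by rewrite -y1; apply: (cont _ _ (fun t => @is_derive1_powR _ y t)).
- by move=> t /pos' t0; rewrite derive1E; have [] := dpow t t0.
- by apply: within => t _; apply: continuous_comp; [exact: continuousN|exact: continuous_expR].
- by move=> t /pos' t0; rewrite derive1E; have [] := dexp t t0.
congr (_ + _)%E.
  by rewrite /gamma_boundary !mulrN opprK addrC.
transitivity (- \int[mu]_(t in `[a, b]) - (x%:E * (gamma_integrand x t)%:E))%E.
  congr (- _)%E; apply: eq_integral => t _.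
  by rewrite -EFinM -EFinN /gamma_integrand mulrN mulrA.
rewrite integral_ge0N ?oppeK; last first.
  by move=> t _; rewrite -EFinM lee_fin mulr_ge0 ?gamma_integrand_ge0// ltW.
rewrite ge0_integralZl//.
- by apply/measurable_EFinP; apply: measurable_funTS; exact: measurable_gamma_integrand.
- by move=> t _; rewrite lee_fin gamma_integrand_ge0.
- by rewrite lee_fin ltW.
Qed.

Lemma gamma_boundary_cvg0 x : 0 < x -> gamma_boundary x n @[n --> \oo] --> 0.
Proof.
move=> x0; rewrite -[X in _ --> X](subr0 0); apply: cvgB.
  have inv0 : (n.+2%:R^-1 : R) @[n --> \oo] --> 0^'+.
    move=> A /nbhs_ballP[e /= e0 eA].
    have /cvgrPdist_lt/(_ e e0)[N _ hN] := @cvg_harmonic R.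
    exists N => // n Nn; apply: eA => //=.
    exact: hN (n.+1) (leqW Nn).
  apply: (@squeeze_cvgr _ _ _ _ (fun=> 0) (fun n => (n.+2%:R^-1 : R) `^ x)).
  - apply: nearW => n; rewrite mulr_ge0 ?powR_ge0 ?expR_ge0//=.
    by rewrite ler_piMr ?powR_ge0// expR_le1 oppr_le0.
  - exact: cvg_cst.
  - exact: (cvg_comp _ _ inv0 (powR_cvg0 x0)).
(* An integer m >= x; the exponential series bounds b^(m+1) by (m+1)! e^b, and the spare power of b
   makes the term decay like 1 / b. *)
pose m := (Num.truncn x).+1.
apply: (@squeeze_cvgr _ _ _ _ (fun=> 0) (fun n => m.+1`!%:R * n.+1%:R^-1)).
- apply: nearW => n; rewrite mulr_ge0 ?powR_ge0 ?expR_ge0//=.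
  set b : R := n.+2%:R; have b0 : 0 < b by [].
  have h1 : b `^ x <= b ^+ m.
    rewrite -(powR_mulrn _ (ltW b0)); apply: ler_powR; first by rewrite ler1n.
    by rewrite ltW// truncnS_gt.
  have h2 : b ^+ m.+1 <= m.+1`!%:R * expR b.
    rewrite mulrC -ler_pdivrMr ?ltr0n ?fact_gt0//.
    by apply: le_trans (expR_ge1Dxn m (ltW b0)); rewrite lerDr.
  rewrite expRN ler_pdivrMr ?expR_gt0//.
  apply: (le_trans h1); rewrite mulrAC ler_pdivlMr// (le_trans _ h2)// exprSr.
  by rewrite ler_wpM2l ?exprn_ge0 ?(ltW b0)// ler_nat.
- exact: cvg_cst.
- rewrite -[X in _ --> X](mulr0 m.+1`!%:R); apply: cvgM; first exact: cvg_cst.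
  exact: cvg_harmonic.
Qed.

Lemma gamma_integral_ge0 x : (0 <= gamma_integral x)%E.
Proof. by apply: integral_ge0 => t _; rewrite lee_fin gamma_integrand_ge0. Qed.

Lemma gamma_integralS x : 0 < x ->
  gamma_integral (x + 1) = (x%:E * gamma_integral x)%E.
Proof.
move=> x0; rewrite -[RHS]add0e.
pose J n := (\int[mu]_(t in gamma_itv n) (gamma_integrand x t)%:E)%E.
have h : ((gamma_boundary x n)%:E + x%:E * J n)%E @[n --> \oo] -->
    (0 + x%:E * gamma_integral x)%E.
  apply: cvgeD => //.
    by apply: cvg_EFin; [exact: nearW|exact: gamma_boundary_cvg0].
  by apply: cvgeZl => //; exact: gamma_integral_cvg.
have := @gamma_integral_cvg (x + 1).
under eq_fun do rewrite gamma_by_parts//.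
by move=> h'; apply: cvg_unique h.
Qed.

Lemma gamma_integral1_lty : (gamma_integral 1 < +oo)%E.
Proof.
apply: le_lt_trans (ltry 1); rewrite -(@integral_exponential_pdf R 1 ltr01).
apply: (@le_trans _ _ (\int[mu]_(t in `]0%R, +oo[) (exponential_pdf 1 t)%:E)%E).
  rewrite le_eqVlt; apply/orP; left; apply/eqP; apply: eq_integral => t.
  rewrite inE /= in_itv/= andbT => t0.
  rewrite /gamma_integrand subrr powRr0 exponential_pdfE ?ltW//.
  by rewrite !mul1r mulN1r.
apply: ge0_subset_integral => //.
  by apply/measurable_EFinP; exact: measurable_exponential_pdf.
by move=> t _; rewrite lee_fin exponential_pdf_ge0.
Qed.

Lemma gamma_integral_nat_lty n : (gamma_integral n.+1%:R < +oo)%E.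
Proof.
elim: n => [|n IH]; first exact: gamma_integral1_lty.
rewrite -natr1 gamma_integralS// lte_mul_pinfty// ?lee_fin//.
Qed.

(** Passing to x + 1 makes the exponent of t positive, so that t^x <= 1 + t^m for an integer m >= x;
    both majorants have integer arguments. *)
Lemma gamma_integral_lty x : 0 < x -> (gamma_integral x < +oo)%E.
Proof.
move=> x0; suff : (gamma_integral (x + 1) < +oo)%E.
  rewrite gamma_integralS//; have := gamma_integral_ge0 x.
  by case: (gamma_integral x) => [y| |]// _; rewrite ?ltry// gt0_muley ?lte_fin.
pose m := (Num.truncn x).+1; have xm : x <= m%:R by rewrite ltW// truncnS_gt.
apply: (@le_lt_trans _ _ (gamma_integral 1 + gamma_integral m.+1%:R)%E); last first.
  by rewrite lte_add_pinfty ?gamma_integral1_lty ?gamma_integral_nat_lty.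
rewrite /gamma_integral -ge0_integralD//=; last 4 first.
- by move=> t _; rewrite lee_fin gamma_integrand_ge0.
- by apply/measurable_EFinP; apply: measurable_funTS; exact: measurable_gamma_integrand.
- by move=> t _; rewrite lee_fin gamma_integrand_ge0.
- by apply/measurable_EFinP; apply: measurable_funTS; exact: measurable_gamma_integrand.
apply: ge0_le_integral => //.
- by move=> t _; rewrite lee_fin gamma_integrand_ge0.
- by apply/measurable_EFinP; apply: measurable_funTS; exact: measurable_gamma_integrand.
- by apply: emeasurable_funD; apply/measurable_EFinP; apply: measurable_funTS;
    exact: measurable_gamma_integrand.
move=> t; rewrite /= in_itv/= andbT => t0; rewrite -EFinD lee_fin /gamma_integrand.
rewrite -mulrDl ler_wpM2r ?expR_ge0// subrr powRr0 addrK -natr1 addrK.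
have [t1|t1] := leP t 1.
  apply: (@le_trans _ _ 1); last by rewrite lerDl powR_ge0.
  by rewrite -(powRr0 t); apply: ger_powR; rewrite ?t0// ltW.
rewrite -[leLHS]add0r; apply: lerD => //; apply: ler_powR => //; exact: ltW.
Qed.

Lemma gamma_integral_gt0 x : 0 < x -> (0 < gamma_integral x)%E.
Proof.
move=> x0; apply: (@lt_le_trans _ _ (\int[mu]_(t in `[1%R, 2%R]) (2^-1 * expR (- 2))%:E)%E).
  rewrite integral_cst//= lebesgue_measure_itv/= lte_fin ltr1n.
  by rewrite -EFinB -EFinM lte_fin mulr_gt0 ?mulr_gt0 ?expR_gt0//; lra.
apply: (@le_trans _ _ (\int[mu]_(t in `[1%R, 2%R]) (gamma_integrand x t)%:E)%E).
  apply: ge0_le_integral => //.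
  - by apply/measurable_EFinP; apply: measurable_funTS; exact: measurable_gamma_integrand.
  move=> t; rewrite /= in_itv/= => /andP[t1 t2]; rewrite lee_fin.
  apply: ler_pM; rewrite ?expR_ge0//; last by rewrite ler_expR lerN2.
  have t0 : 0 < t by apply: lt_le_trans t1.
  apply: (@le_trans _ _ (t `^ (-1))).
    by rewrite powR_inv1 ?lef_pV2 ?posrE// ltW.
  by apply: ler_powR => //; lra.
apply: ge0_subset_integral => //.
- by apply/measurable_EFinP; apply: measurable_funTS; exact: measurable_gamma_integrand.
- by move=> t _; rewrite lee_fin gamma_integrand_ge0.
- by move=> t; rewrite /= !in_itv/= andbT => /andP[t1 _]; apply: lt_le_trans t1.
Qed.

Lemma GammaE x : 0 < x -> gamma_integral x = (Gamma x)%:E.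
Proof.
move=> x0; rewrite -[Gamma x]/(fine (gamma_integral x)) fineK//.
by rewrite ge0_fin_numE ?gamma_integral_ge0// gamma_integral_lty.
Qed.

Lemma Gamma_gt0 x : 0 < x -> 0 < Gamma x.
Proof. by move=> x0; rewrite -lte_fin -GammaE// gamma_integral_gt0. Qed.

Lemma GammaS x : 0 < x -> Gamma (x + 1) = x * Gamma x.
Proof.
move=> x0; apply: EFin_inj; rewrite EFinM -!GammaE ?addr_gt0//.
exact: gamma_integralS.
Qed.

End GammaFunction.

(** * Comparison of alpha_n with (rn)! *)

Section AlphaBounds.
Variables (R : realType) (r : nat) (gamma : 'I_r.-1 -> R).
Hypothesis r_gt0 : (0 < r)%N.
Hypothesis gamma_gt : forall k, -1 < gamma k.
Local Notation alpha := (alpha gamma).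

Lemma gammaD1_gt0 k (n : nat) : 0 < gamma k + n%:R + 1.
Proof. by have := gamma_gt k; have := ler0n R n; lra. Qed.

Lemma alpha0 : alpha 0 = 1.
Proof.
rewrite /alpha muln0 expr0 fact0 !mul1r big1// => k _.
rewrite addr0 divff// gt_eqF// Gamma_gt0//.
by have := gammaD1_gt0 k 0; rewrite addr0.
Qed.

Lemma alphaS n : alpha n.+1 =
  alpha n * (r%:R ^+ r * n.+1%:R * \prod_(k < r.-1) (gamma k + n%:R + 1)).
Proof.
rewrite /alpha mulnS exprD factS natrM.
have -> : \prod_(k < r.-1) (Gamma (gamma k + n.+1%:R + 1) / Gamma (gamma k + 1)) =
  (\prod_(k < r.-1) (gamma k + n%:R + 1)) *
  \prod_(k < r.-1) (Gamma (gamma k + n%:R + 1) / Gamma (gamma k + 1)).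
  rewrite -big_split; apply: eq_bigr => k _ /=.
  by rewrite -natr1 addrA GammaS ?mulrA// gammaD1_gt0.
ring.
Qed.

Lemma alpha_gt0 n : 0 < alpha n.
Proof.
elim: n => [|n IH]; first by rewrite alpha0.
have P0 : 0 < \prod_(k < r.-1) (gamma k + n%:R + 1).
  by apply: prodr_gt0 => k _; exact: gammaD1_gt0.
rewrite alphaS; apply: mulr_gt0 => //; apply: mulr_gt0 => //.
by rewrite mulr_gt0 ?exprn_gt0 ?ltr0n.
Qed.

(** Each new factor rn + j + 1 with j < r lies between n + 1 and r (n + 1). *)
Lemma fact_step n j : (j <= r)%N ->
  (n.+1 ^ j * (r * n)`! <= (r * n + j)`! <= (r * n.+1) ^ j * (r * n)`!)%N.
Proof.
elim: j => [|j IH] jr; first by rewrite addn0 !mul1n !leqnn.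
have /andP[h1 h2] := IH (ltnW jr).
rewrite addnS factS !expnS -!(mulnA _ (_ ^ _)%N); apply/andP; split.
  by apply: leq_mul h1; rewrite ltnS (leq_trans (leq_pmull n r_gt0))// leq_addr.
by apply: leq_mul h2; rewrite mulnS [(r + _)%N]addnC -addnS leq_add2l.
Qed.

(** Passing from n to n + 1 multiplies both alpha_n and (rn)! by a quantity of order (n + 1)^r,
    since gamma_k + n + 1 lies between d (n + 1) and D (n + 1). *)
Lemma alpha_bounds : exists A B : R, [/\ 1 <= A, 1 <= B,
  forall n, (r * n)`!%:R <= A ^+ n * alpha n &
  forall n, alpha n <= B ^+ n * (r * n)`!%:R].
Proof.
have g0 k : 0 < gamma k + 1 by have := gamma_gt k; lra.
have [d [d0 d1 dg]] : exists d : R, [/\ 0 < d, d <= 1 & forall k, d <= gamma k + 1].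
  pose S := \sum_k (gamma k + 1)^-1.
  have S0 : 0 <= S by apply: sumr_ge0 => k _; rewrite invr_ge0 ltW.
  have S1 : 0 < 1 + S by rewrite ltr_pwDl.
  exists (1 + S)^-1; split; first by rewrite invr_gt0.
    by rewrite invf_le1// lerDl.
  move=> k; rewrite -[leRHS]invrK lef_pV2 ?posrE ?invr_gt0//.
  rewrite /S (bigD1 k)//= addrCA lerDl addr_ge0// sumr_ge0// => i _.
  by rewrite invr_ge0 ltW.
have [D [D1 gD]] : exists D : R, 1 <= D /\ forall k, gamma k + 1 <= D.
  exists (1 + \sum_k (gamma k + 1)); split.
    by rewrite lerDl sumr_ge0// => k _; rewrite ltW.
  move=> k; rewrite (bigD1 k)//= addrCA lerDl addr_ge0// sumr_ge0// => i _.
  by rewrite ltW.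
have rr : (r.-1.+1 = r)%N by rewrite prednK.
have nr n : (n.+1%:R : R) ^+ r = n.+1%:R * n.+1%:R ^+ r.-1 by rewrite -exprS rr.
have prodL n : (d * n.+1%:R) ^+ r.-1 <= \prod_(k < r.-1) (gamma k + n%:R + 1).
  rewrite -[r.-1 in X in X <= _]card_ord -prodr_const; apply: ler_prod => k _.
  rewrite mulr_ge0 ?(ltW d0)//= -natr1 mulrDr mulr1.
  have : d * n%:R <= n%:R by rewrite ler_piMl.
  by have := dg k; lra.
have prodU n : \prod_(k < r.-1) (gamma k + n%:R + 1) <= (D * n.+1%:R) ^+ r.-1.
  rewrite -[r.-1 in X in _ <= X]card_ord -prodr_const; apply: ler_prod => k _.
  rewrite (ltW (gammaD1_gt0 _ _))/= -natr1 mulrDr mulr1.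
  have : n%:R <= D * n%:R by rewrite ler_peMl.
  by have := gD k; lra.
have r1 : 1 <= (r%:R : R) by rewrite ler1n.
(* In the first bound the r^r of [alphaS] matches that of [fact_step]; in the second it goes into
   B. *)
exists (d^-1 ^+ r.-1), (r%:R ^+ r * D ^+ r.-1); split.
- by rewrite exprn_ege1// invf_ge1.
- by rewrite -[leLHS]mulr1 ler_pM// exprn_ege1.
- elim=> [|n IH]; first by rewrite alpha0 muln0 expr0 mulr1.
  have /andP[_] := fact_step n (leqnn r).
  rewrite addnC -mulnS -(ler_nat R) natrM natrX natrM => h.
  apply: (le_trans h); rewrite alphaS exprMn.
  apply: (@le_trans _ _ (r%:R ^+ r * n.+1%:R ^+ r * (d^-1 ^+ r.-1 ^+ n * alpha n))).
    by rewrite ler_wpM2l// mulr_ge0// exprn_ge0.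
  have := prodL n; rewrite exprMn nr => hL.
  have -> : r%:R ^+ r * (n.+1%:R * n.+1%:R ^+ r.-1) * (d^-1 ^+ r.-1 ^+ n * alpha n) =
    d^-1 ^+ r.-1 ^+ n.+1 * (alpha n * (r%:R ^+ r * n.+1%:R * (d ^+ r.-1 * n.+1%:R ^+ r.-1))).
    rewrite [_ ^+ n.+1]exprS exprVn; field.
    by rewrite expf_neq0// gt_eqF.
  rewrite ler_wpM2l ?exprn_ge0 ?invr_ge0 ?(ltW d0)//.
  by rewrite ler_wpM2l ?(ltW (alpha_gt0 n))// ler_wpM2l// mulr_ge0// exprn_ge0.
elim=> [|n IH]; first by rewrite alpha0 muln0 expr0 mulr1.
have /andP[h _] := fact_step n (leqnn r).
move: h; rewrite addnC -mulnS -(ler_nat R) natrM natrX => h.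
rewrite alphaS; apply: (@le_trans _ _ ((r%:R ^+ r * D ^+ r.-1) ^+ n * (r * n)`!%:R *
  (r%:R ^+ r * n.+1%:R * (D ^+ r.-1 * n.+1%:R ^+ r.-1)))).
  apply: ler_pM => //; first exact: ltW (alpha_gt0 n).
    by rewrite mulr_ge0 ?mulr_ge0 ?exprn_ge0// prodr_ge0// => k _; rewrite ltW ?gammaD1_gt0.
  by rewrite ler_wpM2l ?mulr_ge0 ?exprn_ge0// -exprMn.
rewrite exprSr -!mulrA; rewrite ler_wpM2l ?exprn_ge0 ?mulr_ge0 ?exprn_ge0 ?(le_trans ler01 D1)//.
have -> : (r * n)`!%:R * (r%:R ^+ r * (n.+1%:R * (D ^+ r.-1 * n.+1%:R ^+ r.-1))) =
  r%:R ^+ r * (D ^+ r.-1 * (n.+1%:R ^+ r * (r * n)`!%:R)) :> R.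
  by rewrite nr; ring.
by rewrite !ler_wpM2l ?exprn_ge0// (le_trans ler01 D1).
Qed.

End AlphaBounds.

(** * Topologies of the function spaces *)

Section FunctionSpaceTopology.
Variable R : realType.
Local Notation C := R[i].
Local Notation Co := (R[i]^o).

Lemma entourage_normc (e : R) : 0 < e ->
  entourage [set p : Co * Co | normc (p.2 - p.1) < e].
Proof.
move=> e0; rewrite -entourage_ballE; exists e%:C; first by rewrite /= ltcR.
by move=> [x y]; rewrite -ball_normE /= ltcR_norm normcBC.
Qed.

Lemma entourage_normcP (E : set (Co * Co)) : entourage E ->
  exists2 e : R, 0 < e & forall x y, normc (y - x) < e -> E (x, y).
Proof.
rewrite -entourage_ballE => -[e' /posc[e e0 ->] eE]; exists e => // x y xy.
by apply: eE; rewrite -ball_normE /= ltcR_norm normcBC.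
Qed.

Lemma fam_nbhs_normc (U : choiceType) (fam : set U -> Prop) (A : set U)
    (f : {family fam, U -> Co}) (e : R) : 0 < e -> fam A ->
  nbhs f [set g | forall y, A y -> normc (g y - f y) < e].
Proof.
move=> e0 fA.
exact: (@fam_nbhs U Co fam A _ f (entourage_normc e0) fA).
Qed.

(** Applied to filters built for the purpose, it yields neighbourhood statements in the topology of
    uniform convergence on a family without an explicit base. *)
Lemma fam_cvg_normc (U : choiceType) (fam : set U -> Prop)
    (F : set_system (U -> Co)) (f : U -> Co) : Filter F ->
  (forall A (e : R), fam A -> 0 < e ->
    F [set g | forall y, A y -> normc (g y - f y) < e]) ->
  F --> (f : {family fam, U -> Co}).
Proof.
move=> FF H; rewrite -fam_cvgE; apply/fam_cvgP => A fA P /uniform_nbhs[E [entE EP]].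
have [e e0 eE] := entourage_normcP entE.
by apply: filterS (H A e fA e0) => g gA; apply: EP => y Ay; apply: eE; exact: gA.
Qed.

Lemma complex_continuous :
  continuous (fun p : R * R => (p.1 +i* p.2) : Co).
Proof.
move=> [x y]; apply/cvgrPdist_lt => e' /posc[e e0 ->].
have e2 : 0 < e / 2 by rewrite divr_gt0.
exists (ball x (e / 2), ball y (e / 2)).
  by split; apply: nbhsx_ballx.
move=> [a b] [] /=; rewrite -!ball_normE /= => xa yb; rewrite ltcR_norm.
apply: le_lt_trans (normc_ReIm _) _; rewrite [e]splitr ltrD//.
Qed.

Lemma disc_compact_cover (rho : R) : exists2 K : set Co, compact K &
  forall z : C, normc z <= rho -> K z.
Proof.
exists ((fun p : R * R => (p.1 +i* p.2) : Co) @` (`[- rho, rho] `*` `[- rho, rho])).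
  apply: continuous_compact; last by apply: compact_setX; exact: segment_compact.
  by apply: continuous_subspaceT; exact: complex_continuous.
move=> z zr; exists (complex.Re z, complex.Im z); last by case: z zr.
split; rewrite /= in_itv/= -ler_norml; first exact: le_trans (normc_Re _) zr.
exact: le_trans (normc_Im _) zr.
Qed.

Lemma compact_disc_bound (K : set Co) : compact K ->
  exists2 rho : R, 0 < rho & forall z : C, K z -> normc z <= rho.
Proof.
move=> cK; have cn : continuous (fun z : Co => normc z : R).
  move=> z A /nbhs_ballP[e /= e0 eA].
  have eC : (0 : C) < e%:C by rewrite ltcR.
  apply: filterS (nbhsx_ballx (z : Co) e%:C eC) => w.
  rewrite -ball_normE /= ltcR_norm => zw; apply: eA; apply: le_lt_trans zw.
  rewrite ler_norml lerBlDr -lerBlDl.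
  have h1 := normcD (z - w) w; rewrite subrK in h1.
  have h2 := normcD (w - z) z; rewrite subrK (normcBC w) in h2.
  by rewrite lerBlDr; lra.
have /compact_bounded[M [_ HM]] := continuous_compact (continuous_subspaceT cn) cK.
exists (Num.max 1 (M + 1)); first by rewrite lt_max ltr01.
move=> z Kz; rewrite le_max; apply/orP; right.
apply: le_trans (ler_norm _) _; apply: (HM (M + 1)); first by rewrite ltrDl.
by exists z.
Qed.

Section HspaceTopology.
Variable r : nat.
Local Notation H := (Hspace R r).

Lemma Hspace_nbhs (u0 : H) (rho e : R) : 0 < e ->
  nbhs u0 [set u : H | forall z, normc z <= rho -> normc (u z - u0 z) < e].
Proof.
move=> e0; have [K cK rK] := disc_compact_cover rho.
have := @initial_continuous H _ (@Hfun R r : H -> {family compact, Co -> Co}) u0.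
move=> /(_ _ (fam_nbhs_normc _ e0 cK)) uN.
apply: (@filterS _ (nbhs u0) (nbhs_filter u0)
  [set u : H | forall y, K y -> normc (u y - u0 y) < e]) => [u uK z zr|].
  by apply: uK; exact: rK.
exact: uN.
Qed.

Lemma Hspace_nbhs0 (V : set H) : nbhs (0 : H) V ->
  exists2 rho : R, 0 < rho & exists2 e : R, 0 < e &
    forall u : H, (forall z, normc z <= rho -> normc (u z) <= e) -> V u.
Proof.
move=> [_ [[B oB <-] B0 BV]].
(* The filter generated by the sup-norm balls on discs. It converges to 0, hence contains every
   neighbourhood of 0. *)
pose G := [set A : set (Co -> Co) | exists2 rho : R, 0 < rho & exists2 e : R, 0 < e &
  [set f | forall z, normc z <= rho -> normc (f z) <= e] `<=` A].
have FG : Filter G.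
  split.
  - by exists 1 => //; exists 1.
  - move=> P Q [r1 r10 [e1 e10 h1]] [r2 r20 [e2 e20 h2]].
    exists (Num.max r1 r2); first by rewrite lt_max r10.
    exists (Num.min e1 e2); first by rewrite lt_min e10.
    move=> f fz; split; [apply: h1|apply: h2] => z zr.
      by have := fz z; rewrite le_max zr le_min => /(_ isT)/andP[].
    by have := fz z; rewrite le_max zr orbT le_min => /(_ isT)/andP[].
  - by move=> P Q PQ [r1 r10 [e1 e10 h1]]; exists r1 => //; exists e1 => // f /h1/PQ.
have HG (A : set Co) (e : R) : compact A -> 0 < e ->
    G [set g | forall y, A y -> normc (g y - (0 : H) y) < e].
  move=> cA e0; have [rho r0 Ar] := compact_disc_bound cA.
  exists rho => //; exists (e / 2); first by rewrite divr_gt0.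
  move=> f fz z Az; rewrite [X in _ - X](_ : _ = 0)// subr0.
  by apply: le_lt_trans (fz z (Ar z Az)) _; rewrite ltr_pdivrMr// ltr_pMr ?ltr1n.
have nB : nbhs ((@Hfun R r 0 : Co -> Co) : {family compact, Co -> Co}) B.
  by apply: open_nbhs_nbhs; split.
have [rho r0 [e e0 h]] := @fam_cvg_normc Co compact G (0 : H) FG HG B nB.
exists rho => //; exists e => // u uz.
by apply: BV; apply: h.
Qed.

Lemma vN_bounded_disc (B : set H) (rho : R) : vN_bounded B ->
  exists2 M : R, 0 <= M & forall u, B u -> disc_bound u 0 rho M.
Proof.
move=> bB; have [s s0 sB] := bB _ (Hspace_nbhs (0 : H) rho ltr01).
exists (normc s); first exact: normc_ge0.
move=> u Bu z; rewrite subr0 => zr.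
have [|v vV <-] := sB s _ u Bu; first by rewrite ger0_norm// ltW.
rewrite [normc _]normcM ler_piMr ?normc_ge0// ltW//.
by have := vV z zr; rewrite [X in _ - X](_ : _ = 0)// subr0.
Qed.

(** Together with [vN_bounded_disc], it turns boundedness in H_r into uniform boundedness on each
    disc. *)
Lemma vN_bounded_intro (B : set H) :
  (forall rho : R, 0 < rho -> exists2 M : R, 0 < M &
    forall u, B u -> disc_bound u 0 rho M) -> vN_bounded B.
Proof.
move=> hB V /Hspace_nbhs0[rho r0 [e e0 eV]]; have [M M0 BM] := hB rho r0.
exists (M / e)%:C; first by rewrite ltcR divr_gt0.
move=> t; rewrite normcE lecR => tM u Bu.
have tn : 0 < normc t by apply: lt_le_trans tM; rewrite divr_gt0.
have t0 : t != 0 by rewrite -normc_gt0.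
exists (t^-1 *: u); last by rewrite scalerA divff// scale1r.
apply: eV => z zr; rewrite [normc _]normcM normcV ler_pdivrMl//.
have := BM u Bu z; rewrite subr0 => /(_ zr)/le_trans; apply.
by rewrite -ler_pdivrMr.
Qed.

Lemma Hspace_holomorphic (u : H) : holomorphic u.
Proof.
have := valP u; rewrite inE => -[eu _] z; apply/cdifferentiableP; exact: eu.
Qed.

Lemma Hspace_even (u : H) : r_even r u.
Proof. by have := valP u; rewrite inE => -[]. Qed.

Lemma in_Hspace (u : C -> C) : holomorphic u -> r_even r u -> u \in @Hpred R r.
Proof. by move=> hu eu; rewrite inE; split => // z; apply/cdifferentiableP. Qed.

Lemma Hspace_ext (u v : H) : (forall z, u z = v z) -> u = v.
Proof. by move=> uv; apply: val_inj; apply/funext. Qed.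

Lemma HspaceE (a : C) (u v : H) z : (a *: u + v : H) z = a * u z + v z.
Proof. by []. Qed.

End HspaceTopology.

End FunctionSpaceTopology.

(** * Continuous functionals on H_r and their values on monomials *)

Section DualSpace.
Variables (R : realType) (r : nat).
Hypothesis r_gt0 : (0 < r)%N.
Local Notation C := R[i].
Local Notation Co := (R[i]^o).
Local Notation H := (Hspace R r).
Implicit Types (T : dual H) (u v : H).

Lemma dual_linear T (a : C) u v : T (a *: u + v) = a * T u + T v.
Proof. by have := valP T; rewrite inE => -[lT _]; rewrite lT. Qed.

Lemma dual0 T : T 0 = 0.
Proof.
have := dual_linear T (-1) 0 0; rewrite scaler0 addr0 mulN1r addNr; exact.
Qed.

Lemma dualZ T (a : C) u : T (a *: u) = a * T u.
Proof. by have := dual_linear T a u 0; rewrite dual0 !addr0. Qed.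

Lemma dualD T u v : T (u + v) = T u + T v.
Proof. by have := dual_linear T 1 u v; rewrite scale1r mul1r. Qed.

Lemma dual_ext (S T : dual H) : (forall u, S u = T u) -> S = T.
Proof. by move=> ST; apply: val_inj; apply/funext. Qed.

Lemma dual_nbhs T u (A : set Co) : nbhs (T u : Co) A -> nbhs u [set v : H | A (T v)].
Proof.
case: T => f fP; have [_ cf] := set_mem fP; rewrite [dual_fun _]/= => fA.
have := cf u A fA; rewrite nbhs_simpl; exact.
Qed.

Lemma dual_bound T : exists2 rho : R, 0 < rho & exists2 K : R, 0 <= K &
  forall u M, disc_bound u 0 rho M -> normc (T u) <= K * M.
Proof.
have e1 : (0 : C) < 1 by [].
have nV : nbhs (0 : H) [set u : H | ball (T 0 : Co) 1 (T u)].
  by apply: dual_nbhs; exact: nbhsx_ballx.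
have [rho r0 [e e0 h]] := Hspace_nbhs0 nV.
exists rho => //; exists e^-1; first by rewrite invr_ge0 ltW.
move=> u M uM; have M0 := disc_bound_ge0 (ltW r0) uM.
apply/ler_addgt0Pr => d d0.
(* M may be 0, so u is scaled by e / M' with M' > 0; the surplus d is arbitrary. *)
pose M' := M + e * d; have M'0 : 0 < M' by rewrite ltr_wpDl// mulr_gt0.
pose s : C := (e / M')%:C.
have sn : normc s = e / M' by rewrite normcR gtr0_norm// divr_gt0.
have := h (s *: u); rewrite /= -ball_normE /= dual0 sub0r normrN dualZ.
have -> : (1 : C) = 1%:C by [].
rewrite ltcR_norm normcM sn => /(_ _)/ltW Tu.
have : e / M' * normc (T u) <= 1.
  apply: Tu => z zr; rewrite [normc _]normcM sn mulrAC ler_pdivrMr//.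
  rewrite ler_wpM2l ?(ltW e0)//; apply: (@le_trans _ _ M); last first.
    by rewrite lerDl mulr_ge0// ltW.
  by apply: uM; rewrite subr0.
rewrite mulrAC ler_pdivrMr// mul1r -ler_pdivlMl// => /le_trans; apply.
by rewrite /M' mulrDr mulKf ?gt_eqF.
Qed.

Lemma in_dual (T : H -> Co) (rho K : R) :
  (forall a u v, T (a *: u + v) = a * T u + T v) -> 0 <= K ->
  (forall u M, disc_bound u 0 rho M -> normc (T u) <= K * M) ->
  T \in @dual_pred _ H.
Proof.
move=> lT K0 TK; rewrite inE; split => // u0 A /nbhs_ballP[e' /posc[e e0 ->] eA].
have K1 : 0 < K + 1 by rewrite ltr_wpDl.
have := Hspace_nbhs u0 rho (divr_gt0 e0 K1).
apply: filterS => u uu0; apply: eA; rewrite -ball_normE /= ltcR_norm normcBC.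
have -> : T u - T u0 = T (-1 *: u0 + u) by rewrite lT mulN1r addrC.
have d : disc_bound (-1 *: u0 + u : H) 0 rho (e / (K + 1)).
  move=> z; rewrite subr0 => zr; rewrite HspaceE mulN1r addrC.
  exact: ltW (uu0 z zr).
apply: le_lt_trans (TK _ _ d) _.
by rewrite mulrCA gtr_pMr// ltr_pdivrMr// mul1r ltrDl.
Qed.

Lemma monomial_even n : r_even r (fun z : C => z ^+ (r * n)).
Proof.
by move=> z k _; rewrite exprMn -exprM mulnCA exprM omegaXr// expr1n mul1r.
Qed.

Definition monomial n : H :=
  HSpace (in_Hspace (@holomorphicX R (r * n)) (@monomial_even n)).

Lemma monomialE n z : monomial n z = z ^+ (r * n).
Proof. by []. Qed.

Lemma monomial_bound n (rho : R) : disc_bound (monomial n) 0 rho (rho ^+ (r * n)).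
Proof.
move=> z; rewrite subr0 => zr; rewrite monomialE normcX.
by rewrite lerXn2r ?nnegrE ?normc_ge0// (le_trans (normc_ge0 z)).
Qed.

Lemma coef_monomial n m : coef (r * n) (monomial m) = (n == m)%:R.
Proof. by rewrite (@coefX R) eqn_pmul2l. Qed.

Definition partial_sum (a : nat -> C) N : H := \sum_(n < N) a n *: monomial n.

Lemma partial_sumE a N z : partial_sum a N z = \sum_(n < N) a n * z ^+ (r * n).
Proof.
elim: N => [|N IH]; first by rewrite /partial_sum !big_ord0.
by rewrite /partial_sum !big_ord_recr /= -IH.
Qed.

Lemma dual_partial_sum T a N :
  T (partial_sum a N) = \sum_(n < N) a n * T (monomial n).
Proof.
elim: N => [|N IH]; first by rewrite /partial_sum !big_ord0 dual0.
by rewrite /partial_sum !big_ord_recr /= -IH dualD dualZ.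
Qed.

Lemma Hspace_coef0 u k : ~~ (r %| k)%N -> coef k u = 0.
Proof.
by move=> rk; apply: (even_coef0 r_gt0 (Hspace_holomorphic u) (@Hspace_even _ _ u)).
Qed.

(** T is dominated by the sup norm on the disc of radius rho, and there the partial sums converge by
    [even_approx], for which u is bounded on radius 32 rho. *)
Lemma dual_series T u : exists M : R, forall N,
  normc (T u - \sum_(n < N) coef (r * n) u * T (monomial n)) <= M * 2^-1 ^+ N.
Proof.
have [rho r0 [K K0 TK]] := dual_bound T.
have [M uM] := holomorphic_bounded 0 (Hspace_holomorphic u) (mulr_gt0 (ltr0Sn R 31) r0).
exists (K * M) => N.
rewrite -(dual_partial_sum T (fun n => coef (r * n) u)) -mulrA.
have -> : T u - T (partial_sum (fun n => coef (r * n) u) N) =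
    T (-1 *: partial_sum (fun n => coef (r * n) u) N + u).
  by rewrite dual_linear mulN1r addrC.
apply: TK => z; rewrite subr0 => zr.
rewrite HspaceE mulN1r addrC partial_sumE.
apply: (even_approx r_gt0 (Hspace_holomorphic u) _ r0 uM) => // k.
exact: Hspace_coef0.
Qed.

Lemma dual_monomial_bound T : exists2 rho : R, 0 < rho & exists2 K : R, 0 <= K &
  forall n, normc (T (monomial n)) <= K * rho ^+ (r * n).
Proof.
have [rho r0 [K K0 TK]] := dual_bound T; exists rho => //; exists K => // n.
by apply: TK; exact: monomial_bound.
Qed.

End DualSpace.

(** * The Fourier transform and its inverse *)

Section FourierTransform.
Variables (R : realType) (r : nat) (gamma : 'I_r.-1 -> R).
Hypothesis r_gt0 : (0 < r)%N.
Hypothesis gamma_gt : forall k, -1 < gamma k.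
Local Notation C := R[i].
Local Notation Co := (R[i]^o).
Local Notation H := (Hspace R r).
Local Notation E := (Expspace R r).
Local Notation alpha := (alpha gamma).
Local Notation mon := (monomial R r_gt0).
Implicit Types (T : dual H) (u v : H).

Variables A B : R.
Hypothesis A_ge1 : 1 <= A.
Hypothesis B_ge1 : 1 <= B.
Hypothesis fact_le_alpha : forall n, (r * n)`!%:R <= A ^+ n * alpha n.
Hypothesis alpha_le_fact : forall n, alpha n <= B ^+ n * (r * n)`!%:R.

Lemma exp_term (x : R) m : 0 <= x -> x ^+ m / m`!%:R <= expR x.
Proof.
case: m => [|m] x0; first by rewrite expr0 fact0 divr1 -expR0 ler_expR.
by apply: le_trans (expR_ge1Dxn m x0); rewrite lerDr.
Qed.

Definition jcoef n : C := (-1) ^+ n / (alpha n)%:C.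

Lemma normc_sign n : normc ((-1) ^+ n : C) = 1.
Proof. by rewrite normcX normcN normc1 expr1n. Qed.

Lemma alphaC_neq0 n : (alpha n)%:C != 0 :> C.
Proof. by rewrite -normc_gt0 normcR normr_gt0 gt_eqF// alpha_gt0. Qed.

Lemma normc_jcoef n : normc (jcoef n) = (alpha n)^-1.
Proof. by rewrite normcM normc_sign mul1r normcV normcR gtr0_norm// alpha_gt0. Qed.

Lemma jgammaE w : jgamma gamma w = lacunary r jcoef w.
Proof.
rewrite /jgamma /lacunary.
suff E : (fun n => (-1) ^+ n * w ^+ (r * n) / (alpha n)%:C) =
    (fun n => jcoef n * w ^+ (r * n)) by rewrite -[in RHS]E.
by apply/funext => n; rewrite mulrAC.
Qed.

Lemma exp_le_mul (x : R) n : 1 <= x -> x ^+ n <= x ^+ (r * n).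
Proof. by move=> x1; rewrite ler_weXn2l// leq_pmull. Qed.

(** Since 1 / alpha_n <= A^n / (rn)!, one term of the exponential series bounds the left side.
    Inflating its argument by 4 yields 4^-n; a mere 2^-n would be lost in [fourier_map_small], which
    multiplies the tail by 2^N. *)
Lemma jcoef_term (t : nat -> C) (K s : R) : 0 <= K -> 0 <= s ->
  (forall n, normc (t n) <= K * s ^+ (r * n)) -> forall n z,
  normc (jcoef n * t n * z ^+ (r * n)) <=
    K * expR (4 * A * s * normc z) * 4^-1 ^+ n.
Proof.
move=> K0 s0 tK n z; set m := (r * n)%N; set x := s * normc z.
have x0 : 0 <= x by rewrite mulr_ge0 ?normc_ge0.
have A0 : 0 <= A by apply: le_trans A_ge1.
have a0 := alpha_gt0 r_gt0 gamma_gt n.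
have m0 : (0 : R) < m`!%:R by rewrite ltr0n fact_gt0.
apply: (@le_trans _ _ (K * ((alpha n)^-1 * x ^+ m))).
  rewrite -mulrA normcM normc_jcoef normcM normcX [leRHS]mulrCA.
  rewrite ler_wpM2l ?invr_ge0 ?(ltW a0)//.
  by rewrite exprMn mulrA ler_wpM2r ?exprn_ge0 ?normc_ge0.
rewrite -mulrA ler_wpM2l//.
apply: (@le_trans _ _ ((A * x) ^+ m / m`!%:R)).
  rewrite mulrC ler_pdivrMr// mulrAC ler_pdivlMr//.
  have -> : (A * x) ^+ m * alpha n = A ^+ m * alpha n * x ^+ m by rewrite exprMn; ring.
  rewrite [leLHS]mulrC ler_wpM2r ?exprn_ge0//.
  apply: (le_trans (fact_le_alpha n)); rewrite ler_wpM2r ?(ltW a0)//.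
  exact: exp_le_mul.
have -> : A * x = 4 * A * s * normc z * 4^-1 by rewrite /x; field.
rewrite exprMn mulrAC; apply: ler_pM; rewrite ?exprn_ge0 ?invr_ge0//.
- by rewrite mulr_ge0 ?invr_ge0 ?(ltW m0)// exprn_ge0// !mulr_ge0 ?normc_ge0.
- by apply: exp_term; rewrite !mulr_ge0 ?normc_ge0.
- by rewrite ler_wiXn2l ?invr_ge0 ?leq_pmull// invf_le1// ler1n.
Qed.

Lemma jcoef_rapid (t : nat -> C) (K s : R) : 0 <= K -> 0 <= s ->
  (forall n, normc (t n) <= K * s ^+ (r * n)) ->
  rapid r (fun n => jcoef n * t n).
Proof.
move=> K0 s0 tK rho r0; exists (K * expR (4 * A * s * rho)) => n.
have := jcoef_term K0 s0 tK n rho%:C; rewrite normcM normcX normcR gtr0_norm//.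
move/le_trans; apply; rewrite ler_piMr ?mulr_ge0 ?expR_ge0//.
by rewrite exprn_ile1 ?invr_ge0// invf_le1// ler1n.
Qed.

Lemma jcoef_tail (t : nat -> C) (K s : R) : 0 <= K -> 0 <= s ->
  (forall n, normc (t n) <= K * s ^+ (r * n)) -> forall N z,
  normc (lacunary r (fun n => jcoef n * t n) z -
         \sum_(n < N) jcoef n * t n * z ^+ (r * n)) <=
    4 * K * expR (4 * A * s * normc z) * 4^-1 ^+ N.
Proof.
move=> K0 s0 tK N z; rewrite -[4 * K * _]mulrA.
apply: (@geometric_series _ (fun n => jcoef n * t n * z ^+ (r * n))) => [|n].
  by rewrite invr_ge0 ler0n lef_pV2 ?posrE// ler_nat.
exact: jcoef_term.
Qed.

Lemma lacunary_in_Hspace (a : nat -> C) : rapid r a -> lacunary r a \in @Hpred R r.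
Proof.
by move=> ra; apply: in_Hspace; [exact: lacunary_holomorphic|exact: lacunary_even].
Qed.

Lemma jgamma_scaleE z :
  (fun w : C => jgamma gamma (w * z)) = lacunary r (fun n => jcoef n * z ^+ (r * n)).
Proof.
apply/funext => w; rewrite jgammaE /lacunary.
suff E : (fun n => jcoef n * (w * z) ^+ (r * n)) =
    (fun n => jcoef n * z ^+ (r * n) * w ^+ (r * n)) by rewrite -[in RHS]E.
by apply/funext => n; rewrite exprMn mulrCA mulrC.
Qed.

Lemma jgamma_rapid (z : C) : rapid r (fun n => jcoef n * z ^+ (r * n)).
Proof.
apply: (@jcoef_rapid (fun n => z ^+ (r * n)) 1 (normc z)) => //.
  exact: normc_ge0.
by move=> n; rewrite mul1r normcX.
Qed.

Lemma jgamma_in_Hspace (z : C) : (fun w : C => jgamma gamma (w * z)) \in @Hpred R r.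
Proof. by rewrite jgamma_scaleE; apply: lacunary_in_Hspace; exact: jgamma_rapid. Qed.

Definition fcoef T n : C := jcoef n * T (mon n).

Lemma fcoef_rapid T : rapid r (fcoef T).
Proof.
have [s s0 [K K0 TK]] := dual_monomial_bound r_gt0 T.
exact: jcoef_rapid K0 (ltW s0) TK.
Qed.

(** For fixed z, T is applied term by term to the Taylor series of w |-> j(w z), which lies in H_r,
    so [insubd] does not return its default. *)
Lemma fourierE T z : fourier gamma T z = lacunary r (fcoef T) z.
Proof.
rewrite /fourier; set u : H := insubd _ _.
have uE : (u : C -> C) = lacunary r (fun n => jcoef n * z ^+ (r * n)).
  rewrite -jgamma_scaleE; exact: (insubdK (0 : H) (jgamma_in_Hspace z)).
have [M hM] := dual_series r_gt0 T u.
have z1 : 0 < normc z + 1 by rewrite ltr_wpDl ?normc_ge0.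
have zz : normc z <= normc z + 1 by rewrite lerDl.
have [M' _ hM'] := rapid_approx r_gt0 (@fcoef_rapid T) z1.
apply/eqP; rewrite -subr_eq0; apply/eqP.
apply: (@normc_half_eq0 _ _ (M + M')) => N.
have := hM N; have := hM' N z zz.
have -> : \sum_(n < N) coef (r * n) u * T (mon n) =
    \sum_(n < N) fcoef T n * z ^+ (r * n).
  apply: eq_bigr => n _; rewrite uE lacunary_coef//; last exact: jgamma_rapid.
  by rewrite /fcoef mulrAC.
move=> h1 h2; apply: le_trans (normc_triangle _ _ _) _; rewrite mulrDl.
by apply: lerD h2 _; rewrite normcBC.
Qed.

Lemma monomial_exp_bound n (k : R) z : 0 < k ->
  normc (z ^+ n) * expR (- (k * normc z)) <= n`!%:R / k ^+ n.
Proof.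
move=> k0; have n0 : (0 : R) < n`!%:R by rewrite ltr0n fact_gt0.
have := @exp_term (k * normc z) n; rewrite mulr_ge0 ?normc_ge0 ?(ltW k0)// => /(_ isT).
rewrite exprMn ler_pdivrMr// => h.
rewrite normcX expRN ler_pdivrMr ?expR_gt0// mulrAC ler_pdivlMr ?exprn_gt0//.
by rewrite mulrC [_ * expR _]mulrC.
Qed.

Lemma monomial_exp n : exp_type (mon n).
Proof.
exists 1; first exact: ltr01.
apply: (@le_lt_trans _ _ ((r * n)`!%:R / 1 ^+ (r * n) : R)%:E); last exact: ltry.
by apply/expnorm_leP => z; apply: monomial_exp_bound.
Qed.

Lemma in_exp_pred u : exp_type u -> u \in @exp_pred R r.
Proof. by move=> eu; rewrite inE. Qed.

Lemma Exp_ext (f g : E) : (forall z, f z = g z) -> f = g.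
Proof. by move=> fg; apply: val_inj; apply: Hspace_ext. Qed.

Definition expmon n : E := ExpSpace (in_exp_pred (monomial_exp n)).

(** Built from the series, for which holomorphy and evenness are known; [fourier_mapE] identifies it
    with [fourier]. *)
Definition fourier_entire T : H := HSpace (lacunary_in_Hspace (@fcoef_rapid T)).

Lemma fourier_entire_tail T : exists2 a : R, 0 < a & exists2 K : R, 0 <= K &
  forall N z, normc (fourier_entire T z - \sum_(n < N) fcoef T n * z ^+ (r * n)) <=
    K * expR (a * normc z) * 4^-1 ^+ N.
Proof.
have [s s0 [K K0 TK]] := dual_monomial_bound r_gt0 T.
exists (4 * A * s); first by rewrite !mulr_gt0// (lt_le_trans ltr01).
exists (4 * K); first by rewrite mulr_ge0.
by move=> N z; exact: (jcoef_tail K0 (ltW s0) TK).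
Qed.

Lemma fourier_entire_exp T : exp_type (fourier_entire T).
Proof.
have [a a0 [K K0 H]] := fourier_entire_tail T; exists a => //.
apply: (@le_lt_trans _ _ K%:E); last exact: ltry.
apply/expnorm_leP => z; have := H 0%N z; rewrite big_ord0 subr0 expr0 mulr1.
by rewrite expRN ler_pdivrMr ?expR_gt0.
Qed.

Definition fourier_map T : E := ExpSpace (in_exp_pred (fourier_entire_exp T)).

Lemma fourier_mapE T z : fourier_map T z = fourier gamma T z.
Proof. by rewrite fourierE. Qed.

Lemma fourier_map_linear : linear fourier_map.
Proof.
move=> a S T; apply: Exp_ext => z.
have -> : (a *: fourier_map S + fourier_map T : E) z =
  a * fourier_map S z + fourier_map T z by [].
(* [fourier] evaluates the functional at an element that depends on z alone, so linearity in T holds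
   by conversion. *)
by rewrite !fourier_mapE.
Qed.

Lemma Exp_sumE (a : nat -> C) N z :
  (\sum_(n < N) a n *: expmon n : E) z = \sum_(n < N) a n * z ^+ (r * n).
Proof.
elim: N => [|N IH]; first by rewrite !big_ord0.
by rewrite !big_ord_recr /= -IH.
Qed.

Lemma Exp_nbhs0_mid (W : set E) x y : Exp_nbhs0 W -> W x -> W y ->
  W (2^-1 *: x + 2^-1 *: y).
Proof.
move=> [/convex_setE cW _] Wx Wy.
have i0 : 0 <= (2^-1 : R[i]) by rewrite invr_ge0 ler0n.
have i1 : (2^-1 : R[i]) <= 1 by rewrite invf_le1 ?ler1n// ltr0n.
have := cW _ _ (Itv01 i0 i1) Wx Wy; rewrite /=.
suff -> : 1 - 2^-1 = 2^-1 :> R[i] by [].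
by field.
Qed.

Definition scaled_monomial n (c : C) : E := (2 ^+ n.+1 * (jcoef n * c)) *: expmon n.

(* [F D] lies in the convex set W as the infinite convex combination
   [\sum_n 2^-(n+1) x_n] of the points [x_n = 2^(n+1) b_n z^(rn)], where [b_n]
   are the Taylor coefficients of [F D]. *)
Lemma fourier_map_small (W : set E) (D : dual H) : Exp_nbhs0 W ->
  (forall n c, c != 0 -> ~ W (scaled_monomial n c^-1) ->
    normc (D (c *: mon n)) < 1) ->
  W (fourier_map D).
Proof.
move=> hW hD; pose x n := scaled_monomial n (D (mon n)).
have Wx n : W (x n).
  (* If x_n were outside W with D(z^(rn)) != 0, then c = 1 / D(z^(rn)) would be a failing multiple
     with D(c z^(rn)) = 1. *)
  apply: contrapT => nW; have [d0|d0] := eqVneq (D (mon n)) 0.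
    by apply: nW; rewrite /x /scaled_monomial d0 !mulr0 scale0r; exact: Exp_nbhs0_0.
  have := hD n (D (mon n))^-1; rewrite invr_eq0 invrK => /(_ d0 nW).
  by rewrite dualZ mulVf// normc1 ltxx.
pose S n : E := \sum_(k < n) fcoef D k *: expmon k.
(* Rescaled remainders avoid the infinite combination, so W need not be closed: y_0 = F(D), y_n is
   the midpoint of x_n and y_(n+1), and y_N lies in W for large N because 2^N 4^-N = 2^-N. *)
pose y n : E := 2 ^+ n *: (fourier_map D - S n).
have ymid n : y n = 2^-1 *: x n + 2^-1 *: y n.+1.
  rewrite /y /x /scaled_monomial /S big_ord_recr /= opprD addrA !scalerA.
  have -> : 2^-1 * (2 ^+ n.+1 * (jcoef n * D (mon n))) = 2 ^+ n * fcoef D n.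
    by rewrite exprS /fcoef; field.
  have -> : 2^-1 * 2 ^+ n.+1 = 2 ^+ n :> R[i] by rewrite exprS mulKf.
  by rewrite [in RHS]scalerBr scalerA [RHS]addrC subrK.
have [a a0 [K K0 tail]] := fourier_entire_tail D.
have [_ /(_ a a0)[e e0 eW]] := hW.
have K1 : 0 < K + 1 by rewrite ltr_wpDl.
have [N hN] := exists_half_lt (divr_gt0 e0 K1).
have WN : W (y N).
  apply: eW; apply: (@le_lt_trans _ _ (K * 2^-1 ^+ N)%:E); last first.
    rewrite lte_fin; move: hN; rewrite ltr_pdivlMr//.
    have : 0 <= (2^-1 : R) ^+ N by rewrite exprn_ge0// invr_ge0.
    by set q := _ ^+ N; lra.
  apply/expnorm_leP => z.
  have -> : y N z = 2 ^+ N * (fourier_entire D z - \sum_(n < N) fcoef D n * z ^+ (r * n)).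
    by rewrite -Exp_sumE.
  rewrite normcM normcX normc_nat expRN ler_pdivrMr ?expR_gt0//.
  apply: le_trans (ler_wpM2l _ (tail N z)) _; first by rewrite exprn_ge0.
  rewrite mulrCA -exprMn (_ : 2 * 4^-1 = 2^-1 :> R); last by field.
  by rewrite mulrAC.
suff : forall k, (k <= N)%N -> W (y (N - k)%N).
  move=> /(_ N (leqnn N)); rewrite subnn /y expr0 scale1r /S big_ord0 subr0; exact.
elim=> [|k IH] kN; first by rewrite subn0.
rewrite ymid; apply: Exp_nbhs0_mid => //.
by have := IH (ltnW kN); rewrite subnS prednK// subn_gt0.
Qed.

Lemma Hspace_scaleE (a : C) (u : H) z : (a *: u : H) z = a * u z.
Proof. by []. Qed.

Lemma Exp_scaleE (a : C) (f : E) z : (a *: f : E) z = a * f z.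
Proof. by []. Qed.

Lemma expnorm_scale_expmon n (a : C) (k : R) : 0 < k ->
  (expnorm k (a *: expmon n : E) <= (normc a * ((r * n)`!%:R / k ^+ (r * n)))%:E)%E.
Proof.
move=> k0; apply/expnorm_leP => z.
rewrite Exp_scaleE normcM -mulrA ler_wpM2l ?normc_ge0//.
exact: monomial_exp_bound.
Qed.

Lemma clear_denominators (e c f al p q k : R) : 0 < al -> 0 < c -> 0 < k -> 0 <= p ->
  f <= q * al -> e <= p * (al^-1 / c) * (f / k) -> e * (c * k) <= p * q.
Proof.
move=> al0 c0 k0 p0 fq he; rewrite -ler_pdivlMr ?mulr_gt0//; apply: (le_trans he).
have -> : p * (al^-1 / c) * (f / k) = p * (f / al) / (c * k).
  by field; rewrite !gt_eqF.
by rewrite ler_wpM2r ?invr_ge0 ?mulr_ge0 ?(ltW c0) ?(ltW k0)// ler_wpM2l// ler_pdivrMr.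
Qed.

(** A point outside W has P_k norm at least e, which gives |c| k^(rn) <= 2^(n+1) A^n / e. With k = 2
    A rho the powers are absorbed and |c| rho^(rn) <= 2 / e, uniformly in n. *)
Lemma scaled_monomial_bounded (W : set E) : Exp_nbhs0 W ->
  vN_bounded [set u : H | exists n c, [/\ c != 0, u = c *: mon n &
    ~ W (scaled_monomial n c^-1)]].
Proof.
move=> [_ bW]; apply: vN_bounded_intro => rho r0.
have A0 : 0 < A by apply: lt_le_trans A_ge1.
pose k := 2 * A * rho; have k0 : 0 < k by rewrite !mulr_gt0.
have [e e0 eW] := bW k k0; exists (2 / e); first by rewrite divr_gt0.
move=> _ [n [c [c0 -> nW]]].
suff h : normc c * rho ^+ (r * n) <= 2 / e.
  move=> z zr; rewrite Hspace_scaleE normcM; apply: le_trans h.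
  by rewrite ler_wpM2l ?normc_ge0//; exact: monomial_bound.
have cn : 0 < normc c by rewrite normc_gt0.
have a0 := alpha_gt0 r_gt0 gamma_gt n.
have km : 0 < k ^+ (r * n) by rewrite exprn_gt0.
set s := 2 ^+ n.+1 * (jcoef n * c^-1).
have sn : normc s = 2 ^+ n.+1 * ((alpha n)^-1 / normc c).
  by rewrite normcM normcX normc_nat normcM normc_jcoef normcV.
have : e <= normc s * ((r * n)`!%:R / k ^+ (r * n)).
  rewrite leNgt; apply/negP => lt; apply: nW; apply: eW.
  by apply: (le_lt_trans (expnorm_scale_expmon _ _ k0)); rewrite lte_fin.
rewrite sn => he.
have h1 : e * (normc c * k ^+ (r * n)) <= 2 ^+ n.+1 * A ^+ n.
  by apply: clear_denominators he; rewrite ?exprn_ge0.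
have A2 : 1 <= 2 * A by rewrite (le_trans A_ge1)// ler_peMl ?(ltW A0)// ler1n.
have h2 : 2 ^+ n.+1 * A ^+ n <= 2 * (2 * A) ^+ (r * n).
  by rewrite exprS -mulrA -exprMn ler_wpM2l// exp_le_mul.
rewrite ler_pdivlMr//.
have km2 : 0 < (2 * A) ^+ (r * n) by rewrite exprn_gt0// mulr_gt0.
rewrite -(ler_pM2r km2); apply: le_trans h2; apply: le_trans h1.
have -> : k ^+ (r * n) = (2 * A) ^+ (r * n) * rho ^+ (r * n) by rewrite /k exprMn.
by rewrite [e * _]mulrC mulrAC !mulrA [normc c * _ * _]mulrAC.
Qed.

Lemma fourier_map_continuous : continuous fourier_map.
Proof.
move=> T0 U /Exp_nbhsP[W hW WU].
have bB := scaled_monomial_bounded hW; set B' := [set u | _] in bB.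
have N : nbhs T0 [set T : dual H | forall u, B' u -> normc (T u - T0 u) < 1].
  have := @initial_continuous (dual H) _
    (@dual_fun _ H : dual H -> {family @vN_bounded _ H, H -> Co}) T0.
  by move=> /(_ _ (fam_nbhs_normc _ ltr01 bB)).
apply: (@filterS _ (nbhs T0) (nbhs_filter T0) _ _ _ N) => T hT /=.
have -> : fourier_map T = fourier_map T0 + fourier_map (-1 *: T0 + T).
  by rewrite fourier_map_linear scaleN1r addrA subrr add0r.
apply: WU; apply: fourier_map_small => // n c c0 nW.
have -> : (-1 *: T0 + T : dual H) (c *: mon n) = T (c *: mon n) - T0 (c *: mon n).
  have -> : (-1 *: T0 + T : dual H) (c *: mon n) = -1 * T0 (c *: mon n) + T (c *: mon n) by [].
  by rewrite mulN1r addrC.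
by apply: hT; exists n, c.
Qed.

(** * The inverse transform *)

Local Notation e1 := (expR (1 : R)).

Lemma fact_le_expn m : (m`! <= m.+1 ^ m)%N.
Proof.
elim: m => [//|m IH]; rewrite factS expnS leq_mul//.
by apply: leq_trans IH _; case: (m) => // k; rewrite leq_exp2r.
Qed.

(** The radius (m + 1) / a is close to m / a, where e^(a rho) / rho^m is smallest, and is positive
    also for m = 0. Its power (m + 1)^m cancels against m! <= (m + 1)^m. *)
Lemma exp_coef_bound (v : E) (a P : R) n : 0 < a -> (expnorm a v <= P%:E)%E ->
  alpha n * normc (coef (r * n) v) <= P * e1 * (16 * a * e1 * B) ^+ (r * n).
Proof.
move=> a0 /expnorm_leP vP; set m := (r * n)%N.
have B0 : 0 <= B by apply: le_trans B_ge1.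
have m0 : (0 : R) < m.+1%:R by [].
pose rho := m.+1%:R / a; have r0 : 0 < rho by rewrite divr_gt0.
have vM : disc_bound v 0 rho (P * e1 ^+ m.+1).
  move=> z; rewrite subr0 => zr; have := vP z.
  have P0 : 0 <= P.
    by apply: le_trans (vP 0); rewrite mulr_ge0 ?normc_ge0 ?expR_ge0.
  rewrite expRN ler_pdivrMr ?expR_gt0// => /le_trans; apply.
  rewrite ler_wpM2l// -expRM_natl mulr1 ler_expR.
  by rewrite mulrC -ler_pdivlMr.
have h1 := coef_bound m (Hspace_holomorphic v) r0 vM.
have h2 : alpha n <= B ^+ m * m.+1%:R ^+ m.
  apply: (le_trans (alpha_le_fact n)); apply: ler_pM; rewrite ?exprn_ge0//.
    exact: exp_le_mul.
  by rewrite -natrX ler_nat fact_le_expn.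
have a1 := ltW (alpha_gt0 r_gt0 gamma_gt n).
apply: le_trans (ler_pM a1 (normc_ge0 _) h2 h1) _.
have -> : (16 * a * e1 * B) ^+ m = B ^+ m * m.+1%:R ^+ m * (16 / rho) ^+ m * e1 ^+ m.
  by rewrite -!exprMn; congr (_ ^+ _); rewrite /rho; field; rewrite !gt_eqF.
rewrite exprS le_eqVlt; apply/orP; left; apply/eqP.
move: (B ^+ m) (m.+1%:R ^+ m) ((16 / rho) ^+ m) (e1 ^+ m) => x1 x2 x3 x4; ring.
Qed.

Definition inverse_term (v : E) (u : H) n : C :=
  (-1) ^+ n * (alpha n)%:C * coef (r * n) v * coef (r * n) u.

Definition inverse_fun (v : E) (u : H) : Co :=
  limn (series (inverse_term v u : Co^nat)).

(** The growth rate of alpha_n v_n from [exp_coef_bound], times 16 to cancel the constant of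
    [coef_bound] and 2 to gain 2^-n. *)
Definition inverse_radius (a : R) : R := 32 * (16 * a * e1 * B).

Lemma inverse_radius_gt0 a : 0 < a -> 0 < inverse_radius a.
Proof. by move=> a0; rewrite !mulr_gt0 ?expR_gt0// (lt_le_trans ltr01). Qed.

Lemma inverse_fun_approx (v : E) (u : H) (a P M : R) :
  0 < a -> (expnorm a v <= P%:E)%E -> disc_bound u 0 (inverse_radius a) M ->
  forall N, normc (inverse_fun v u - \sum_(n < N) inverse_term v u n) <=
    4 * (P * e1 * M) * 2^-1 ^+ N.
Proof.
move=> a0 vP uM; apply: geometric_series => [|n].
  by rewrite invr_ge0 ler0n lexx.
set s := 16 * a * e1 * B; have s0 : 0 < s.
  by rewrite !mulr_gt0 ?expR_gt0// (lt_le_trans ltr01).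
have h1 := exp_coef_bound n a0 vP.
have h2 := coef_bound (r * n) (Hspace_holomorphic u) (inverse_radius_gt0 a0) uM.
have a1 := ltW (alpha_gt0 r_gt0 gamma_gt n).
have M0 := disc_bound_ge0 (ltW (inverse_radius_gt0 a0)) uM.
have P0 : 0 <= P.
  move/expnorm_leP: vP => /(_ 0); apply: le_trans.
  by rewrite mulr_ge0 ?normc_ge0 ?expR_ge0.
rewrite /inverse_term normcM normcM normcM normc_sign mul1r normcR ger0_norm//.
apply: le_trans (ler_pM _ (normc_ge0 _) h1 h2) _.
  by rewrite mulr_ge0 ?normc_ge0.
rewrite -/s (_ : 16 / inverse_radius a = (2 * s)^-1); last first.
  by rewrite /inverse_radius -/s; field; rewrite gt_eqF.
rewrite exprVn [(2 * s) ^+ _]exprMn.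
have sm : 0 < s ^+ (r * n) by rewrite exprn_gt0.
have -> : P * e1 * s ^+ (r * n) * ((2 ^+ (r * n) * s ^+ (r * n))^-1 * M) =
  P * e1 * M * 2^-1 ^+ (r * n).
  rewrite exprVn; move: sm; move: (s ^+ (r * n)) => x x0.
  have : (2 : R) ^+ (r * n) != 0 by rewrite expf_neq0.
  move: (2 ^+ (r * n)) => y y0; field; rewrite y0 gt_eqF//.
rewrite ler_wpM2l ?mulr_ge0 ?expR_ge0//; exact: expr_half_le.
Qed.

Definition half_limit (l : C) (S : nat -> C) :=
  exists M : R, forall N, normc (l - S N) <= M * 2^-1 ^+ N.

Lemma half_limit_unique l l' S : half_limit l S -> half_limit l' S -> l = l'.
Proof.
move=> [M hM] [M' hM']; apply/eqP; rewrite -subr_eq0; apply/eqP.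
apply: (@normc_half_eq0 _ _ (M + M')) => N; rewrite mulrDl.
by rewrite (le_trans (normc_triangle _ (S N) _))// lerD// normcBC.
Qed.

Lemma half_limit_linear (c l l' : C) S S' : half_limit l S -> half_limit l' S' ->
  half_limit (c * l + l') (fun N => c * S N + S' N).
Proof.
move=> [M hM] [M' hM']; exists (normc c * M + M') => N.
have -> : c * l + l' - (c * S N + S' N) = c * (l - S N) + (l' - S' N) by ring.
rewrite (le_trans (normcD _ _))// mulrDl lerD// normcM -mulrA.
by rewrite ler_wpM2l ?normc_ge0.
Qed.

Lemma Exp_bound (v : E) : exists2 a : R, 0 < a & exists P : R, (expnorm a v <= P%:E)%E.
Proof.
have := valP v; rewrite inE => -[a a0 /expnorm_ltyP[P _ vP]].
by exists a => //; exists P.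
Qed.

Lemma inverse_fun_limit (v : E) u :
  half_limit (inverse_fun v u) (fun N => \sum_(n < N) inverse_term v u n).
Proof.
have [a a0 [P vP]] := Exp_bound v.
have [M uM] := holomorphic_bounded 0 (Hspace_holomorphic u) (inverse_radius_gt0 a0).
by exists (4 * (P * e1 * M)) => N; exact: inverse_fun_approx vP uM N.
Qed.

Lemma Hspace_coef_linear n (c : C) (u w : H) :
  coef n (c *: u + w : H) = c * coef n u + coef n w.
Proof. by rewrite -coef_linear//; exact: Hspace_holomorphic. Qed.

Lemma inverse_fun_linear (v : E) (c : C) u w :
  inverse_fun v (c *: u + w) = c * inverse_fun v u + inverse_fun v w.
Proof.
apply: (half_limit_unique (inverse_fun_limit _ _)).
have := half_limit_linear c (inverse_fun_limit v u) (inverse_fun_limit v w).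
congr half_limit; apply/funext => N; rewrite mulr_sumr -big_split; apply: eq_bigr => n _.
by rewrite /inverse_term Hspace_coef_linear /=; ring.
Qed.

Lemma inverse_fun_linear_l (c : C) (f g : E) u :
  inverse_fun (c *: f + g) u = c * inverse_fun f u + inverse_fun g u.
Proof.
apply: (half_limit_unique (inverse_fun_limit _ _)).
have := half_limit_linear c (inverse_fun_limit f u) (inverse_fun_limit g u).
congr half_limit; apply/funext => N; rewrite mulr_sumr -big_split; apply: eq_bigr => n _.
have E' : coef (r * n) (c *: f + g : E) = c * coef (r * n) f + coef (r * n) g.
  exact: (Hspace_coef_linear _ c (f : H) (g : H)).
by rewrite /inverse_term E' /=; ring.
Qed.

Lemma inverse_fun_bound (v : E) (u : H) (a P M : R) :
  0 < a -> (expnorm a v <= P%:E)%E -> disc_bound u 0 (inverse_radius a) M ->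
  normc (inverse_fun v u) <= 4 * (P * e1) * M.
Proof.
move=> a0 vP uM; have := inverse_fun_approx a0 vP uM 0%N.
by rewrite big_ord0 subr0 expr0 mulr1 !mulrA.
Qed.

Lemma inverse_fun_dual (v : E) : inverse_fun v \in @dual_pred _ H.
Proof.
have [a a0 [P vP]] := Exp_bound v.
apply: (@in_dual _ _ _ (inverse_radius a) (4 * (P * e1))).
- exact: inverse_fun_linear.
- have P0 : 0 <= P.
    move/expnorm_leP: vP => /(_ 0); apply: le_trans.
    by rewrite mulr_ge0 ?normc_ge0 ?expR_ge0.
  by rewrite mulr_ge0// mulr_ge0 ?expR_ge0.
- by move=> u M; exact: inverse_fun_bound.
Qed.

Definition inverse_map (v : E) : dual H := Dual (inverse_fun_dual v).

Lemma inverse_mapE (v : E) u : inverse_map v u = inverse_fun v u.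
Proof. by []. Qed.

Lemma signed_alphaK n : (-1) ^+ n * (alpha n)%:C * jcoef n = 1.
Proof.
rewrite /jcoef mulrACA divff ?alphaC_neq0// mulr1 -expr2 -exprM mulnC exprM.
by rewrite sqrrN expr1n expr1n.
Qed.

Lemma fourier_mapK : cancel fourier_map inverse_map.
Proof.
move=> T; apply: dual_ext => u; rewrite inverse_mapE.
apply: (half_limit_unique (inverse_fun_limit _ _)).
have [M hM] := dual_series r_gt0 T u; exists M => N.
suff -> : \sum_(n < N) inverse_term (fourier_map T) u n =
  \sum_(n < N) coef (r * n) u * T (mon n) by exact: hM.
apply: eq_bigr => n _; rewrite /inverse_term.
have -> : coef (r * n) (fourier_map T) = fcoef T n.
  by apply: lacunary_coef => //; exact: fcoef_rapid.
by rewrite /fcoef mulrA signed_alphaK mul1r mulrC.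
Qed.

Lemma inverse_fun_monomial (v : E) n :
  inverse_fun v (mon n) = (-1) ^+ n * (alpha n)%:C * coef (r * n) v.
Proof.
set x := _ * coef _ _; apply: (half_limit_unique (inverse_fun_limit _ _)).
(* The series has only the n-th term; the constant covers the N <= n, for which the partial sum is
   still 0. *)
exists (normc x * 2 ^+ n) => N.
have -> : \sum_(k < N) inverse_term v (mon n) k = if (n < N)%N then x else 0.
  case: ltnP => nN.
    rewrite (bigD1 (Ordinal nN))//= big1 => [|k kn].
      by rewrite /inverse_term coef_monomial// eqxx mulr1 addr0.
    rewrite /inverse_term coef_monomial//.
    by have -> : (k == n :> nat) = false by [exact/negbTE]; rewrite mulr0.
  rewrite big1// => k _; rewrite /inverse_term coef_monomial//.
  by rewrite ltn_eqF ?mulr0// (leq_trans (ltn_ord k)).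
case: ltnP => nN.
  by rewrite subrr normc0 !mulr_ge0 ?normc_ge0 ?exprn_ge0 ?invr_ge0.
rewrite subr0 -mulrA ler_peMr ?normc_ge0//.
by rewrite exprVn -exprB ?unitfE// exprn_ege1// ler1n.
Qed.

Lemma inverse_mapK : cancel inverse_map fourier_map.
Proof.
move=> v; apply: Exp_ext => z; rewrite fourier_mapE fourierE.
rewrite [RHS](@even_lacunary _ r r_gt0 (v : H) (Hspace_holomorphic v)); last first.
  by move=> k; exact: Hspace_coef0.
congr (lacunary r _ z); apply/funext => n.
by rewrite /fcoef inverse_mapE inverse_fun_monomial mulrA [jcoef n * _]mulrC signed_alphaK mul1r.
Qed.

(** Comparable elements of R[i] have equal imaginary parts, so the coefficients of convex
    combinations are real. *)
Lemma i01_real (l : {i01 R[i]}) : exists2 t : R, 0 <= t <= 1 & l%:num = t%:C.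
Proof.
have l0 : 0 <= l%:num :> R[i] by [].
have l1 : l%:num <= 1 :> R[i] by [].
move: l0 l1; case: (l%:num) => x y; rewrite !lecE /= => /andP[/eqP-> x0] /andP[_ x1].
by exists x => //; rewrite x0.
Qed.

Lemma inverse_map_continuous : continuous inverse_map.
Proof.
move=> v0 U [_ [[B' oB <-] B0 BU]].
(* The image under [inverse_fun] of the neighbourhood filter of v0; it suffices that it converges
   uniformly on bounded sets. *)
pose G : set_system (H -> Co) := [set A' | nbhs v0 [set v : E | A' (inverse_fun v)]].
have FG : Filter G.
  split; first exact: filterT.
    by move=> P Q; exact: filterI.
  by move=> P Q PQ; apply: filterS => v; exact: PQ.
have HG (A' : set H) (e : R) : vN_bounded A' -> 0 < e ->
    G [set g | forall u, A' u -> normc (g u - inverse_fun v0 u) < e].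
  move=> bA e0; apply/Exp_nbhsP.
  exists [set w | forall u, A' u -> normc (inverse_fun w u) < e]; last first.
    move=> w hw u Au; have := hw u Au.
    have := inverse_fun_linear_l 1 w v0 u; rewrite scale1r mul1r addrC => ->.
    by rewrite addrK.
  split.
    apply/convex_setE => x y l hx hy u Au.
    rewrite inverse_fun_linear_l.
    have -> : inverse_fun ((1 - l%:num) *: y) u = (1 - l%:num) * inverse_fun y u.
      have := inverse_fun_linear_l (1 - l%:num) y 0 u; rewrite addr0 => ->.
      have := inverse_fun_linear_l (-1) (0 : E) (0 : E) u.
      by rewrite scaler0 addr0 mulN1r addNr => ->; rewrite addr0.
    have [t /andP[t0 t1] ->] := i01_real l.
    apply: le_lt_trans (normcD _ _) _.
    rewrite !normcM -[1 - _](rmorphB (real_complex R) 1 t) !normcR !ger0_norm ?subr_ge0//.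
    have h1 := hx u Au; have h2 := hy u Au.
    move: t0; rewrite le_eqVlt => /predU1P[<-|t0].
      by rewrite mul0r add0r subr0 mul1r.
    by nra.
  move=> a a0; have [M M0 AM] := vN_bounded_disc (inverse_radius a) bA.
  have e10 : 0 < e1 by exact: expR_gt0.
  have d0 : 0 < 4 * e1 * (M + 1) by rewrite !mulr_gt0// ltr_wpDl.
  (* M + 1 keeps the denominator positive when M = 0 and makes the final inequality strict. *)
  exists (e / (4 * e1 * (M + 1))); first by rewrite divr_gt0.
  move=> w /ltW hw u Au; apply: le_lt_trans (inverse_fun_bound a0 hw (AM u Au)) _.
  have -> : 4 * (e / (4 * e1 * (M + 1)) * e1) * M = e * (M / (M + 1)).
    by field; rewrite !gt_eqF// ltr_wpDl.
  by rewrite gtr_pMr// ltr_pdivrMr ?ltr_wpDl// mul1r ltrDl.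
have nB : nbhs ((inverse_fun v0 : H -> Co) : {family @vN_bounded _ H, H -> Co}) B'.
  by apply: open_nbhs_nbhs; split.
have NB : nbhs v0 [set v : E | B' (inverse_fun v)].
  exact: (@fam_cvg_normc R H (@vN_bounded _ H) G (inverse_fun v0) FG HG B' nB).
by apply: (@filterS _ (nbhs v0) (nbhs_filter v0) _ _ _ NB) => v hv; apply: BU.
Qed.

End FourierTransform.

(** The first conjunct ensures that [insubd] in [fourier] never falls back to 0. Since [fourier]
    takes values in plain functions, the second asks for a map into [Expspace] with the same
    values. *)
Theorem theorem3p4 (R : realType) (r : nat) (gamma : 'I_r.-1 -> R)
    (r_ge2 : (2 <= r)%N)
    (gamma_ge : forall k : 'I_r.-1, -1 + k.+1%:R / r%:R <= gamma k) :
  (forall z : R[i]^o,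
     (fun w : R[i]^o => jgamma gamma (w * z)) \in @Hpred R r) /\
  exists2 F : dual (Hspace R r) -> Expspace R r,
    (forall (T : dual (Hspace R r)) (z : R[i]^o), F T z = fourier gamma T z) &
    topological_isomorphism F.
Proof.
have r_gt0 : (0 < r)%N by exact: ltnW.
(* Makes all arguments of [Gamma] positive, where Euler's integral converges and the functional
   equation holds. *)
have gamma_gt k : -1 < gamma k.
  by apply: lt_le_trans (gamma_ge k); rewrite ltrDl divr_gt0// ltr0n.
have [A [B [A1 B1 fA fB]]] := alpha_bounds r_gt0 gamma_gt.
split; first by move=> z; exact: (jgamma_in_Hspace r_gt0 gamma_gt A1 fA).
exists (fourier_map r_gt0 gamma_gt A1 fA).
  by move=> T z; exact: fourier_mapE.
split; first exact: fourier_map_linear.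
split; first exact: fourier_map_continuous.
exists (inverse_map r_gt0 gamma_gt B1 fB); split.
- exact: fourier_mapK.
- exact: inverse_mapK.
- exact: inverse_map_continuous.
Qed.
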